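(* Let $\mu>0$, $\delta<0$, $a_0>0$, $b:=\sqrt{2|\delta|}$, and let $\bar\rho$ be the solution of $(\bar\rho^{1/3})''+\frac{2}{y}(\bar\rho^{1/3})'+\frac14\bar\rho+\frac34\delta=0$, $\bar\rho(0)=1$, $\bar\rho'(0)=0$, with first zero $R_0\in(0,\infty)$ (positive on $[0,R_0)$). Set $\bar\alpha(s):=a_0e^{bs}$. Let $\phi(x,s)$, $x\in[0,R_0]$, $\phi>-1$, be a smooth solution of $$\frac{1}{(1+\phi)^2}\Big(x\bar\rho\phi_{ss}+\frac b2x\bar\rho\phi_s\Big)+\Big(\frac{1}{(1+\phi)^4}-\frac{1}{1+\phi}\Big)|\delta|x\bar\rho+\Big[\Big(\frac{\bar\rho}{(1+\phi)^2(1+\phi+x\phi_x)}\Big)^{4/3}\Big]_x-\frac{(\bar\rho^{4/3})_x}{(1+\phi)^4}=a_0^{5/2}e^{\frac52bs}\Big(\bar{\mathfrak B}_x+4\mu\Big(\frac{\phi_s}{1+\phi}\Big)_x\Big),$$ where $\bar{\mathfrak B}:=\frac43\mu\big(\frac{\phi_s+x\phi_{xs}}{1+\phi+x\phi_x}-\frac{\phi_s}{1+\phi}\big)$, with boundary condition $\bar{\mathfrak B}(R_0,s)=0$ and initial data $(\phi,\phi_s)|_{s=0}=(\phi_0,\phi_1)$, $\phi_0>-1$. Define the energy $$E(\phi,\phi_s):=\bar\alpha^{-1}\!\int_0^{R_0}\!x^4\bar\rho\Big(\tfrac12\phi_s^2+\sqrt{2|\delta|}(1+\phi)\phi_s-\delta(1+\phi)^2+\frac{\delta}{1+\phi}\Big)dx+\bar\alpha^{-1}\!\int_0^{R_0}\!x^2\bar\rho^{4/3}\Big\{\frac{3}{((1+\phi)^2(1+\phi+x\phi_x))^{1/3}}-\frac{3}{1+\phi}+\frac{x\phi_x}{(1+\phi)^2}\Big\}dx,$$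 and write $E(\phi_0,\phi_1)$ for its value at $s=0$. Suppose one of the following holds: (1) the perturbation is homogeneous, i.e. $\phi_0,\phi_1$ are constants (so $\phi=\phi(s)$), and $\phi_1\neq-\sqrt{2|\delta|}(1+\phi_0)+\sqrt{2|\delta|}(1+\phi_0)^{-1/2}$; (2) $E(\phi_0,\phi_1)\le0$ and the perturbation is inhomogeneous (not spatially constant). Then for any $0<\bar\varepsilon_0<0.5$, no matter how small the initial perturbation is, there exists $\bar T>0$ such that $\max\{\|\phi(s)\|_{L^\infty_x},\|x\phi_x(s)\|_{L^\infty_x}\}>\bar\varepsilon_0$ for $t>\bar T$, where $s=s(t)$.
   Context: This describes perturbations of the self-similarly expanding homogeneous solution of the spherically symmetric isentropic radiation gaseous star system (pressure $p=\rho^{4/3}$, monatomic viscosity $\mu>0$, $2\mu+3\lambda=0$): $\rho_\alpha=\alpha^{-3}(t)\bar\rho(r/\alpha)$, $u_\alpha=\alpha'(t)r/\alpha$, with $\alpha(t)=(a_0^{3/2}+\frac32a_0^{1/2}a_1t)^{2/3}$ and $a_1=\sqrt{2|\delta|/a_0}$ (escape velocity). In Lagrangian coordinates the particle path is $r(x,t)=\alpha(t)x(1+\phi(x,s(t)))$ with the self-similar time $s(t)=\int_0^t\alpha(\sigma)^{-3/2}d\sigma$, so that $\alpha(t)=\bar\alpha(s(t))$. The zero perturbation $\phi\equiv0$ is the self-similarly expanding solution; the curve $\phi_s=-\sqrt{2|\delta|}(1+\phi)+\sqrt{2|\delta|}(1+\phi)^{-1/2}$ is the set of homogeneous data with zero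 energy containing $(0,0)$. *)

(* Defs.v *)
From Stdlib Require Import Reals Lra List.
From Coquelicot Require Import Coquelicot.
Open Scope R_scope.

(* Real power x^p for x > 0 (and 0 otherwise; only used at nonnegative bases). *)
Definition pw (x p : R) : R := if Rlt_dec 0 x then Rpower x p else 0.

Definition pdx (f : R -> R -> R) (x s : R) : R := Derive (fun y => f y s) x.
Definition pds (f : R -> R -> R) (x s : R) : R := Derive (fun t => f x t) s.

Inductive dir := Dx | Ds.
Fixpoint iterD (l : list dir) (f : R -> R -> R) : R -> R -> R :=
  match l with
  | nil => f
  | Dx :: l' => pdx (iterD l' f)
  | Ds :: l' => pds (iterD l' f)
  end.

Definition smooth2 (f : R -> R -> R) : Prop :=
  forall (l : list dir) (x s : R),
    ex_derive (fun y => iterD l f y s) x /\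
    ex_derive (fun t => iterD l f x t) s /\
    continuity_2d_pt (iterD l f) x s.

Definition bconst (delta : R) : R := sqrt (2 * Rabs delta).

Definition alpha (a0 delta t : R) : R :=
  pw (pw a0 (3/2) + 3/2 * pw a0 (1/2) * sqrt (2 * Rabs delta / a0) * t) (2/3).

Definition stime (a0 delta t : R) : R :=
  RInt (fun sg => pw (alpha a0 delta sg) (-3/2)) 0 t.

Definition Bbar (mu : R) (phi : R -> R -> R) (x s : R) : R :=
  4/3 * mu * ((pds phi x s + x * pdx (pds phi) x s)
                / (1 + phi x s + x * pdx phi x s)
              - pds phi x s / (1 + phi x s)).

Definition pert_eq (mu delta a0 R0 : R) (rho : R -> R) (phi : R -> R -> R)
    (x s : R) : Prop :=
  let b := bconst delta in
  let ph := phi x s in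
  / (1 + ph) ^ 2 * (x * rho x * pds (pds phi) x s + b / 2 * x * rho x * pds phi x s)
  + (/ (1 + ph) ^ 4 - / (1 + ph)) * Rabs delta * x * rho x
  + Derive (fun y => pw (rho y / ((1 + phi y s) ^ 2 * (1 + phi y s + y * pdx phi y s)))
                        (4/3)) x
  - Derive (fun y => pw (rho y) (4/3)) x / (1 + ph) ^ 4
  = pw a0 (5/2) * exp (5/2 * b * s)
    * (Derive (fun y => Bbar mu phi y s) x
       + 4 * mu * Derive (fun y => pds phi y s / (1 + phi y s)) x).

(* Energy E(phi0, phi1) at s = 0 (baralpha(0) = a0); phi0' = dphi0. *)
Definition energy0 (delta a0 R0 : R) (rho : R -> R) (phi0 phi1 : R -> R) : R :=
  / a0 * RInt (fun x => x ^ 4 * rho x *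
        (1/2 * (phi1 x) ^ 2 + sqrt (2 * Rabs delta) * (1 + phi0 x) * phi1 x
         - delta * (1 + phi0 x) ^ 2 + delta / (1 + phi0 x))) 0 R0
  + / a0 * RInt (fun x => x ^ 2 * pw (rho x) (4/3) *
        (3 / pw ((1 + phi0 x) ^ 2 * (1 + phi0 x + x * Derive phi0 x)) (1/3)
         - 3 / (1 + phi0 x) + x * Derive phi0 x / (1 + phi0 x) ^ 2)) 0 R0.

Definition supnorm (R0 : R) (f : R -> R) : Rbar :=
  Lub_Rbar (fun v => exists x, 0 <= x <= R0 /\ v = Rabs (f x)).

(* Main.v *)
(** Writing [p = 1 + phi], [q = p + x p_x], [v = (ln p)_s] and [w = rho^(1/3)], the momentum equation
    tested with [x^3 p^3 (v - V)], for any spatially constant [V], loses all viscous terms except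
    a dissipation proportional to [((ln p)_xs)^2]. For [V = - b] this is the decay of the physical energy,
    whose only negative part is [- |delta| / p]; hence negative energy, amplified by [exp (b s)],
    forces [p < 1/2] somewhere at all late times.

    If the energy vanishes identically, then [p(x,s) = P(x) g(s)], and the rescaled density solves
    the Lane-Emden equation with a possibly different constant and with the same mass as [rho]. Comparing
    the two profiles through an oscillator energy shows that [P] is constant, so this does not happen
    for inhomogeneous data.

    Homogeneous data stay homogeneous by a Gronwall estimate, obtained by taking for [V] a weighted mean
    of [v]; then [p] solves an ODE with a first integral whose level sets can be analysed directly. *)

Require Import Defs.
From Stdlib Require Import Reals Lra Psatz ClassicalEpsilon.
From Coquelicot Require Import Coquelicot.
Open Scope R_scope.

(** * One- and two-variable calculus *)

(** The viscous prefactor grows exponentially in [s], so viscosity cannot be treated as a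
    perturbation: estimates must come from an identity in which it has a sign. The weight [x^3 p^3]
    provides one, because its derivative [3 x^2 p^2 q] times [visc] is exactly [4 mu x^3 p^3 shear],
    the tested form of the viscous term outside the divergence. This reflects [2 mu + 3 lambda = 0]:
    a homogeneous expansion is not damped at all. Since the particle path is [alpha x p] with
    [alpha = a0 exp (b s)], its logarithmic velocity is [v + b]; this is why [V = - b] gives the
    physical energy.

    In the Gronwall estimate the pressure produces [(ln p)_x], which the variances of [v] and [ln p]
    do not control. Its square is therefore added to the functional. The growth of that part
    contains [(ln p)_x * shear] with weight [x^4], and the dissipation absorbs it because it has the
    same weight, with no factor [rho] that would degenerate at the surface.

    Both ends of the star are singular: the center by the powers [1 / x], the surface by vacuum.
    Equations are used in the open interval only, and the ends are reached by continuity. *)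

Lemma is_derive_eq (f : R -> R) (x l l' : R) :
  is_derive f x l -> l = l' -> is_derive f x l'.
Proof. now intros H <-. Qed.

Lemma Derive_eta_unique (f : R -> R) (x l : R) :
  is_derive f x l -> Derive (fun y => f y) x = l.
Proof. intros H. now apply is_derive_unique. Qed.

Lemma is_derive_continuity_pt (f : R -> R) (x l : R) :
  is_derive f x l -> continuity_pt f x.
Proof.
  intros H. apply derivable_continuous_pt. exists l. now apply is_derive_Reals.
Qed.

(** Derivatives are asked for in the open interval only: the profile and momentum equations hold
    strictly between center and surface, and the monotonicity arguments below have to reach the end
    points by continuity. *)
Lemma mvt_open (f df : R -> R) (a b : R) :
  a < b ->
  (forall x, a < x < b -> is_derive f x (df x)) ->
  (forall x, a <= x <= b -> continuity_pt f x) ->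
  exists c, a < c < b /\ f b - f a = df c * (b - a).
Proof.
  intros Hab Hd Hc.
  assert (pr : forall c, a < c < b -> derivable_pt f c).
  { intros c Hc'. exists (df c). now apply is_derive_Reals, Hd. }
  assert (pr2 : forall c, a < c < b -> derivable_pt id c).
  { intros c _. apply derivable_pt_id. }
  destruct (MVT f id a b pr pr2 Hab Hc) as [c [P HE]].
  { intros c _. apply derivable_continuous_pt, derivable_pt_id. }
  exists c; split; [exact P|].
  rewrite (derive_pt_eq_0 f c (df c) (pr c P)) in HE
    by (now apply is_derive_Reals, Hd).
  rewrite (derive_pt_eq_0 id c 1 (pr2 c P)) in HE
    by apply derivable_pt_lim_id.
  unfold id in HE. lra.
Qed.

Lemma nonincreasing_of_derive (f df : R -> R) (a b : R) :
  a <= b ->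
  (forall x, a < x < b -> is_derive f x (df x)) ->
  (forall x, a <= x <= b -> continuity_pt f x) ->
  (forall x, a < x < b -> df x <= 0) -> f b <= f a.
Proof.
  intros Hab Hd Hc Hneg.
  destruct (Req_dec a b) as [<-|Hne]; [lra|].
  destruct (mvt_open f df a b ltac:(lra) Hd Hc) as [c [Hc1 Hc2]].
  specialize (Hneg c Hc1). nra.
Qed.

Lemma nondecreasing_of_derive (f df : R -> R) (a b : R) :
  a <= b ->
  (forall x, a < x < b -> is_derive f x (df x)) ->
  (forall x, a <= x <= b -> continuity_pt f x) ->
  (forall x, a < x < b -> 0 <= df x) -> f a <= f b.
Proof.
  intros Hab Hd Hc Hneg.
  destruct (Req_dec a b) as [<-|Hne]; [lra|].
  destruct (mvt_open f df a b ltac:(lra) Hd Hc) as [c [Hc1 Hc2]].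
  specialize (Hneg c Hc1). nra.
Qed.

Lemma constant_of_derive (f : R -> R) (a b : R) :
  a <= b ->
  (forall x, a < x < b -> is_derive f x 0) ->
  (forall x, a <= x <= b -> continuity_pt f x) -> f b = f a.
Proof.
  intros Hab Hd Hc. apply Rle_antisym.
  - apply (nonincreasing_of_derive f (fun _ => 0)); auto; intros; lra.
  - apply (nondecreasing_of_derive f (fun _ => 0)); auto; intros; lra.
Qed.

Lemma continuity_pt_continuous (f : R -> R) (x : R) :
  continuity_pt f x <-> continuous f x.
Proof. apply continuity_pt_filterlim. Qed.

Lemma ex_RInt_continuity (f : R -> R) (a b : R) :
  (forall x, continuity_pt f x) -> ex_RInt f a b.
Proof.
  intros H. apply (ex_RInt_continuous (V := R_CompleteNormedModule)).
  intros x _. now apply continuity_pt_continuous.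
Qed.

Lemma is_derive_primitive (f : R -> R) (a x : R) :
  (forall x, continuity_pt f x) ->
  is_derive (fun x => RInt f a x) x (f x).
Proof.
  intros H. apply is_derive_RInt with a.
  - apply filter_forall. intros y. apply RInt_correct.
    now apply ex_RInt_continuity.
  - now apply continuity_pt_continuous.
Qed.

Lemma RInt_open_ftc (f F : R -> R) (a b : R) :
  a <= b ->
  (forall x, continuity_pt f x) ->
  (forall x, a <= x <= b -> continuity_pt F x) ->
  (forall x, a < x < b -> is_derive F x (f x)) ->
  RInt f a b = F b - F a.
Proof.
  intros Hab Hf HF Hd.
  assert (H : RInt f a b - F b = RInt f a a - F a).
  { apply (constant_of_derive (fun x => RInt f a x - F x)); auto.
    - intros x Hx. eapply is_derive_eq.
      + apply (is_derive_minus (fun x => RInt f a x) F).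
        * now apply is_derive_primitive.
        * now apply Hd.
      + apply (Rminus_diag (f x)).
    - intros x Hx. apply continuity_pt_minus; [|now apply HF].
      eapply is_derive_continuity_pt. now apply is_derive_primitive. }
  rewrite RInt_point in H. change zero with 0 in H. lra.
Qed.

(** A zero total would squeeze the monotone primitive to zero on the whole interval, hence also its
    derivative [f] in the interior. Since [c] may be an end point, continuity is used to carry the
    positivity to an interior point. *)
Lemma RInt_pos_strict (f : R -> R) (a b c : R) :
  a <= b -> (forall x, continuity_pt f x) ->
  (forall x, a <= x <= b -> 0 <= f x) ->
  a <= c <= b -> 0 < f c -> a < b -> 0 < RInt f a b.
Proof.
  intros Hab Hf H0 Hc Hfc Hab'.
  destruct (Rle_lt_or_eq_dec 0 (RInt f a b)) as [H|H]; auto.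
  { apply RInt_ge_0; auto. now apply ex_RInt_continuity.
    intros; apply H0; lra. }
  exfalso.
  assert (HF : forall x, a <= x <= b -> RInt f a x = 0).
  { intros x Hx.
    assert (Hx1 : RInt f a a <= RInt f a x).
    { apply (nondecreasing_of_derive _ f); [lra|..]; intros y Hy.
      - now apply is_derive_primitive.
      - eapply is_derive_continuity_pt; now apply is_derive_primitive.
      - apply H0; lra. }
    assert (Hx2 : RInt f a x <= RInt f a b).
    { apply (nondecreasing_of_derive (fun x => RInt f a x) f); [lra|..]; intros y Hy.
      - now apply is_derive_primitive.
      - eapply is_derive_continuity_pt; now apply is_derive_primitive.
      - apply H0; lra. }
    rewrite RInt_point in Hx1. change zero with 0 in Hx1. lra. }
  assert (Hf0 : forall x, a < x < b -> f x = 0).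
  { intros x Hx.
    assert (H1 : is_derive (fun x => RInt f a x) x (f x)) by now apply is_derive_primitive.
    assert (H2 : is_derive (fun x => RInt f a x) x 0).
    { apply (is_derive_ext_loc (fun _ => 0)).
      - assert (He : 0 < Rmin (x - a) (b - x)) by (apply Rmin_glb_lt; lra).
        exists (mkposreal _ He). intros y Hy. symmetry; apply HF.
        change (Rabs (y - x) < Rmin (x - a) (b - x)) in Hy.
        pose proof (Rmin_l (x - a) (b - x)). pose proof (Rmin_r (x - a) (b - x)).
        apply Rabs_lt_between in Hy. lra.
      - apply (is_derive_const 0). }
    apply is_derive_unique in H1. apply is_derive_unique in H2. congruence. }
  destruct (Hf c (f c) Hfc) as [d [Hd Hd']].
  assert (Hy : exists y, a < y < b /\ y <> c /\ Rabs (y - c) < d).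
  { destruct (Rlt_le_dec c b) as [Hcb|Hcb].
    - exists (c + Rmin (d / 2) ((b - c) / 2)).
      assert (0 < Rmin (d / 2) ((b - c) / 2)) by (apply Rmin_glb_lt; lra).
      pose proof (Rmin_l (d / 2) ((b - c) / 2)). pose proof (Rmin_r (d / 2) ((b - c) / 2)).
      replace (c + Rmin (d / 2) ((b - c) / 2) - c) with (Rmin (d / 2) ((b - c) / 2)) by ring.
      rewrite Rabs_pos_eq; lra.
    - exists (c - Rmin (d / 2) ((c - a) / 2)).
      assert (0 < Rmin (d / 2) ((c - a) / 2)) by (apply Rmin_glb_lt; lra).
      pose proof (Rmin_l (d / 2) ((c - a) / 2)). pose proof (Rmin_r (d / 2) ((c - a) / 2)).
      replace (c - Rmin (d / 2) ((c - a) / 2) - c) with (- Rmin (d / 2) ((c - a) / 2)) by ring.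
      rewrite Rabs_Ropp, Rabs_pos_eq; lra. }
  destruct Hy as [y [Hy1 [Hy2 Hy3]]].
  assert (HD : Rabs (f y - f c) < f c).
  { apply Hd'. split; [|exact Hy3]. split; [exact I|]. auto. }
  rewrite (Hf0 y Hy1) in HD. apply Rabs_lt_between in HD. lra.
Qed.

(** * Continuity in two variables and integrals depending on a parameter *)

Definition cont2 (f : R -> R -> R) : Prop := forall x s, continuity_2d_pt f x s.

Lemma cont2_const c : cont2 (fun _ _ => c).
Proof. intros x s. apply continuity_2d_pt_const. Qed.
Lemma cont2_fst (f : R -> R) : (forall x, continuity_pt f x) -> cont2 (fun x _ => f x).
Proof.
  intros H x s. apply (continuity_1d_2d_pt_comp f (fun x _ => x)); [apply H|].
  apply continuity_2d_pt_id1.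
Qed.
Lemma cont2_snd (f : R -> R) : (forall x, continuity_pt f x) -> cont2 (fun _ s => f s).
Proof.
  intros H x s. apply (continuity_1d_2d_pt_comp f (fun _ s => s)); [apply H|].
  apply continuity_2d_pt_id2.
Qed.
Lemma cont2_id1 : cont2 (fun x _ => x).
Proof. intros x s. apply continuity_2d_pt_id1. Qed.
Lemma cont2_plus f g : cont2 f -> cont2 g -> cont2 (fun x s => f x s + g x s).
Proof. intros Hf Hg x s. now apply continuity_2d_pt_plus. Qed.
Lemma cont2_minus f g : cont2 f -> cont2 g -> cont2 (fun x s => f x s - g x s).
Proof. intros Hf Hg x s. now apply continuity_2d_pt_minus. Qed.
Lemma cont2_mult f g : cont2 f -> cont2 g -> cont2 (fun x s => f x s * g x s).
Proof. intros Hf Hg x s. now apply continuity_2d_pt_mult. Qed.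
Lemma cont2_opp f : cont2 f -> cont2 (fun x s => - f x s).
Proof. intros Hf x s. now apply continuity_2d_pt_opp. Qed.
Lemma cont2_div f g : cont2 f -> cont2 g -> (forall x s, g x s <> 0) ->
  cont2 (fun x s => f x s / g x s).
Proof.
  intros Hf Hg H0 x s. apply continuity_2d_pt_mult; [apply Hf|].
  apply continuity_2d_pt_inv; auto.
Qed.
Lemma cont2_pow f n : cont2 f -> cont2 (fun x s => f x s ^ n).
Proof.
  intros Hf. induction n as [|n IH]; simpl; [apply cont2_const|].
  now apply cont2_mult.
Qed.
Lemma cont2_comp (h : R -> R) f : (forall x s, continuity_pt h (f x s)) -> cont2 f ->
  cont2 (fun x s => h (f x s)).
Proof. intros Hh Hf x s. apply continuity_1d_2d_pt_comp; auto. Qed.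
Lemma cont2_exp f : cont2 f -> cont2 (fun x s => exp (f x s)).
Proof.
  apply cont2_comp. intros x s. apply derivable_continuous_pt, derivable_pt_exp.
Qed.
Lemma cont2_ln f : cont2 f -> (forall x s, 0 < f x s) -> cont2 (fun x s => ln (f x s)).
Proof.
  intros H H0. apply cont2_comp; auto. intros x s. apply derivable_continuous_pt.
  exists (/ f x s). apply derivable_pt_lim_ln, H0.
Qed.
Lemma cont2_slice1 f s : cont2 f -> forall x, continuity_pt (fun x => f x s) x.
Proof.
  intros H x e He. destruct (H x s (mkposreal e He)) as [d Hd].
  exists d. split; [apply cond_pos|]. intros y [_ Hy]. apply Hd; [exact Hy|].
  rewrite Rminus_diag, Rabs_R0. apply cond_pos.
Qed.
Lemma cont2_slice2 f x : cont2 f -> forall s, continuity_pt (fun s => f x s) s.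
Proof.
  intros H s e He. destruct (H x s (mkposreal e He)) as [d Hd].
  exists d. split; [apply cond_pos|]. intros y [_ Hy]. apply Hd; [|exact Hy].
  rewrite Rminus_diag, Rabs_R0. apply cond_pos.
Qed.

(** A gauge argument: the gauge at [(u, v)] is taken below [1 / (|f u v| + 1)], so that the uniform
    lower bound on gauges supplied by [compactness_value_2d] turns into an upper bound for [|f|]. *)
Lemma cont2_bounded f a b c d : cont2 f ->
  exists M, 0 < M /\ forall x s, a <= x <= b -> c <= s <= d -> Rabs (f x s) <= M.
Proof.
  intros Hf.
  assert (Hd : forall u v, exists e : posreal,
     (e <= / (Rabs (f u v) + 1)) /\
     forall x s, Rabs (x - u) < e -> Rabs (s - v) < e -> Rabs (f x s - f u v) < 1).
  { intros u v. destruct (Hf u v (mkposreal 1 Rlt_0_1)) as [e He].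
    assert (Hp : 0 < / (Rabs (f u v) + 1)).
    { apply Rinv_0_lt_compat. pose proof (Rabs_pos (f u v)). lra. }
    assert (Hm : 0 < Rmin e (/ (Rabs (f u v) + 1))) by (apply Rmin_glb_lt; [apply cond_pos|exact Hp]).
    exists (mkposreal _ Hm). simpl. split; [apply Rmin_r|].
    intros x s Hx Hs. apply He.
    - eapply Rlt_le_trans; [exact Hx|apply Rmin_l].
    - eapply Rlt_le_trans; [exact Hs|apply Rmin_l]. }
  set (del u v := proj1_sig (constructive_indefinite_description _ (Hd u v))).
  destruct (compactness_value_2d a b c d del) as [e He].
  exists (/ e + 1). pose proof (Rinv_0_lt_compat e (cond_pos e)). split; [lra|].
  intros x s Hx Hs. apply NNPP. intros Hn. apply (He x s Hx Hs).
  intros [u [v [_ [_ [H1 [H2 H3]]]]]]. apply Hn. clear Hn.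
  unfold del in H1, H2, H3.
  destruct (constructive_indefinite_description _ (Hd u v)) as [g [Hg1 Hg2]].
  simpl in H1, H2, H3. specialize (Hg2 x s H1 H2).
  assert (Hfu : Rabs (f u v) + 1 <= / e).
  { rewrite <- (Rinv_inv (Rabs (f u v) + 1)). apply Rinv_le_contravar; [apply cond_pos|].
    lra. }
  pose proof (Rabs_triang (f x s - f u v) (f u v)).
  replace (f x s - f u v + f u v) with (f x s) in H0 by ring. lra.
Qed.

Lemma RInt_param_continuity (f : R -> R -> R) (a b : R) : a <= b -> cont2 f ->
  forall s, continuity_pt (fun s => RInt (fun x => f x s) a b) s.
Proof.
  intros Hab Hf s e He.
  assert (He' : 0 < e / (2 * (b - a + 1))).
  { apply Rdiv_lt_0_compat; lra. }
  destruct (uniform_continuity_2d_1d f a b s (fun x _ => Hf x s) (mkposreal _ He')) as [d Hd].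
  exists d. split; [apply cond_pos|]. intros t [_ Ht].
  unfold dist in *; simpl in *; unfold Rdist in *.
  assert (Hi : forall s, ex_RInt (fun x => f x s) a b).
  { intros s'. apply ex_RInt_continuity. intros x. now apply (cont2_slice1 f s'). }
  replace (RInt (fun x => f x t) a b - RInt (fun x => f x s) a b)
    with (RInt (fun x => f x t - f x s) a b)
    by (apply (RInt_minus (V := R_CompleteNormedModule) (fun x => f x t)); apply Hi).
  eapply Rle_lt_trans.
  - apply abs_RInt_le_const with (M := e / (2 * (b - a + 1))); auto.
    + apply (ex_RInt_minus (V := R_NormedModule)); apply Hi.
    + intros x Hx. left. apply Hd; auto.
      * pose proof (cond_pos d); lra.
      * apply Rabs_lt_between in Ht. lra.
      * rewrite Rminus_diag, Rabs_R0. apply cond_pos.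
  - replace e with (e / (2 * (b - a + 1)) * (2 * (b - a + 1))) at 2 by (field; lra).
    rewrite Rmult_comm. apply Rmult_lt_compat_l; lra.
Qed.

(** For [a <= b] this is the 1-Lipschitz retraction onto [[a, b]]. Composing with it extends
    continuity and positivity from the interval to the whole line, so that later hypotheses can be
    stated globally. *)
Definition clamp (a b x : R) : R := Rmax a (Rmin x b).

Lemma clamp_id a b x : a <= x <= b -> clamp a b x = x.
Proof. intros H. unfold clamp. rewrite Rmin_left, Rmax_right; lra. Qed.

Lemma clamp_in a b x : a <= b -> a <= clamp a b x <= b.
Proof.
  intros H. unfold clamp. split; [apply Rmax_l|]. apply Rmax_lub; [exact H|apply Rmin_r].
Qed.

Lemma Rmin_spec x y : (x <= y /\ Rmin x y = x) \/ (y < x /\ Rmin x y = y).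
Proof.
  destruct (Rle_lt_dec x y); [left; rewrite Rmin_left|right; rewrite Rmin_right]; lra.
Qed.

Lemma Rmax_spec x y : (x <= y /\ Rmax x y = y) \/ (y < x /\ Rmax x y = x).
Proof.
  destruct (Rle_lt_dec x y); [left; rewrite Rmax_right|right; rewrite Rmax_left]; lra.
Qed.

Lemma clamp_lipschitz a b x y : Rabs (clamp a b x - clamp a b y) <= Rabs (x - y).
Proof.
  unfold clamp.
  destruct (Rmin_spec x b) as [[? ->]|[? ->]], (Rmin_spec y b) as [[? ->]|[? ->]];
  repeat match goal with
  | |- context [Rmax a ?u] => destruct (Rmax_spec a u) as [[? ->]|[? ->]]
  end; unfold Rabs; repeat destruct Rcase_abs; lra.
Qed.

Lemma continuity_pt_clamp a b x : continuity_pt (clamp a b) x.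
Proof.
  intros e He. exists e. split; auto. intros y [_ Hy].
  eapply Rle_lt_trans; [apply clamp_lipschitz|exact Hy].
Qed.

(** The derivative is known only for [x] in [[a, b]], while [is_derive_RInt_param] wants it jointly
    continuous around every point, end points included. Evaluating at [clamp a b x] provides this
    without changing the integral. *)
Lemma RInt_param_derive (f g : R -> R -> R) (a b s : R) : a <= b ->
  cont2 f -> cont2 g -> 0 < s ->
  (forall x t, a <= x <= b -> 0 < t -> is_derive (fun t => f x t) t (g x t)) ->
  is_derive (fun t => RInt (fun x => f x t) a b) s (RInt (fun x => g x s) a b).
Proof.
  intros Hab Hf Hg Hs Hd.
  assert (Hl : locally s (fun t => 0 < t)).
  { exists (mkposreal s Hs). intros t Ht. change (Rabs (t - s) < s) in Ht.
    apply Rabs_lt_between in Ht. lra. }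
  assert (Hc : forall x t, 0 < t -> is_derive (fun t => f (clamp a b x) t) t (g (clamp a b x) t)).
  { intros x t Ht. apply Hd; auto. now apply clamp_in. }
  apply (is_derive_ext (fun t => RInt (fun x => f (clamp a b x) t) a b)).
  { intros t. apply RInt_ext. intros x Hx. rewrite Rmin_left, Rmax_right in Hx by exact Hab.
    rewrite clamp_id; [reflexivity|lra]. }
  eapply is_derive_eq.
  - apply (is_derive_RInt_param (fun t x => f (clamp a b x) t) a b s).
    + eapply filter_imp; [|exact Hl].
      intros t Ht x _. exists (g (clamp a b x) t). now apply Hc.
    + intros x _. apply (continuity_2d_pt_ext_loc (fun u v => g (clamp a b v) u)).
      * destruct Hl as [e He]. exists e. intros u v Hu Hv.
        symmetry. apply is_derive_unique, Hc, He. exact Hu.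
      * intros e. destruct (Hg (clamp a b x) s e) as [d Hd']. exists d. intros u v Hu Hv.
        apply Hd'; [|exact Hu]. eapply Rle_lt_trans; [apply clamp_lipschitz|exact Hv].
    + apply filter_forall. intros t. apply ex_RInt_continuity.
      intros x. apply (continuity_pt_comp (clamp a b) (fun x => f x t)).
      * apply continuity_pt_clamp.
      * now apply (cont2_slice1 f t).
  - apply RInt_ext. intros x Hx. rewrite Rmin_left, Rmax_right in Hx by exact Hab.
    transitivity (g (clamp a b x) s); [now apply is_derive_unique, Hc|].
    rewrite clamp_id; [reflexivity|lra].
Qed.

Lemma RInt_plus_cont (f g : R -> R) a b :
  (forall x, continuity_pt f x) -> (forall x, continuity_pt g x) ->
  RInt (fun x => f x + g x) a b = RInt f a b + RInt g a b.
Proof.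
  intros Hf Hg. apply (RInt_plus (V := R_CompleteNormedModule)); now apply ex_RInt_continuity.
Qed.

Lemma RInt_scal_cont (f : R -> R) c a b :
  (forall x, continuity_pt f x) ->
  RInt (fun x => c * f x) a b = c * RInt f a b.
Proof.
  intros Hf. apply (RInt_scal (V := R_CompleteNormedModule)); now apply ex_RInt_continuity.
Qed.

Lemma RInt_ext_le (f g : R -> R) a b : a <= b ->
  (forall x, a < x < b -> f x = g x) -> RInt f a b = RInt g a b.
Proof.
  intros Hab H. apply RInt_ext. intros x Hx.
  rewrite Rmin_left, Rmax_right in Hx by exact Hab. now apply H.
Qed.

Lemma RInt_le_cont (f g : R -> R) a b : a <= b ->
  (forall x, continuity_pt f x) -> (forall x, continuity_pt g x) ->
  (forall x, a < x < b -> f x <= g x) -> RInt f a b <= RInt g a b.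
Proof.
  intros Hab Hf Hg H. apply RInt_le; auto; now apply ex_RInt_continuity.
Qed.

Ltac cont2_auto := repeat first
  [ assumption
  | apply cont2_const
  | match goal with
    | H : cont2 ?f |- cont2 (fun x s => ?f x s) => exact H
    | H : forall x, continuity_pt ?f x |- cont2 (fun x _ => ?f x) => exact (cont2_fst f H)
    | H : forall x, continuity_pt ?f x |- cont2 (fun _ s => ?f s) => exact (cont2_snd f H)
    | |- cont2 (fun x _ => x) => apply cont2_id1
    | |- cont2 (fun x s => @?f x s + @?g x s) => apply (cont2_plus f g)
    | |- cont2 (fun x s => @?f x s - @?g x s) => apply (cont2_minus f g)
    | |- cont2 (fun x s => @?f x s / @?g x s) => apply (cont2_div f g)
    | |- cont2 (fun x s => @?f x s * @?g x s) => apply (cont2_mult f g)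
    | |- cont2 (fun x s => - @?f x s) => apply (cont2_opp f)
    | |- cont2 (fun x s => @?f x s ^ ?n) => apply (cont2_pow f n)
    | |- cont2 (fun x s => exp (@?f x s)) => apply (cont2_exp f)
    | |- cont2 (fun x s => ln (@?f x s)) => apply (cont2_ln f)
    end ].

Ltac splits := repeat match goal with |- _ /\ _ => split end.

Ltac ex_der := splits; match goal with
  | |- True => exact I
  | H : forall x, _ -> is_derive ?f x _ |- ex_derive (fun y => ?f y) _ =>
      eexists; apply H; lra
  end.

Ltac ex_der_at := splits; try match goal with
  | |- True => exact I
  | H : is_derive ?f ?x ?l |- ex_derive (fun y => ?f y) ?x => exists l; exact H
  end.

(** * Lane-Emden profiles of equal mass *)

(** The supremum of the points of [[0, b]] where [f] is nonnegative is the last zero before the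
    negative value at [b]. *)
Lemma last_nonneg (f : R -> R) (b : R) :
  0 < b -> (forall x, continuity_pt f x) -> f 0 = 0 -> f b < 0 ->
  exists c, 0 <= c < b /\ f c = 0 /\ forall x, c < x <= b -> f x < 0.
Proof.
  intros Hb Hc H0 Hfb.
  destruct (completeness (fun x => 0 <= x <= b /\ 0 <= f x)) as [c [Hc1 Hc2]].
  { exists b. intros x [Hx _]. lra. }
  { exists 0. lra. }
  assert (Hc0 : 0 <= c) by (apply Hc1; lra).
  assert (Hcb : c <= b) by (apply Hc2; intros x [Hx _]; lra).
  assert (Hlt : forall x, c < x <= b -> f x < 0).
  { intros x Hx. destruct (Rlt_le_dec (f x) 0) as [H|H]; auto.
    assert (x <= c) by (apply Hc1; lra). lra. }
  assert (Hge : 0 <= f c).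
  { destruct (Rle_lt_dec 0 (f c)) as [H|H]; auto. exfalso.
    destruct (Hc c (- f c) ltac:(lra)) as [d [Hd Hd']].
    assert (c <= c - d).
    { apply Hc2. intros x [Hx1 Hx2]. apply Rnot_lt_le. intros Hx3.
      assert (x <= c) by (apply Hc1; lra).
      destruct (Req_dec x c) as [->|Hne]; [lra|].
      assert (HD : Rabs (f x - f c) < - f c).
      { apply Hd'. split; [split; [exact I|auto]|].
        simpl. unfold Rdist. rewrite Rabs_left1; lra. }
      apply Rabs_lt_between in HD. lra. }
    lra. }
  assert (Hcb' : c < b).
  { destruct (Req_dec c b) as [->|Hne]; lra. }
  exists c. repeat split; auto; try lra.
  destruct (Rle_lt_or_eq_dec _ _ Hge) as [H|H]; auto. exfalso.
  destruct (Hc c (f c) H) as [d [Hd Hd']].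
  set (x := c + Rmin (d / 2) (b - c)).
  assert (Hm : 0 < Rmin (d / 2) (b - c)) by (apply Rmin_glb_lt; lra).
  pose proof (Rmin_l (d / 2) (b - c)). pose proof (Rmin_r (d / 2) (b - c)).
  assert (HD : Rabs (f x - f c) < f c).
  { apply Hd'. unfold x. split; [split; [exact I|lra]|].
    simpl. unfold Rdist. rewrite Rabs_pos_eq; lra. }
  apply Rabs_lt_between in HD.
  assert (f x < 0) by (apply Hlt; unfold x; lra). lra.
Qed.

Lemma pos_near (f : R -> R) (c : R) : continuity_pt f c -> 0 < f c ->
  exists d, 0 < d /\ forall x, Rabs (x - c) < d -> 0 < f x.
Proof.
  intros Hf H. destruct (Hf (f c) H) as [d [Hd Hd']].
  exists d. split; auto. intros x Hx.
  destruct (Req_dec x c) as [->|Hne]; auto.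
  assert (HD : Rabs (f x - f c) < f c).
  { apply Hd'. split; [split; [exact I|auto]|exact Hx]. }
  apply Rabs_lt_between in HD. lra.
Qed.

Ltac cpt := repeat first
  [ assumption
  | apply continuity_pt_const; intros ? ?; reflexivity
  | apply derivable_continuous_pt, derivable_pt_id
  | match goal with
    | H : forall x, continuity_pt ?f x |- continuity_pt (fun y => ?f y) _ => apply H
    | H : forall x, continuity_pt ?f x |- continuity_pt ?f _ => apply H
    | |- continuity_pt (fun x => @?f x + @?g x) _ => apply (continuity_pt_plus f g)
    | |- continuity_pt (fun x => @?f x - @?g x) _ => apply (continuity_pt_minus f g)
    | |- continuity_pt (fun x => @?f x * @?g x) _ => apply (continuity_pt_mult f g)
    | |- continuity_pt (fun x => @?f x / @?g x) _ => apply (continuity_pt_div f g)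
    | |- continuity_pt (fun x => - @?f x) _ => apply (continuity_pt_opp f)
    | |- continuity_pt (fun x => @?f x ^ ?n) _ =>
        apply (continuity_pt_comp f (fun y => y ^ n));
        [ | apply derivable_continuous_pt, derivable_pt_pow ]
    end ].

(* [m - K r ^ 3] is [- 4 r ^ 2 dW/dr]; at a point where it vanishes the decreasing energy
   [(dW/dr)^2/2 + W^4/16 - 3KW/4], which is nonnegative at the surface, forces
   [W ^ 3 >= 12 K], so that [m - K r ^ 3] is increasing there. *)
Lemma profile_nonincreasing (L K : R) (r dr W m g : R -> R) :
  0 < L ->
  (forall x, continuity_pt r x) -> (forall x, continuity_pt W x) ->
  (forall x, continuity_pt m x) -> (forall x, 0 <= x <= L -> continuity_pt g x) ->
  r 0 = 0 -> W 0 = 1 -> m 0 = 0 -> W L = 0 -> g 0 = 0 ->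
  (forall x, 0 <= x < L -> 0 < W x) -> (forall x, 0 < x <= L -> 0 < r x) ->
  (forall x, 0 < x <= L -> g x = (K * r x - m x / r x ^ 2) / 4) ->
  (forall x, 0 < x < L -> 0 < dr x) ->
  (forall x, 0 < x < L -> is_derive r x (dr x)) ->
  (forall x, 0 < x < L -> is_derive W x (dr x * g x)) ->
  (forall x, 0 < x < L -> is_derive m x (dr x * (r x ^ 2 * W x ^ 3))) ->
  forall x, 0 < x < L -> g x <= 0.
Proof.
  intros HR Cr CW Cm Cg r0 W0 m0 WR g0 Wpos rpos Hg drpos Dr DW Dm.
  (* In the variable [r] this is the Lane-Emden equation [W'' + 2 W' / r + W^3 / 4 = 3 K / 4],
     recovered from its integrated form. *)
  assert (Dg : forall x, 0 < x < L ->
    is_derive g x (dr x * (- 2 * g x / r x + 3 / 4 * K - W x ^ 3 / 4))).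
  { intros x Hx.
    apply (is_derive_ext_loc (fun x => (K * r x - m x / r x ^ 2) / 4)).
    { assert (He : 0 < Rmin x (L - x)) by (apply Rmin_glb_lt; lra).
      exists (mkposreal _ He). intros y Hy. symmetry; apply Hg.
      change (Rabs (y - x) < Rmin x (L - x)) in Hy.
      pose proof (Rmin_l x (L - x)). pose proof (Rmin_r x (L - x)).
      apply Rabs_lt_between in Hy. lra. }
    assert (Hrx : r x <> 0) by (specialize (rpos x ltac:(lra)); lra).
    auto_derive.
    - splits; match goal with
      | |- ex_derive (fun y => r y) _ => exists (dr x); exact (Dr x Hx)
      | |- ex_derive (fun y => m y) _ => eexists; exact (Dm x Hx)
      | |- True => exact I
      | |- _ <> 0 => rewrite Rmult_1_r;
          apply Rmult_integral_contrapositive_currified; exact Hrx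
      end.
    - rewrite (Derive_eta_unique _ _ _ (Dr x Hx)), (Derive_eta_unique _ _ _ (Dm x Hx)).
      rewrite Hg by lra. field. exact Hrx. }
  set (en x := g x ^ 2 / 2 + W x ^ 4 / 16 - 3 / 4 * K * W x).
  assert (Hen : forall x, 0 <= x <= L -> 0 <= en x).
  { intros x Hx. apply Rle_trans with (en L).
    - unfold en. rewrite WR. pose proof (pow2_ge_0 (g L)). lra.
    - apply (nonincreasing_of_derive en (fun x => - 2 * dr x * g x ^ 2 / r x)); [lra|..].
      + intros y Hy. unfold en.
        assert (Hry : r y <> 0) by (specialize (rpos y ltac:(lra)); lra).
        auto_derive.
        * ex_der.
        * rewrite (Derive_eta_unique _ _ _ (Dg y ltac:(lra))),
            (Derive_eta_unique _ _ _ (DW y ltac:(lra))). field. exact Hry.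
      + intros y Hy. unfold en. specialize (Cg y ltac:(lra)). cpt; lra.
      + intros y Hy. specialize (rpos y ltac:(lra)). specialize (drpos y ltac:(lra)).
        assert (0 <= dr y * g y ^ 2 / r y).
        { apply Rmult_le_pos; [|left; now apply Rinv_0_lt_compat].
          pose proof (pow2_ge_0 (g y)). nra. }
        unfold Rdiv in *. lra. }
  set (n x := m x - K * r x ^ 3).
  assert (Hng : forall x, 0 < x <= L -> n x = - 4 * r x ^ 2 * g x).
  { intros x Hx. unfold n. rewrite Hg by lra. specialize (rpos x Hx). field. lra. }
  assert (Dn : forall x, 0 < x < L -> is_derive n x (dr x * r x ^ 2 * (W x ^ 3 - 3 * K))).
  { intros x Hx. unfold n. auto_derive.
    - ex_der.
    - rewrite (Derive_eta_unique _ _ _ (Dr x Hx)), (Derive_eta_unique _ _ _ (Dm x Hx)). ring. }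
  assert (Cn : forall x, continuity_pt n x) by (intros x; unfold n; cpt).
  intros x0 Hx0. destruct (Rle_lt_dec (g x0) 0) as [H|H]; auto. exfalso.
  destruct (last_nonneg n x0) as [c [Hc [Hnc Hneg]]]; try lra; auto.
  { unfold n. rewrite r0, m0. ring. }
  { rewrite Hng by lra. specialize (rpos x0 ltac:(lra)).
    assert (0 < r x0 ^ 2) by nra. nra. }
  assert (Hgc : g c = 0).
  { destruct (Req_dec c 0) as [->|Hne]; auto.
    rewrite Hng in Hnc by lra. specialize (rpos c ltac:(lra)).
    assert (0 < r c ^ 2) by nra. nra. }
  assert (HW : 0 < W c ^ 3 - 3 * K).
  { specialize (Hen c ltac:(lra)). specialize (Wpos c ltac:(lra)).
    unfold en in Hen. rewrite Hgc in Hen.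
    assert (0 < W c ^ 3) by (now apply pow_lt).
    assert (0 <= W c * (W c ^ 3 - 12 * K)) by nra.
    assert (0 <= W c ^ 3 - 12 * K) by nra. nra. }
  destruct (pos_near (fun x => W x ^ 3 - 3 * K) c) as [d [Hd Hd']]; [cpt|exact HW|].
  set (x := c + Rmin (d / 2) (x0 - c)).
  assert (Hm : 0 < Rmin (d / 2) (x0 - c)) by (apply Rmin_glb_lt; lra).
  pose proof (Rmin_l (d / 2) (x0 - c)). pose proof (Rmin_r (d / 2) (x0 - c)).
  assert (Hnx : n x < 0) by (apply Hneg; unfold x; lra).
  assert (n c <= n x).
  { apply (nondecreasing_of_derive n (fun x => dr x * r x ^ 2 * (W x ^ 3 - 3 * K))); auto.
    - unfold x; lra.
    - intros y Hy. apply Dn. unfold x in Hy; lra.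
    - intros y Hy. unfold x in Hy.
      specialize (drpos y ltac:(lra)). specialize (Hd' y ltac:(rewrite Rabs_pos_eq; lra)).
      apply Rmult_le_pos; [apply Rmult_le_pos|]; try lra. apply pow2_ge_0. }
  lra.
Qed.

(* The difference [W1 - W2] satisfies an oscillator equation with a nonincreasing coefficient
   and constant forcing [3/4 (K1 - K2)], so its energy stays nonpositive. *)
Lemma profile_comparison (X K1 K2 : R) (r dr W1 W2 m1 m2 g1 g2 : R -> R) :
  0 < X ->
  (forall x, 0 <= x <= X -> continuity_pt W1 x) ->
  (forall x, 0 <= x <= X -> continuity_pt W2 x) ->
  (forall x, 0 <= x <= X -> continuity_pt g1 x) ->
  (forall x, 0 <= x <= X -> continuity_pt g2 x) ->
  W1 0 = 1 -> W2 0 = 1 -> g1 0 = 0 -> g2 0 = 0 ->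
  (forall x, 0 <= x <= X -> 0 <= W1 x) -> (forall x, 0 <= x <= X -> 0 <= W2 x) ->
  (forall x, 0 < x < X -> 0 < r x) ->
  (forall x, 0 < x < X -> g1 x = (K1 * r x - m1 x / r x ^ 2) / 4) ->
  (forall x, 0 < x < X -> g2 x = (K2 * r x - m2 x / r x ^ 2) / 4) ->
  (forall x, 0 < x < X -> g1 x <= 0) -> (forall x, 0 < x < X -> g2 x <= 0) ->
  (forall x, 0 < x < X -> 0 < dr x) ->
  (forall x, 0 < x < X -> is_derive r x (dr x)) ->
  (forall x, 0 < x < X -> is_derive W1 x (dr x * g1 x)) ->
  (forall x, 0 < x < X -> is_derive W2 x (dr x * g2 x)) ->
  (forall x, 0 < x < X -> is_derive m1 x (dr x * (r x ^ 2 * W1 x ^ 3))) ->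
  (forall x, 0 < x < X -> is_derive m2 x (dr x * (r x ^ 2 * W2 x ^ 3))) ->
  forall x, 0 <= x <= X ->
    (K2 <= K1 -> W2 x <= W1 x) /\ (K1 <= K2 -> W1 x <= W2 x).
Proof.
  intros HX CW1 CW2 Cg1 Cg2 W10 W20 g10 g20 W1p W2p rpos Hg1 Hg2 g1n g2n drpos
    Dr DW1 DW2 Dm1 Dm2.
  assert (Hnear : forall x, 0 < x < X -> locally x (fun y => 0 < y < X)).
  { intros x Hx. assert (He : 0 < Rmin x (X - x)) by (apply Rmin_glb_lt; lra).
    exists (mkposreal _ He). intros y Hy.
    change (Rabs (y - x) < Rmin x (X - x)) in Hy.
    pose proof (Rmin_l x (X - x)). pose proof (Rmin_r x (X - x)).
    apply Rabs_lt_between in Hy. lra. }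
  assert (Dg : forall K W m g,
    (forall x, 0 < x < X -> g x = (K * r x - m x / r x ^ 2) / 4) ->
    (forall x, 0 < x < X -> is_derive m x (dr x * (r x ^ 2 * W x ^ 3))) ->
    forall x, 0 < x < X ->
    is_derive g x (dr x * (- 2 * g x / r x + 3 / 4 * K - W x ^ 3 / 4))).
  { intros K W m g Hg Dm x Hx.
    apply (is_derive_ext_loc (fun x => (K * r x - m x / r x ^ 2) / 4)).
    { eapply filter_imp; [|now apply Hnear]. intros y Hy. symmetry. now apply Hg. }
    assert (Hrx : r x <> 0) by (specialize (rpos x ltac:(lra)); lra).
    auto_derive.
    - splits; match goal with
      | |- ex_derive (fun y => r y) _ => exists (dr x); exact (Dr x Hx)
      | |- ex_derive (fun y => m y) _ => eexists; exact (Dm x Hx)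
      | |- True => exact I
      | |- _ <> 0 => rewrite Rmult_1_r;
          apply Rmult_integral_contrapositive_currified; exact Hrx
      end.
    - rewrite (Derive_eta_unique _ _ _ (Dr x Hx)), (Derive_eta_unique _ _ _ (Dm x Hx)).
      rewrite Hg by lra. field. exact Hrx. }
  pose proof (Dg K1 W1 m1 g1 Hg1 Dm1) as Dg1.
  pose proof (Dg K2 W2 m2 g2 Hg2 Dm2) as Dg2. clear Dg.
  (* [W1^3 - W2^3 = 4 c (W1 - W2)], so [c] is the oscillator coefficient of the difference; it does
     not increase because both profiles are nonnegative and nonincreasing. *)
  set (c x := (W1 x ^ 2 + W1 x * W2 x + W2 x ^ 2) / 4).
  set (e x := (g1 x - g2 x) ^ 2 / 2 + c x * (W1 x - W2 x) ^ 2 / 2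
              - 3 / 4 * (K1 - K2) * (W1 x - W2 x)).
  intros x Hx.
  assert (He : e x <= e 0).
  { apply (nonincreasing_of_derive e (fun x => dr x * (- 2 * (g1 x - g2 x) ^ 2 / r x
     + (W1 x - W2 x) ^ 2 / 8 *
       ((2 * W1 x + W2 x) * g1 x + (W1 x + 2 * W2 x) * g2 x)))); [lra|..].
    - intros y Hy. unfold e, c.
      assert (Hry : r y <> 0) by (specialize (rpos y ltac:(lra)); lra).
      auto_derive.
      + ex_der.
      + rewrite (Derive_eta_unique _ _ _ (Dg1 y ltac:(lra))),
          (Derive_eta_unique _ _ _ (DW1 y ltac:(lra))),
          (Derive_eta_unique _ _ _ (Dg2 y ltac:(lra))),
          (Derive_eta_unique _ _ _ (DW2 y ltac:(lra))). field. exact Hry.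
    - intros y Hy. unfold e, c. specialize (Cg1 y ltac:(lra)). specialize (Cg2 y ltac:(lra)).
      specialize (CW1 y ltac:(lra)). specialize (CW2 y ltac:(lra)). cpt; lra.
    - intros y Hy. specialize (rpos y ltac:(lra)). specialize (drpos y ltac:(lra)).
      specialize (g1n y ltac:(lra)). specialize (g2n y ltac:(lra)).
      specialize (W1p y ltac:(lra)). specialize (W2p y ltac:(lra)).
      assert (0 <= (g1 y - g2 y) ^ 2 / r y).
      { apply Rmult_le_pos; [apply pow2_ge_0|left; now apply Rinv_0_lt_compat]. }
      assert ((2 * W1 y + W2 y) * g1 y + (W1 y + 2 * W2 y) * g2 y <= 0) by nra.
      pose proof (pow2_ge_0 (W1 y - W2 y)).
      assert ((W1 y - W2 y) ^ 2 / 8 *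
       ((2 * W1 y + W2 y) * g1 y + (W1 y + 2 * W2 y) * g2 y) <= 0) by nra.
      unfold Rdiv in *. nra. }
  assert (e 0 = 0) by (unfold e, c; rewrite W10, W20, g10, g20; field).
  (* A nonnegative quantity is at most [3/4 (K1 - K2) (W1 - W2)], so the difference of the profiles
     cannot have the sign opposite to [K1 - K2]. *)
  assert (Hc : c x * (W1 x - W2 x) ^ 2 / 2 <= 3 / 4 * (K1 - K2) * (W1 x - W2 x)).
  { unfold e in He at 1. pose proof (pow2_ge_0 (g1 x - g2 x)). lra. }
  specialize (W1p x Hx). specialize (W2p x Hx).
  assert (Hlt : forall a b, 0 <= a -> a < b ->
      0 < (a ^ 2 + a * b + b ^ 2) / 4 * (a - b) ^ 2 / 2).
  { intros a b Ha Hab. assert (0 < a ^ 2 + a * b + b ^ 2) by nra.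
    assert (0 < (a - b) ^ 2) by nra. nra. }
  unfold c in Hc. split; intros HK; apply Rnot_lt_le; intros Hw.
  - specialize (Hlt _ _ W1p Hw). nra.
  - specialize (Hlt _ _ W2p Hw).
    replace ((W1 x ^ 2 + W1 x * W2 x + W2 x ^ 2) / 4 * (W1 x - W2 x) ^ 2 / 2)
     with ((W2 x ^ 2 + W2 x * W1 x + W1 x ^ 2) / 4 * (W2 x - W1 x) ^ 2 / 2) in Hc by field.
    nra.
Qed.

(** Label two stars by [x] so that both enclose the mass [m x]: the star [w] puts this mass within
    radius [x], the star [W] within radius [r x]. At equal radii [W x] is compared with [w (r x)];
    the star with the larger constant is at least as dense everywhere, and two stars of equal total
    mass can be ordered in this way only if they coincide. *)
Lemma profile_rigidity (L k K : R) (w m gw r dr W gW : R -> R) :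
  0 < L ->
  (forall x, continuity_pt w x) -> (forall x, continuity_pt m x) ->
  (forall x, continuity_pt gw x) ->
  (forall x, continuity_pt r x) -> (forall x, continuity_pt W x) ->
  (forall x, 0 <= x <= L -> continuity_pt gW x) ->
  w 0 = 1 -> m 0 = 0 -> w L = 0 -> (forall x, 0 <= x < L -> 0 < w x) ->
  gw 0 = 0 -> (forall x, 0 < x <= L -> gw x = (k * x - m x / x ^ 2) / 4) ->
  (forall x, 0 < x < L -> is_derive w x (gw x)) ->
  (forall x, 0 < x < L -> is_derive m x (x ^ 2 * w x ^ 3)) ->
  r 0 = 0 -> (forall x, 0 < x < L -> 0 < dr x) ->
  (forall x, 0 < x < L -> is_derive r x (dr x)) ->
  W 0 = 1 -> W L = 0 -> (forall x, 0 <= x < L -> 0 < W x) ->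
  gW 0 = 0 -> (forall x, 0 < x <= L -> gW x = (K * r x - m x / r x ^ 2) / 4) ->
  (forall x, 0 < x < L -> is_derive W x (dr x * gW x)) ->
  (forall x, 0 < x < L -> x ^ 2 * w x ^ 3 = dr x * (r x ^ 2 * W x ^ 3)) ->
  forall x, 0 <= x <= L -> r x = x.
Proof.
  intros HR Cw Cm Cgw Cr CW CgW w0 m0 wR wpos gw0 Hgw Dw Dm r0 drpos Dr W0 WR Wpos gW0 HgW DW Hmass.
  assert (Dm' : forall x, 0 < x < L -> is_derive m x (dr x * (r x ^ 2 * W x ^ 3))).
  { intros x Hx. rewrite <- Hmass by exact Hx. now apply Dm. }
  assert (rinc : forall x y, 0 <= x -> x < y -> y <= L -> r x < r y).
  { intros x y Hx Hxy Hy.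
    destruct (mvt_open r dr x y Hxy) as [c [Hc1 Hc2]]; auto.
    { intros; apply Dr; lra. }
    specialize (drpos c ltac:(lra)). nra. }
  assert (minc : forall x y, 0 <= x -> x < y -> y <= L -> m x < m y).
  { intros x y Hx Hxy Hy.
    destruct (mvt_open m (fun x => x ^ 2 * w x ^ 3) x y Hxy) as [c [Hc1 Hc2]]; auto.
    { intros; apply Dm; lra. }
    assert (0 < w c ^ 3) by (apply pow_lt, wpos; lra).
    assert (0 < c ^ 2) by (apply pow_lt; lra).
    assert (0 < c ^ 2 * w c ^ 3) by (now apply Rmult_lt_0_compat). nra. }
  assert (minj : forall x y, 0 <= x <= L -> 0 <= y <= L -> m x = m y -> x = y).
  { intros x y Hx Hy He. destruct (Rtotal_order x y) as [H|[H|H]]; auto.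
    - specialize (minc x y ltac:(lra) H ltac:(lra)). lra.
    - specialize (minc y x ltac:(lra) H ltac:(lra)). lra. }
  assert (rpos : forall x, 0 < x <= L -> 0 < r x).
  { intros x Hx. rewrite <- r0. apply rinc; lra. }
  assert (gwn : forall x, 0 < x < L -> gw x <= 0).
  { apply (profile_nonincreasing L k (fun x => x) (fun _ => 1) w m gw); auto; intros; cpt; try lra.
    - apply (is_derive_id (K := R_AbsRing)).
    - rewrite Rmult_1_l. now apply Dw.
    - rewrite Rmult_1_l. now apply Dm. }
  assert (gWn : forall x, 0 < x < L -> gW x <= 0).
  { apply (profile_nonincreasing L K r dr W m gW); auto. }
  assert (wpos' : forall x, 0 <= x <= L -> 0 <= w x).
  { intros x Hx. destruct (Req_dec x L) as [->|Hne]; [lra|]. left; apply wpos; lra. }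
  assert (Wpos' : forall x, 0 <= x <= L -> 0 <= W x).
  { intros x Hx. destruct (Req_dec x L) as [->|Hne]; [lra|]. left; apply Wpos; lra. }
  (* [X] is the largest label for which [r X] lies inside both stars; there at least one of the two
     surfaces is met. *)
  assert (HX : exists X, 0 < X <= L /\ r X <= L /\ (r X = L \/ X = L)).
  { destruct (Rle_lt_dec (r L) L) as [H|H].
    - exists L. repeat split; auto; lra.
    - destruct (IVT (fun x => r x - L) 0 L) as [X [HX1 HX2]]; try lra.
      + intros y. cpt.
      + exists X. assert (X <> 0) by (intros ->; lra). repeat split; try lra. }
  destruct HX as [X [HX [HrX HXR]]].
  assert (Hr : forall x, 0 < x < X -> 0 < r x < L).
  { intros x Hx. split; [apply rpos; lra|]. specialize (rinc x X ltac:(lra) ltac:(lra) ltac:(lra)). lra. }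
  assert (Hr' : forall x, 0 <= x <= X -> 0 <= r x <= L).
  { intros x Hx. destruct (Req_dec x 0) as [->|Hne]; [lra|].
    destruct (Req_dec x X) as [->|Hne']; [specialize (rpos X ltac:(lra)); lra|].
    specialize (Hr x ltac:(lra)). lra. }
  assert (Ccomp : forall f, (forall x, continuity_pt f x) -> forall x, continuity_pt (fun x => f (r x)) x).
  { intros f Hf x. apply (continuity_pt_comp r f); auto. }
  assert (Dcomp : forall f df, (forall x, 0 < x < L -> is_derive f x (df x)) ->
     forall x, 0 < x < X -> is_derive (fun x => f (r x)) x (dr x * df (r x))).
  { intros f df Hf x Hx. apply (is_derive_comp f r); [apply Hf; auto|apply Dr; lra]. }
  assert (Hcmp : forall x, 0 <= x <= X ->
    (k <= K -> w (r x) <= W x) /\ (K <= k -> W x <= w (r x))).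
  { apply (profile_comparison X K k r dr W (fun x => w (r x)) m (fun x => m (r x))
             gW (fun x => gw (r x))); auto; try (intros; apply Ccomp; auto; fail).
    - lra.
    - intros x Hx; apply CgW; lra.
    - now rewrite r0.
    - now rewrite r0.
    - intros x Hx; apply Wpos'; lra.
    - intros x Hx. apply Hr; lra.
    - intros x Hx; apply HgW; lra.
    - intros x Hx; apply Hgw. specialize (Hr x Hx); lra.
    - intros x Hx; apply gWn; lra.
    - intros x Hx; apply drpos; lra.
    - intros x Hx; apply Dr; lra.
    - intros x Hx; apply DW; lra.
    - intros x Hx; apply Dm'; lra.
    - intros x Hx. apply (Dcomp m (fun x => x ^ 2 * w x ^ 3) Dm x Hx). }
  (* Mass of the star [W] minus mass of the star [w] within the common radius [r x]; the comparison
     of densities makes it monotone. *)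
  set (n x := m x - m (r x)).
  assert (Cn : forall x, continuity_pt n x).
  { intros x. unfold n. pose proof (Ccomp m Cm x). cpt. }
  assert (Dn : forall x, 0 < x < X -> is_derive n x (dr x * (r x ^ 2 * (W x ^ 3 - w (r x) ^ 3)))).
  { intros x Hx. eapply is_derive_eq.
    - apply (is_derive_minus m (fun x => m (r x))).
      + apply Dm'; lra.
      + apply (Dcomp m _ Dm x Hx).
    - unfold minus, plus, opp; simpl. ring. }
  assert (n0 : n 0 = 0) by (unfold n; rewrite r0; ring).
  assert (cube : forall a b, 0 <= a -> a <= b -> a ^ 3 <= b ^ 3).
  { intros a b Ha Hab. apply pow_incr; lra. }
  assert (Hup : k <= K -> forall x y, 0 <= x <= y -> y <= X -> n x <= n y).
  { intros HK x y Hxy Hy.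
    apply (nondecreasing_of_derive n (fun x => dr x * (r x ^ 2 * (W x ^ 3 - w (r x) ^ 3)))); auto.
    - lra.
    - intros z Hz; apply Dn; lra.
    - intros z Hz. destruct (Hcmp z ltac:(lra)) as [H _].
      apply Rmult_le_pos; [left; apply drpos; lra|].
      apply Rmult_le_pos; [apply pow2_ge_0|].
      specialize (cube (w (r z)) (W z) (wpos' _ (Hr' z ltac:(lra))) (H HK)). lra. }
  assert (Hdown : K <= k -> forall x y, 0 <= x <= y -> y <= X -> n y <= n x).
  { intros HK x y Hxy Hy.
    apply (nonincreasing_of_derive n (fun x => dr x * (r x ^ 2 * (W x ^ 3 - w (r x) ^ 3)))); auto.
    - lra.
    - intros z Hz; apply Dn; lra.
    - intros z Hz. destruct (Hcmp z ltac:(lra)) as [_ H].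
      specialize (cube (W z) (w (r z)) (Wpos' z ltac:(lra)) (H HK)).
      specialize (drpos z ltac:(lra)). pose proof (pow2_ge_0 (r z)).
      assert (0 <= r z ^ 2 * (w (r z) ^ 3 - W z ^ 3)) by (apply Rmult_le_pos; lra).
      nra. }
  (* The less dense star meets its surface first, and all its mass is then enclosed in a radius
     where the other star has at least as much. As the total masses agree, the two surfaces
     coincide. *)
  assert (HXR' : X = L /\ n L = 0).
  { destruct (Rle_lt_dec k K) as [HK|HK].
    - specialize (Hup HK 0 X ltac:(lra) ltac:(lra)).
      assert (HrR : r X = L).
      { destruct HXR as [H|H]; auto. subst X.
        destruct (Hcmp L ltac:(lra)) as [H _]. specialize (H HK).
        destruct (Req_dec (r L) L); auto.
        specialize (wpos (r L) ltac:(specialize (rpos L ltac:(lra)); lra)). lra. }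
      assert (X = L).
      { destruct (Req_dec X L); auto. specialize (minc X L ltac:(lra) ltac:(lra) ltac:(lra)).
        unfold n in Hup. rewrite HrR, r0 in Hup. lra. }
      subst X. split; auto. unfold n. rewrite HrR. ring.
    - assert (HXeq : X = L).
      { destruct HXR as [H|H]; auto. destruct (Req_dec X L); auto.
        destruct (Hcmp X ltac:(lra)) as [_ H1]. specialize (H1 ltac:(lra)).
        rewrite H, wR in H1. specialize (Wpos X ltac:(lra)). lra. }
      subst X. split; auto.
      specialize (Hdown ltac:(lra) 0 L ltac:(lra) ltac:(lra)).
      unfold n in *. destruct (Req_dec (r L) L) as [->|Hne]; [ring|].
      specialize (minc (r L) L ltac:(specialize (rpos L ltac:(lra)); lra) ltac:(lra) ltac:(lra)).
      rewrite r0 in Hdown. lra. }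
  destruct HXR' as [-> HnR].
  intros x Hx. symmetry. apply minj; auto.
  assert (n x = 0); [|unfold n in *; lra].
  destruct (Rle_lt_dec k K) as [HK|HK].
  - pose proof (Hup HK 0 x ltac:(lra) ltac:(lra)).
    pose proof (Hup HK x L ltac:(lra) ltac:(lra)). lra.
  - pose proof (Hdown ltac:(lra) 0 x ltac:(lra) ltac:(lra)).
    pose proof (Hdown ltac:(lra) x L ltac:(lra) ltac:(lra)). lra.
Qed.

(** * The ODE of homogeneous perturbations *)

Lemma same_sign_on_ray (f : R -> R) : (forall s, continuity_pt f s) ->
  (forall s, 0 <= s -> f s <> 0) -> f 0 < 0 -> forall s, 0 <= s -> f s < 0.
Proof.
  intros Hc Hne H0 s Hs. apply Rnot_le_lt. intros Hfs.
  destruct (Req_dec s 0) as [->|Hs0]; [lra|].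
  assert (f s <> 0) by now apply Hne.
  destruct (IVT f 0 s) as [c [Hc1 Hc2]]; try lra.
  - exact Hc.
  - apply (Hne c); lra.
Qed.

(* [exp (- b s) ((dP + b P)^2 / 2 - k / P)] is conserved; with [y = exp (b s) P] this reads
   [y'^2 = 2 exp (2 b s) (e0 exp (b s) + k / P)]. Negative [e0] forces [P] to be small, positive [e0]
   forces collapse or unbounded growth, and [e0 = 0] off the given curve forces collapse. *)
Lemma homogeneous_ode_exit (k b y0 : R) (P dP ddP : R -> R) :
  0 < k -> 0 < b -> b ^ 2 = 2 * k ->
  (forall s, 0 < P s) -> (forall s, continuity_pt P s) -> (forall s, continuity_pt dP s) ->
  (forall s, 0 < s -> is_derive P s (dP s)) ->
  (forall s, 0 < s -> is_derive dP s (ddP s)) ->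
  (forall s, 0 < s -> ddP s + b / 2 * dP s = k * (P s - / P s ^ 2)) ->
  0 < y0 -> y0 ^ 2 * P 0 = 1 -> dP 0 <> - b * P 0 + b * y0 ->
  exists S, forall s, S < s -> 0 <= s /\ (P s < 1 / 2 \/ 3 / 2 < P s).
Proof.
  intros Hk Hb Hbk HP CP CdP DP DdP Ode Hy0 Hy0P Hoff.
  assert (Hexp : forall c s, continuity_pt (fun s => exp (c * s)) s).
  { intros c s. apply derivable_continuous_pt. exists (c * exp (c * s)).
    apply is_derive_Reals. auto_derive; [exact I|ring]. }
  set (g s := dP s + b * P s).
  assert (Cg : forall s, continuity_pt g s) by (intros; unfold g; cpt).
  set (e s := exp (- b * s) * (g s ^ 2 / 2 - k / P s)).
  assert (Ce : forall s, continuity_pt e s).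
  { intros s. unfold e. pose proof (Hexp (- b)). pose proof (HP s) as HPs. cpt; lra. }
  assert (He : forall s, 0 <= s -> e s = e 0).
  { intros s Hs. apply (constant_of_derive e); auto. intros t Ht.
    pose proof (DP t ltac:(lra)) as D1. pose proof (DdP t ltac:(lra)) as D2.
    specialize (HP t). unfold e, g. auto_derive.
    - ex_der_at; lra.
    - rewrite (Derive_eta_unique _ _ _ D1), (Derive_eta_unique _ _ _ D2).
      replace (ddP t) with (k * (P t - / P t ^ 2) - b / 2 * dP t) by (rewrite <- Ode; lra).
      replace k with (b ^ 2 / 2) by lra. field. lra. }
  assert (Hg : forall s, 0 <= s -> g s ^ 2 / 2 = k / P s + e 0 * exp (b * s)).
  { intros s Hs. rewrite <- (He s Hs). unfold e.
    replace (exp (- b * s) * (g s ^ 2 / 2 - k / P s) * exp (b * s))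
      with ((g s ^ 2 / 2 - k / P s) * (exp (- b * s) * exp (b * s))) by ring.
    rewrite <- exp_plus. replace (- b * s + b * s) with 0 by ring. rewrite exp_0. ring. }
  assert (HkP : forall s, 0 < k / P s) by (intros; apply Rdiv_lt_0_compat; auto).
  destruct (Rlt_le_dec (e 0) 0) as [Hneg|Hnn].
  { exists (Rmax 0 (2 * k / - e 0 / b)). intros s Hs.
    pose proof (Rmax_l 0 (2 * k / - e 0 / b)). pose proof (Rmax_r 0 (2 * k / - e 0 / b)).
    split; [lra|]. left. specialize (Hg s ltac:(lra)). pose proof (pow2_ge_0 (g s)).
    assert (Hbs : 2 * k < b * s * - e 0).
    { apply Rmult_lt_reg_r with (/ - e 0 * / b).
      - apply Rmult_lt_0_compat; apply Rinv_0_lt_compat; lra.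
      - replace (b * s * - e 0 * (/ - e 0 * / b)) with s by (field; lra).
        unfold Rdiv in *; lra. }
    pose proof (exp_ineq1_le (b * s)).
    assert (Hk2 : 2 * k < k / P s) by nra.
    pose proof (HP s) as HPs. apply Rmult_lt_compat_r with (r := P s) in Hk2; [|exact HPs].
    replace (k / P s * P s) with k in Hk2 by (field; lra). nra. }
  assert (Hgne : forall s, 0 <= s -> g s <> 0).
  { intros s Hs H0. specialize (Hg s Hs). rewrite H0 in Hg. specialize (HkP s).
    pose proof (exp_pos (b * s)). nra. }
  set (y s := exp (b * s) * P s).
  assert (Cy : forall s, continuity_pt y s).
  { intros s. unfold y. pose proof (Hexp b). cpt. }
  assert (Dy : forall s, 0 < s -> is_derive y s (exp (b * s) * g s)).
  { intros s Hs. pose proof (DP s Hs) as D1. unfold y, g. auto_derive; [ex_der_at|].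
    rewrite (Derive_eta_unique _ _ _ D1). ring. }
  assert (Hy0' : y 0 = P 0) by (unfold y; rewrite Rmult_0_r, exp_0; ring).
  assert (He1 : forall s, 0 <= s -> 1 <= exp (b * s)).
  { intros s Hs. pose proof (exp_ineq1_le (b * s)). nra. }
  (* From here on [e 0 >= 0], so [g] never vanishes and keeps its initial sign. A negative sign
     leads to collapse in finite time, which [P > 0] forbids. *)
  destruct (Rlt_le_dec (g 0) 0) as [Hg0|Hg0].
  - exfalso.
    assert (Hgn := same_sign_on_ray g Cg Hgne Hg0).
    assert (Hyp : forall s, 0 < y s) by (intros; apply Rmult_lt_0_compat; auto; apply exp_pos).
    assert (Hyle : forall s, 0 <= s -> y s <= P 0).
    { intros s Hs. rewrite <- Hy0'.
      apply (nonincreasing_of_derive y (fun s => exp (b * s) * g s)); auto.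
      - intros; apply Dy; lra.
      - intros t Ht. specialize (Hgn t ltac:(lra)). pose proof (exp_pos (b * t)). nra. }
    (* [(exp (b s) g)^2 >= 2 k exp (3 b s) / y >= 2 k / P 0 = (b y0)^2], because [y] stays below
       [P 0]. With such a slope [y] would reach zero by the time [P 0 / (b y0)]. *)
    assert (Hslope : forall s, 0 <= s -> exp (b * s) * g s <= - (b * y0)).
    { intros s Hs. specialize (Hg s Hs). specialize (Hgn s Hs). specialize (Hyle s Hs).
      specialize (He1 s Hs). pose proof (HP s) as HPs. specialize (Hyp s).
      assert (Hsq : (b * y0) ^ 2 <= (exp (b * s) * g s) ^ 2).
      { apply Rle_trans with (exp (b * s) ^ 2 * (2 * (k / P s))).
        - replace ((b * y0) ^ 2) with (2 * (k / P 0)).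
          2: { replace k with (b ^ 2 / 2) by lra.
               replace (P 0) with (/ y0 ^ 2).
               - field. lra.
               - apply Rmult_eq_reg_l with (y0 ^ 2); [rewrite Hy0P; field; lra|].
                 apply pow_nonzero; lra. }
          replace (exp (b * s) ^ 2 * (2 * (k / P s))) with (2 * k * exp (b * s) ^ 3 * / y s)
            by (unfold y; field; split; [lra|pose proof (exp_pos (b * s)); lra]).
          assert (H1 : / P 0 <= / y s) by (apply Rinv_le_contravar; lra).
          assert (H2 : 0 < / P 0) by (apply Rinv_0_lt_compat; auto).
          assert (H3 : 1 <= exp (b * s) ^ 3) by (apply pow_R1_Rle; lra).
          replace (2 * (k / P 0)) with (2 * k * (1 * / P 0)) by (unfold Rdiv; ring).
          rewrite (Rmult_assoc (2 * k)). apply Rmult_le_compat_l; [lra|].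
          apply Rmult_le_compat; lra.
        - rewrite Rpow_mult_distr. apply Rmult_le_compat_l; [apply pow2_ge_0|].
          pose proof (exp_pos (b * s)). nra. }
      assert (0 < b * y0) by now apply Rmult_lt_0_compat.
      assert (exp (b * s) * g s < 0) by nra. nra. }
    set (s := P 0 / (b * y0)).
    assert (Hby : 0 < b * y0) by now apply Rmult_lt_0_compat.
    assert (Hs : 0 < s) by (apply Rdiv_lt_0_compat; auto).
    assert (Hd : y s + b * y0 * s <= y 0 + b * y0 * 0).
    { apply (nonincreasing_of_derive (fun s => y s + b * y0 * s)
        (fun s => exp (b * s) * g s + b * y0)); try lra.
      - intros t Ht. pose proof (Dy t ltac:(lra)) as D1. auto_derive; [ex_der_at|].
        rewrite (Derive_eta_unique _ _ _ D1). ring.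
      - intros t _. cpt.
      - intros t Ht. specialize (Hslope t ltac:(lra)). lra. }
    rewrite Hy0' in Hd. unfold s in Hd at 2.
    replace (b * y0 * (P 0 / (b * y0))) with (P 0) in Hd by (field; lra).
    specialize (Hyp s). lra.
  - assert (Hg0' : 0 < g 0) by (specialize (Hgne 0 ltac:(lra)); lra).
    assert (Hgp : forall s, 0 <= s -> 0 < g s).
    { intros s Hs. apply Ropp_lt_cancel. rewrite Ropp_0.
      apply (same_sign_on_ray (fun s => - g s)); try lra.
      - intros t. cpt.
      - intros t Ht. specialize (Hgne t Ht). lra. }
    (* If [e 0 = 0], then [g 0 ^ 2 = 2 k / P 0 = (b y0)^2], and [g 0 > 0] puts the data on the
       excluded curve. *)
    assert (He0 : 0 < e 0).
    { destruct (Req_dec (e 0) 0) as [H0|H0]; [|lra]. exfalso. apply Hoff.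
      specialize (Hg 0 ltac:(lra)). rewrite H0, Rmult_0_l, Rplus_0_r in Hg.
      assert (Hsq : g 0 ^ 2 = (b * y0) ^ 2).
      { replace (g 0 ^ 2) with (2 * (g 0 ^ 2 / 2)) by field. rewrite Hg.
        replace k with (b ^ 2 / 2) by lra.
        replace (P 0) with (/ y0 ^ 2).
        - field. lra.
        - apply Rmult_eq_reg_l with (y0 ^ 2); [rewrite Hy0P; field; lra|].
          apply pow_nonzero; lra. }
      assert (0 < b * y0) by now apply Rmult_lt_0_compat.
      assert (g 0 = b * y0) by nra. unfold g in *. lra. }
    set (c := sqrt (2 * e 0)).
    assert (Hc : 0 < c) by (apply sqrt_lt_R0; lra).
    assert (Hc2 : c * c = 2 * e 0) by (apply sqrt_sqrt; lra).
    assert (Hgc : forall s, 0 <= s -> c * exp (b / 2 * s) <= g s).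
    { intros s Hs. specialize (Hg s Hs). specialize (Hgp s Hs). specialize (HkP s).
      assert (Hee : exp (b * s) = exp (b / 2 * s) * exp (b / 2 * s)).
      { rewrite <- exp_plus. f_equal. field. }
      pose proof (exp_pos (b / 2 * s)). apply Rnot_lt_le. intros Hlt.
      assert (0 < c * exp (b / 2 * s)) by now apply Rmult_lt_0_compat.
      assert (g s ^ 2 < (c * exp (b / 2 * s)) ^ 2) by nra.
      replace ((c * exp (b / 2 * s)) ^ 2) with (c * c * (exp (b / 2 * s) * exp (b / 2 * s))) in H1 by ring.
      rewrite Hc2, <- Hee in H1. lra. }
    (* Integrating [y' >= c exp (3 b s / 2)] and dividing by [exp (b s)] bounds [P] below by
       [2 c / (3 b)] times [exp (b s / 2) - 1]; the linear bound suffices. *)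
    assert (Hgrow : forall s, 0 <= s -> c / 3 * s <= P s).
    { intros s Hs.
      assert (Hd : y 0 - 2 * c / (3 * b) * exp (3 * b / 2 * 0) <= y s - 2 * c / (3 * b) * exp (3 * b / 2 * s)).
      { apply (nondecreasing_of_derive (fun s => y s - 2 * c / (3 * b) * exp (3 * b / 2 * s))
          (fun s => exp (b * s) * g s - c * exp (3 * b / 2 * s))); try lra.
        - intros t Ht. pose proof (Dy t ltac:(lra)) as D1. auto_derive; [ex_der_at|].
          rewrite (Derive_eta_unique _ _ _ D1). field. lra.
        - intros t _. pose proof (Hexp (3 * b / 2)). cpt.
        - intros t Ht. specialize (Hgc t ltac:(lra)).
          replace (exp (3 * b / 2 * t)) with (exp (b * t) * exp (b / 2 * t)).
          + pose proof (exp_pos (b * t)). nra.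
          + rewrite <- exp_plus. f_equal. field. }
      rewrite Rmult_0_r, exp_0, Hy0' in Hd.
      replace (exp (3 * b / 2 * s)) with (exp (b * s) * exp (b / 2 * s)) in Hd.
      2: { rewrite <- exp_plus. f_equal. field. }
      unfold y in Hd. specialize (He1 s Hs).
      assert (Hcb : 0 < 2 * c / (3 * b)) by (apply Rdiv_lt_0_compat; lra).
      pose proof (exp_ineq1_le (b / 2 * s)) as Hx.
      assert (H1 : 2 * c / (3 * b) * (b / 2 * s) <= P s).
      { apply Rmult_le_reg_l with (exp (b * s)); [lra|].
        assert (exp (b * s) * (2 * c / (3 * b) * (b / 2 * s)) <=
           2 * c / (3 * b) * (exp (b * s) * exp (b / 2 * s) - 1)).
        { replace (exp (b * s) * (2 * c / (3 * b) * (b / 2 * s)))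
            with (2 * c / (3 * b) * (exp (b * s) * (b / 2 * s))) by ring.
          apply Rmult_le_compat_l; [lra|]. nra. }
        specialize (HP 0). lra. }
      replace (2 * c / (3 * b) * (b / 2 * s)) with (c / 3 * s) in H1 by (field; lra). exact H1. }
    exists (5 / c). intros s Hs. assert (0 < 5 / c) by (apply Rdiv_lt_0_compat; lra).
    split; [lra|]. right. apply Rlt_le_trans with (c / 3 * s).
    + apply Rlt_trans with (c / 3 * (5 / c)).
      * replace (c / 3 * (5 / c)) with (5 / 3) by (field; lra). lra.
      * apply Rmult_lt_compat_l; lra.
    + apply Hgrow; lra.
Qed.

(** * The perturbed flow *)

Section Flow.

Variables (L k b mu : R) (w a : R -> R) (p px ps pxs pss q : R -> R -> R).

(* [w] is [rho^(1/3)], [k] is [|delta|], [a] is the viscous prefactor, [shear = (ln p)_xs],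
   [zeta = (p^2 q)^(-1/3)], so that the pressure is [w^4 zeta^4], and [visc] is [Bbar]. *)
Definition mass (x : R) : R := RInt (fun y => y ^ 2 * w y ^ 3) 0 x.
Let v (x s : R) : R := ps x s / p x s.
Definition shear (x s : R) : R := (pxs x s * p x s - ps x s * px x s) / p x s ^ 2.
Definition zeta (x s : R) : R := exp (- (2 * ln (p x s) + ln (q x s)) / 3).
Definition visc (x s : R) : R := 4 / 3 * mu * (x * p x s * shear x s / q x s).

Hypothesis L_pos : 0 < L.
Hypothesis k_pos : 0 < k.
Hypothesis b_pos : 0 < b.
Hypothesis b_sq : b ^ 2 = 2 * k.
Hypothesis mu_pos : 0 < mu.
Hypothesis w_cont : forall x, continuity_pt w x.
Hypothesis w_zero : w 0 = 1.
Hypothesis w_L : w L = 0.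
Hypothesis w_pos : forall x, 0 <= x < L -> 0 < w x.
Hypothesis w_derive : forall x, 0 < x < L -> is_derive w x ((k * x - mass x / x ^ 2) / 4).
Hypothesis a_cont : forall s, continuity_pt a s.
Hypothesis a_pos : forall s, 0 < a s.
Hypothesis p_cont : cont2 p.
Hypothesis px_cont : cont2 px.
Hypothesis ps_cont : cont2 ps.
Hypothesis pxs_cont : cont2 pxs.
Hypothesis pss_cont : cont2 pss.
Hypothesis q_cont : cont2 q.
Hypothesis p_pos : forall x s, 0 < p x s.
Hypothesis q_pos : forall x s, 0 < q x s.
Hypothesis q_eq : forall x s, 0 <= x <= L -> q x s = p x s + x * px x s.
Hypothesis p_dx : forall x s, 0 < x < L -> 0 < s -> is_derive (fun x => p x s) x (px x s).
Hypothesis ps_dx : forall x s, 0 < x < L -> 0 < s -> is_derive (fun x => ps x s) x (pxs x s).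
Hypothesis px_dx : forall x s, 0 < x < L -> 0 < s -> ex_derive (fun x => px x s) x.
Hypothesis p_ds : forall x s, 0 <= x <= L -> 0 < s -> is_derive (fun s => p x s) s (ps x s).
Hypothesis ps_ds : forall x s, 0 <= x <= L -> 0 < s -> is_derive (fun s => ps x s) s (pss x s).
Hypothesis px_ds : forall x s, 0 <= x <= L -> 0 < s -> is_derive (fun s => px x s) s (pxs x s).
(* [pert_eq], with [(rho^(4/3))_x] eliminated by the Lane-Emden equation. *)
Hypothesis momentum : forall x s, 0 < x < L -> 0 < s ->
  is_derive (fun x => w x ^ 4 * zeta x s ^ 4 - a s * visc x s) x
    (4 * mu * a s * shear x s
     - x * w x ^ 3 * ((pss x s + b / 2 * ps x s) / p x s ^ 2 - k / p x s)
     - w x ^ 3 * mass x / (x ^ 2 * p x s ^ 4)).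
Hypothesis visc_boundary : forall s, 0 < s -> visc L s = 0.

Lemma p_neq x s : p x s <> 0.
Proof. specialize (p_pos x s). lra. Qed.
Lemma q_neq x s : q x s <> 0.
Proof. specialize (q_pos x s). lra. Qed.
Lemma p_pow_neq x s n : p x s ^ n <> 0.
Proof. apply pow_nonzero, p_neq. Qed.
Lemma p_sq_neq x s : p x s ^ 2 <> 0.
Proof. apply p_pow_neq. Qed.
Hint Resolve p_neq q_neq p_pow_neq p_sq_neq : core.

Lemma zeta_pos x s : 0 < zeta x s.
Proof. apply exp_pos. Qed.

Lemma zeta_cube x s : zeta x s ^ 3 * p x s ^ 2 * q x s = 1.
Proof.
  assert (H : zeta x s ^ 3 = / (p x s ^ 2 * q x s)).
  { unfold zeta.
    replace (exp (- (2 * ln (p x s) + ln (q x s)) / 3) ^ 3)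
      with (exp (- (ln (p x s) + ln (p x s) + ln (q x s)))).
    - rewrite exp_Ropp, !exp_plus, !exp_ln by auto. f_equal. ring.
    - simpl. rewrite Rmult_1_r, <- !exp_plus. f_equal. field. }
  rewrite H. field. auto.
Qed.

Lemma zeta_static x s : 0 <= x <= L -> x * px x s = 0 -> zeta x s = / p x s.
Proof.
  intros Hx H0. pose proof (zeta_cube x s) as Hz. rewrite q_eq, H0, Rplus_0_r in Hz by exact Hx.
  pose proof (zeta_pos x s). pose proof (p_pos x s).
  assert (Hpos : 0 < zeta x s * p x s) by now apply Rmult_lt_0_compat.
  assert (Hf : (zeta x s * p x s - 1) * ((zeta x s * p x s) ^ 2 + zeta x s * p x s + 1) = 0).
  { transitivity (zeta x s ^ 3 * p x s ^ 2 * p x s - 1); [ring|lra]. }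
  apply Rmult_integral in Hf. apply Rmult_eq_reg_r with (p x s); auto.
  rewrite Rinv_l by auto. destruct Hf; nra.
Qed.

Lemma zeta_cont : cont2 zeta.
Proof. unfold zeta. cont2_auto; auto; intros; lra. Qed.

Lemma v_cont : cont2 v.
Proof. unfold v. cont2_auto; auto. Qed.

Lemma shear_cont : cont2 shear.
Proof. unfold shear. cont2_auto; auto. Qed.

Lemma v_dx x s : 0 < x < L -> 0 < s -> is_derive (fun x => v x s) x (shear x s).
Proof.
  intros Hx Hs. eapply is_derive_eq.
  - apply (is_derive_div (fun x => ps x s) (fun x => p x s)); auto.
  - reflexivity.
Qed.

(** * The weak identity and the decay of the energy *)

Lemma flux_derive (P V G u : R -> R) (x dP dV dG du : R) :
  P x <> 0 -> is_derive P x dP -> is_derive V x dV -> is_derive G x dG -> is_derive u x du ->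
  is_derive (fun x => - x ^ 3 * P x ^ 3 * V x * (G x - u x ^ 4 / P x ^ 4)) x
    (- (3 * x ^ 2 * P x ^ 3 * V x + 3 * x ^ 3 * P x ^ 2 * dP * V x + x ^ 3 * P x ^ 3 * dV)
       * (G x - u x ^ 4 / P x ^ 4)
     - x ^ 3 * P x ^ 3 * V x
       * (dG - 4 * u x ^ 3 * du / P x ^ 4 + 4 * u x ^ 4 * dP / P x ^ 5)).
Proof.
  intros HP DP DV DG Du. auto_derive.
  - splits; match goal with
    | |- True => exact I
    | |- _ <> 0 => exact (pow_nonzero _ 4 HP)
    | H : is_derive ?f ?x ?l |- ex_derive (fun y => ?f y) ?x => exists l; exact H
    end.
  - rewrite (Derive_eta_unique _ _ _ DP), (Derive_eta_unique _ _ _ DV),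
      (Derive_eta_unique _ _ _ DG), (Derive_eta_unique _ _ _ Du).
    field. exact HP.
Qed.

Definition dissipation (x s : R) : R :=
  4 / 3 * mu * a s * (x ^ 4 * p x s ^ 4 * shear x s ^ 2 / q x s).

(** This is the [x]-derivative of the flux [F] in [weak_identity]. The shift [V] stays free because
    it takes three values: [- b] for the energy, a weighted mean of [v] for the Gronwall estimate,
    and [v - 1] to extract the homogeneous equation. *)
Definition weak_density (V x s : R) : R :=
  x ^ 4 * w x ^ 3 * (p x s * (v x s - V) * (pss x s + b / 2 * ps x s)
    + k * (v x s - V) * (1 / p x s - p x s ^ 2))
  - w x ^ 4 * (zeta x s ^ 4 * (3 * x ^ 2 * p x s ^ 2 * q x s * (v x s - V)
                            + x ^ 3 * p x s ^ 3 * shear x s)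
      - (3 * x ^ 2 / p x s - x ^ 3 * px x s / p x s ^ 2) * (v x s - V)
      - x ^ 3 / p x s * shear x s)
  + dissipation x s.

Lemma dissipation_cont : cont2 dissipation.
Proof.
  pose proof shear_cont. unfold dissipation. cont2_auto; auto.
Qed.

Lemma weak_density_cont V : cont2 (weak_density V).
Proof.
  pose proof shear_cont. pose proof v_cont. pose proof zeta_cont. pose proof dissipation_cont.
  unfold weak_density. cont2_auto; auto.
Qed.

(* Testing the momentum equation with [x^3 p^3 (v - V)]: for spatially constant [V] the
   contribution of [V] to the viscous terms cancels. *)
Lemma weak_identity (V s : R) : 0 < s ->
  RInt (fun x => weak_density V x s) 0 L = 0.
Proof.
  intros Hs.
  (* Subtracting [w^4 / p^4] brings in the hydrostatic balance of the profile, which cancels the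
     [mass] term of [momentum]. The flux vanishes at the center through [x^3], and at the surface
     through [w L = 0] and [visc_boundary]. *)
  set (F x := - x ^ 3 * p x s ^ 3 * (v x s - V)
     * ((w x ^ 4 * zeta x s ^ 4 - a s * visc x s) - w x ^ 4 / p x s ^ 4)).
  rewrite (RInt_open_ftc (fun x => weak_density V x s) F); try lra.
  - change (F L - F 0 = 0). unfold F. rewrite visc_boundary, w_L by exact Hs. field. auto.
  - intros x. apply (cont2_slice1 (weak_density V)), weak_density_cont.
  - intros x _. pose proof shear_cont. pose proof v_cont. pose proof zeta_cont.
    apply (cont2_slice1 (fun x s => - x ^ 3 * p x s ^ 3 * (v x s - V)
     * ((w x ^ 4 * zeta x s ^ 4 - a s * visc x s) - w x ^ 4 / p x s ^ 4)) s).
    unfold visc. cont2_auto; auto.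
  - intros x Hx. eapply is_derive_eq.
    + apply (flux_derive (fun x => p x s) (fun x => v x s - V)
        (fun x => w x ^ 4 * zeta x s ^ 4 - a s * visc x s) w); auto.
      * eapply is_derive_eq; [apply (is_derive_minus (fun x => v x s) (fun _ => V))|].
        -- now apply v_dx.
        -- apply (is_derive_const V).
        -- apply Rminus_0_r.
    + unfold weak_density, dissipation, visc, v. cbv beta.
      specialize (q_eq x s ltac:(lra)). assert (Hq := q_neq x s).
      rewrite q_eq in Hq |- *.
      field. repeat split; auto; lra.
Qed.

(** Since [b^2 = 2 k], the terms of the energy in [phi_s^2], [(1 + phi) phi_s] and [(1 + phi)^2]
    form the single square [(ps + b p)^2 / 2], the physical kinetic energy up to scaling. The
    internal term [3 / (p^2 q)^(1/3)] is [3 zeta]. *)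
Definition energy_density (x s : R) : R :=
  x ^ 4 * w x ^ 3 * ((ps x s + b * p x s) ^ 2 / 2 - k / p x s)
  + x ^ 2 * w x ^ 4 * (3 * zeta x s - 3 / p x s + x * px x s / p x s ^ 2).

Definition energy (s : R) : R := exp (- b * s) * RInt (fun x => energy_density x s) 0 L.

Lemma energy_density_cont : cont2 energy_density.
Proof. pose proof zeta_cont. unfold energy_density. cont2_auto; auto. Qed.

Lemma q_ds x s : 0 <= x <= L -> 0 < s ->
  is_derive (fun s => q x s) s (ps x s + x * pxs x s).
Proof.
  intros Hx Hs. apply (is_derive_ext (fun s => p x s + x * px x s)).
  { intros t. now rewrite q_eq. }
  apply (is_derive_plus (fun s => p x s) (fun s => x * px x s)); auto.
  apply (is_derive_scal (fun s => px x s)); auto.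
Qed.

Lemma zeta_ds x s : 0 <= x <= L -> 0 < s -> is_derive (fun s => zeta x s) s
  (- zeta x s * (2 * ps x s / p x s + (ps x s + x * pxs x s) / q x s) / 3).
Proof.
  intros Hx Hs. pose proof (p_ds x s Hx Hs) as Dp. pose proof (q_ds x s Hx Hs) as Dq.
  unfold zeta. auto_derive.
  - splits; auto; match goal with
    | H : is_derive ?f ?x ?l |- ex_derive (fun y => ?f y) ?x => exists l; exact H
    end.
  - rewrite (Derive_eta_unique _ _ _ Dp), (Derive_eta_unique _ _ _ Dq).
    unfold Rdiv. field. auto.
Qed.

Lemma energy_derive s : 0 < s ->
  is_derive energy s (- exp (- b * s) * RInt (fun x => dissipation x s) 0 L).
Proof.
  intros Hs.
  set (dh x s := x ^ 4 * w x ^ 3 * ((ps x s + b * p x s) * (pss x s + b * ps x s)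
                   + k * ps x s / p x s ^ 2)
      + x ^ 2 * w x ^ 4 * (- zeta x s * (2 * ps x s / p x s + (ps x s + x * pxs x s) / q x s)
          + 3 * ps x s / p x s ^ 2
          + x * (pxs x s / p x s ^ 2 - 2 * px x s * ps x s / p x s ^ 3))).
  assert (Cz := zeta_cont). assert (Ch := energy_density_cont). assert (Cd := dissipation_cont).
  assert (Cdh : cont2 dh) by (unfold dh; cont2_auto; auto).
  assert (Dh : forall x t, 0 <= x <= L -> 0 < t ->
     is_derive (fun t => energy_density x t) t (dh x t)).
  { intros x t Hx Ht. unfold energy_density, dh.
    pose proof (p_ds x t Hx Ht) as Dp. pose proof (ps_ds x t Hx Ht) as Dps.
    pose proof (px_ds x t Hx Ht) as Dpx. pose proof (zeta_ds x t Hx Ht) as Dz.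
    auto_derive.
    - splits; auto; match goal with
      | |- True => exact I
      | |- _ * _ <> 0 => apply p_sq_neq
      | H : is_derive ?f ?x ?l |- ex_derive (fun y => ?f y) ?x => exists l; exact H
      end.
    - rewrite (Derive_eta_unique _ _ _ Dp), (Derive_eta_unique _ _ _ Dps),
       (Derive_eta_unique _ _ _ Dpx), (Derive_eta_unique _ _ _ Dz).
      field. auto. }
  unfold energy. eapply is_derive_eq.
  - apply (is_derive_mult (fun s => exp (- b * s)) (fun s => RInt (fun x => energy_density x s) 0 L)).
    + auto_derive; [exact I|reflexivity].
    + apply (RInt_param_derive energy_density dh); auto; lra.
    + intros; apply Rmult_comm.
  - unfold plus, mult; simpl.
    (* The integrands agree pointwise: [dh - b * energy_density + dissipation] is
       [weak_density (- b)], where [v + b = (ps + b p) / p]. *)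
    assert (HI : RInt (fun x => dh x s) 0 L + (- b) * RInt (fun x => energy_density x s) 0 L
               + RInt (fun x => dissipation x s) 0 L = 0).
    { rewrite <- RInt_scal_cont by (intros x; apply (cont2_slice1 energy_density), Ch).
      rewrite <- RInt_plus_cont.
      2: now apply (cont2_slice1 dh).
      2: { apply (cont2_slice1 (fun x s => - b * energy_density x s)). cont2_auto. }
      rewrite <- RInt_plus_cont.
      2: { apply (cont2_slice1 (fun x s => dh x s + - b * energy_density x s)). cont2_auto. }
      2: now apply (cont2_slice1 dissipation).
      transitivity (RInt (fun x => weak_density (- b) x s) 0 L);
        [|now apply weak_identity].
      apply RInt_ext_le; [lra|].
      intros x Hx. unfold weak_density, dh, energy_density.
      (* Lowering the power of [zeta] makes both sides linear in it, so that [field] can compare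
         them. *)
      assert (Hz4 : zeta x s ^ 4 = zeta x s / (p x s ^ 2 * q x s)).
      { rewrite <- (Rmult_1_r (zeta x s)) at 2. rewrite <- (zeta_cube x s). field. auto. }
      rewrite Hz4. replace k with (b ^ 2 / 2) by lra.
      specialize (q_eq x s ltac:(lra)). assert (Hq := q_neq x s).
      unfold v, shear. rewrite q_eq in Hq |- *. field. auto. }
    replace (- b * 1 * exp (- b * s)) with (- b * exp (- b * s)) by ring.
    replace (RInt (fun x => dh x s) 0 L) with
      (b * RInt (fun x => energy_density x s) 0 L - RInt (fun x => dissipation x s) 0 L) by lra.
    ring.
Qed.

Lemma dissipation_nonneg x s : 0 <= x <= L -> 0 <= dissipation x s.
Proof.
  intros Hx. unfold dissipation. specialize (a_pos s). specialize (q_pos x s).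
  apply Rmult_le_pos; [apply Rmult_le_pos; lra|].
  apply Rmult_le_pos; [|left; now apply Rinv_0_lt_compat].
  apply Rmult_le_pos; [|apply pow2_ge_0].
  apply Rmult_le_pos; apply pow_le; [lra|]. specialize (p_pos x s). lra.
Qed.

Lemma energy_cont s : continuity_pt energy s.
Proof.
  unfold energy. apply continuity_pt_mult.
  - apply derivable_continuous_pt.
    exists (- b * exp (- b * s)). apply is_derive_Reals. auto_derive; [exact I|ring].
  - apply RInt_param_continuity; [lra|]. apply energy_density_cont.
Qed.

Lemma energy_nonincreasing s1 s2 : 0 <= s1 <= s2 -> energy s2 <= energy s1.
Proof.
  intros Hs. apply (nonincreasing_of_derive energy
    (fun s => - exp (- b * s) * RInt (fun x => dissipation x s) 0 L)); try lra.
  - intros s H. apply energy_derive; lra.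
  - intros s _. apply energy_cont.
  - intros s H. assert (0 <= RInt (fun x => dissipation x s) 0 L).
    { apply RInt_ge_0; [lra| |intros; apply dissipation_nonneg; lra].
      apply ex_RInt_continuity. apply (cont2_slice1 dissipation), dissipation_cont. }
    pose proof (exp_pos (- b * s)). nra.
Qed.

(* With [y = p zeta] and [y ^ 3 q = p] this is weighted AM-GM: [3 y + y^-3 >= 4]. *)
Lemma internal_energy_nonneg x s : 0 <= x <= L ->
  0 <= 3 * zeta x s - 3 / p x s + x * px x s / p x s ^ 2.
Proof.
  intros Hx. pose proof (zeta_cube x s) as Hz. pose proof (zeta_pos x s).
  pose proof (p_pos x s).
  set (y := p x s * zeta x s).
  assert (Hy : 0 < y) by (unfold y; now apply Rmult_lt_0_compat).
  assert (Hq : x * px x s = p x s / y ^ 3 - p x s).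
  { assert (Hq1 : q x s = p x s / y ^ 3).
    { unfold y. apply Rmult_eq_reg_l with (zeta x s ^ 3 * p x s ^ 2).
      - rewrite Hz. field. split; auto; lra.
      - apply Rmult_integral_contrapositive_currified; auto. apply pow_nonzero; lra. }
    rewrite q_eq in Hq1 by exact Hx. lra. }
  rewrite Hq.
  replace (3 * zeta x s - 3 / p x s + (p x s / y ^ 3 - p x s) / p x s ^ 2)
    with ((y - 1) ^ 2 * (3 * y ^ 2 + 2 * y + 1) / (p x s * y ^ 3)).
  - apply Rmult_le_pos.
    + apply Rmult_le_pos; [apply pow2_ge_0|nra].
    + left. apply Rinv_0_lt_compat, Rmult_lt_0_compat; [lra|now apply pow_lt].
  - replace (zeta x s) with (y / p x s) by (unfold y; field; auto).
    field. split; auto. lra.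
Qed.

Lemma w_nonneg x : 0 <= x <= L -> 0 <= w x.
Proof.
  intros Hx. destruct (Req_dec x L) as [->|Hne]; [lra|]. left; apply w_pos; lra.
Qed.

Lemma negative_energy_exit s1 : 0 <= s1 -> energy s1 < 0 ->
  exists S, forall s, S < s -> 0 <= s /\ exists x, 0 <= x <= L /\ p x s < 1 / 2.
Proof.
  intros Hs1 HE.
  set (I0 := RInt (fun x => x ^ 4 * w x ^ 3) 0 L).
  assert (Cw : forall x, continuity_pt (fun x => x ^ 4 * w x ^ 3) x) by (intros; cpt).
  (* If [p >= 1/2] everywhere, the energy integral is at least [- 2 k I0]; but it equals [exp (b s)]
     times an energy not above [energy s1]. The second entry is the time at which [b s] times
     [- energy s1] passes [2 k I0]. *)
  exists (Rmax s1 (2 * k * I0 / - energy s1 / b)). intros s Hs.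
  pose proof (Rmax_l s1 (2 * k * I0 / - energy s1 / b)).
  pose proof (Rmax_r s1 (2 * k * I0 / - energy s1 / b)).
  split; [lra|]. apply NNPP. intros Hn.
  assert (Hp : forall x, 0 <= x <= L -> 1 / 2 <= p x s).
  { intros x Hx. apply Rnot_lt_le. intros H'. apply Hn. now exists x. }
  assert (HI : - (2 * k) * I0 <= RInt (fun x => energy_density x s) 0 L).
  { unfold I0. rewrite <- RInt_scal_cont by exact Cw. apply RInt_le_cont; try lra.
    - intros; cpt.
    - apply (cont2_slice1 energy_density), energy_density_cont.
    - intros x Hx. unfold energy_density.
      pose proof (internal_energy_nonneg x s ltac:(lra)).
      pose proof (w_nonneg x ltac:(lra)). specialize (Hp x ltac:(lra)).
      assert (0 <= x ^ 2 * w x ^ 4) by (apply Rmult_le_pos; apply pow_le; lra).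
      assert (0 <= x ^ 4 * w x ^ 3) by (apply Rmult_le_pos; apply pow_le; lra).
      assert (k / p x s <= k * 2).
      { unfold Rdiv. apply Rmult_le_compat_l; [lra|]. rewrite <- (Rinv_inv 2).
        apply Rinv_le_contravar; lra. }
      pose proof (pow2_ge_0 (ps x s + b * p x s)).
      assert (0 <= x ^ 2 * w x ^ 4 * (3 * zeta x s - 3 / p x s + x * px x s / p x s ^ 2))
        by now apply Rmult_le_pos.
      assert (x ^ 4 * w x ^ 3 * - (2 * k) <=
        x ^ 4 * w x ^ 3 * ((ps x s + b * p x s) ^ 2 / 2 - k / p x s))
        by (apply Rmult_le_compat_l; lra).
      lra. }
  assert (HEs : energy s <= energy s1) by (apply energy_nonincreasing; lra).
  assert (Hexp : RInt (fun x => energy_density x s) 0 L = energy s * exp (b * s)).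
  { unfold energy. rewrite (Rmult_comm (exp (- b * s))), Rmult_assoc, <- exp_plus.
    replace (- b * s + b * s) with 0 by ring. now rewrite exp_0, Rmult_1_r. }
  assert (Hbs : 2 * k * I0 / - energy s1 < b * s).
  { apply Rmult_lt_reg_r with (/ b); [now apply Rinv_0_lt_compat|].
    replace (b * s * / b) with s by (field; lra). unfold Rdiv in *; lra. }
  assert (Hbs' : 2 * k * I0 < b * s * - energy s1).
  { apply Rmult_lt_reg_r with (/ - energy s1); [apply Rinv_0_lt_compat; lra|].
    replace (b * s * - energy s1 * / - energy s1) with (b * s) by (field; lra).
    unfold Rdiv in *; lra. }
  assert (Hs0 : 0 <= b * s) by (apply Rmult_le_pos; lra).
  pose proof (exp_ineq1_le (b * s)). rewrite Hexp in HI. nra.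
Qed.

(** * Motions without dissipation *)

Lemma mass_derive x : is_derive mass x (x ^ 2 * w x ^ 3).
Proof. apply (is_derive_primitive (fun y => y ^ 2 * w y ^ 3)). intros; cpt. Qed.

Lemma mass_cont x : continuity_pt mass x.
Proof. eapply is_derive_continuity_pt, mass_derive. Qed.

Lemma mass_zero : mass 0 = 0.
Proof. exact (RInt_point 0 (fun y => y ^ 2 * w y ^ 3)). Qed.

(** Near the center [|w| <= 2], and [8 = 2^3]. Negative [x] are included because [slope_cont_zero]
    needs two-sided continuity at [0]. *)
Lemma mass_cubic : exists d, 0 < d /\ forall x, Rabs x < d -> Rabs (mass x) <= 8 * Rabs x ^ 3.
Proof.
  destruct (w_cont 0 1 Rlt_0_1) as [d [Hd Hd']].
  exists d. split; [exact Hd|]. intros x Hx.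
  assert (Hw : forall y, Rabs y < d -> Rabs (w y) <= 2).
  { intros y Hy. destruct (Req_dec y 0) as [->|Hne].
    - rewrite w_zero, Rabs_R1. lra.
    - assert (H : Rabs (w y - w 0) < 1).
      { apply Hd'. split; [split; [exact I|auto]|]. simpl. unfold Rdist. now rewrite Rminus_0_r. }
      rewrite w_zero in H. apply Rabs_lt_between in H. apply Rabs_le. lra. }
  destruct (MVT_gen mass 0 x (fun x => x ^ 2 * w x ^ 3)) as [c [Hc1 Hc2]].
  - intros y _. apply mass_derive.
  - intros y _. apply mass_cont.
  - rewrite mass_zero, !Rminus_0_r in Hc2. rewrite Hc2.
    assert (Hcx : Rabs c <= Rabs x).
    { unfold Rmin, Rmax, Rabs in *.
      destruct (Rle_dec 0 x); repeat destruct Rcase_abs; lra. }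
    specialize (Hw c ltac:(lra)). rewrite !Rabs_mult, <- !RPow_abs.
    pose proof (Rabs_pos c). pose proof (Rabs_pos x). pose proof (Rabs_pos (w c)).
    replace (8 * Rabs x ^ 3) with (Rabs x ^ 2 * 2 ^ 3 * Rabs x) by ring.
    apply Rmult_le_compat_r; [lra|].
    apply Rmult_le_compat; try (apply pow_le; lra); apply pow_incr; lra.
Qed.

(** The quotient [mass x / r x ^ 2] has size at most a multiple of [|x|^3 / |x|^2] and tends to [0].
    This is also its value at [x = 0], because [mass 0 = 0] and division is total. *)
Lemma slope_cont_zero (r : R -> R) (K c d : R) :
  0 < c -> 0 < d -> continuity_pt r 0 -> (forall x, Rabs x < d -> c * Rabs x <= Rabs (r x)) ->
  continuity_pt (fun x => (K * r x - mass x / r x ^ 2) / 4) 0.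
Proof.
  intros Hc Hd Cr Hr. destruct mass_cubic as [d' [Hd' Hm]].
  assert (Cm : continuity_pt (fun x => mass x / r x ^ 2) 0).
  { intros e He.
    assert (He' : 0 < e * c ^ 2 / 8).
    { pose proof (pow_lt c 2 Hc). apply Rdiv_lt_0_compat; [now apply Rmult_lt_0_compat|lra]. }
    remember (e * c ^ 2 / 8) as e' eqn:Ee.
    exists (Rmin (Rmin d d') e').
    split; [repeat apply Rmin_glb_lt; auto|].
    intros x [[_ Hne] Hx]. simpl in *. unfold Rdist in *. rewrite Rminus_0_r in Hx.
    pose proof (Rmin_l (Rmin d d') e').
    pose proof (Rmin_r (Rmin d d') e').
    pose proof (Rmin_l d d'). pose proof (Rmin_r d d').
    specialize (Hr x ltac:(lra)). specialize (Hm x ltac:(lra)).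
    rewrite mass_zero. unfold Rdiv at 2. rewrite Rmult_0_l, Rminus_0_r.
    assert (Hx0 : 0 < Rabs x) by (apply Rabs_pos_lt; auto).
    assert (Hcx : 0 < c * Rabs x) by now apply Rmult_lt_0_compat.
    assert (Hrp : 0 < Rabs (r x)) by lra.
    change (r x * (r x * 1)) with (r x ^ 2).
    unfold Rdiv. rewrite Rabs_mult, Rabs_inv, <- RPow_abs.
    apply Rmult_lt_reg_r with (Rabs (r x) ^ 2); [now apply pow_lt|].
    rewrite Rmult_assoc, Rinv_l, Rmult_1_r by (apply pow_nonzero; lra).
    apply Rle_lt_trans with (1 := Hm).
    apply Rlt_le_trans with (e * (c * Rabs x) ^ 2).
    - assert (8 * Rabs x < e * c ^ 2) by lra.
      assert (0 < Rabs x ^ 2) by (now apply pow_lt). nra.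
    - apply Rmult_le_compat_l; [lra|]. apply pow_incr. lra. }
  unfold Rdiv at 1. apply continuity_pt_mult; [|apply continuity_pt_const; intros ? ?; reflexivity].
  apply continuity_pt_minus; [|exact Cm]. cpt.
Qed.

Lemma zeta_ex_dx x s : 0 < x < L -> 0 < s -> ex_derive (fun x => zeta x s) x.
Proof.
  intros Hx Hs. pose proof (p_dx x s Hx Hs) as Dp. destruct (px_dx x s Hx Hs) as [l Dl].
  assert (Dq : ex_derive (fun x => q x s) x).
  { apply (ex_derive_ext_loc (fun x => p x s + x * px x s)).
    - assert (He : 0 < Rmin x (L - x)) by (apply Rmin_glb_lt; lra).
      exists (mkposreal _ He). intros y Hy. symmetry; apply q_eq.
      change (Rabs (y - x) < Rmin x (L - x)) in Hy.
      pose proof (Rmin_l x (L - x)). pose proof (Rmin_r x (L - x)).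
      apply Rabs_lt_between in Hy. lra.
    - auto_derive. splits; auto; eexists; eassumption. }
  unfold zeta. auto_derive. splits; auto; exact (ex_intro _ _ Dp).
Qed.

(** Without shear [v] depends on time only, so [(pss + b / 2 ps) / p = v_s + v^2 + b v / 2] is a
    constant [c0] in [x]. The momentum equation then becomes hydrostatic balance for a star with
    radii [x p], and [profile_rigidity] applies to it after rescaling. *)
Lemma homogeneous_of_static (s : R) : 0 < s ->
  (forall x t, 0 < x < L -> 0 < t -> shear x t = 0) ->
  forall x, 0 <= x <= L -> p x s = p 0 s.
Proof.
  intros Hs Hvx.
  assert (Hv : forall x t, 0 <= x <= L -> 0 < t -> v x t = v 0 t).
  { intros x t Hx Ht. apply (constant_of_derive (fun x => v x t)); [lra|..].
    - intros y Hy. rewrite <- (Hvx y t) by lra. apply v_dx; lra.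
    - intros y _. apply (cont2_slice1 v), v_cont. }
  assert (Hdv : forall x, 0 <= x <= L ->
     is_derive (fun t => v x t) s (pss x s / p x s - ps x s ^ 2 / p x s ^ 2)).
  { intros x Hx. eapply is_derive_eq.
    - apply (is_derive_div (fun t => ps x t) (fun t => p x t)); auto.
    - field. auto. }
  set (c0 := (pss 0 s + b / 2 * ps 0 s) / p 0 s).
  assert (Hacc : forall x, 0 <= x <= L -> (pss x s + b / 2 * ps x s) / p x s = c0).
  { intros x Hx.
    assert (H1 : pss x s / p x s - ps x s ^ 2 / p x s ^ 2
             = pss 0 s / p 0 s - ps 0 s ^ 2 / p 0 s ^ 2).
    { rewrite <- (is_derive_unique _ _ _ (Hdv x Hx)).
      rewrite <- (is_derive_unique _ _ _ (Hdv 0 ltac:(lra))).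
      apply Derive_ext_loc. exists (mkposreal s Hs). intros t Ht.
      change (Rabs (t - s) < s) in Ht. apply Rabs_lt_between in Ht. apply Hv; lra. }
    pose proof (Hv x s Hx Hs) as H2. unfold v in H2.
    replace (ps x s ^ 2 / p x s ^ 2) with ((ps x s / p x s) ^ 2) in H1 by (field; auto).
    replace (ps 0 s ^ 2 / p 0 s ^ 2) with ((ps 0 s / p 0 s) ^ 2) in H1 by (field; auto).
    rewrite H2 in H1. unfold c0.
    replace ((pss x s + b / 2 * ps x s) / p x s)
      with (pss x s / p x s + b / 2 * (ps x s / p x s)) by (field; auto).
    replace ((pss 0 s + b / 2 * ps 0 s) / p 0 s)
      with (pss 0 s / p 0 s + b / 2 * (ps 0 s / p 0 s)) by (field; auto).
    rewrite H2. lra. }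
  set (p0 := p 0 s). assert (Hp0 : 0 < p0) by apply p_pos.
  (* Dividing radii by [p0] and multiplying the cube root [w zeta] of the density by [p0] gives
     central value [W 0 = 1], as [zeta 0 s = 1 / p0]. The effective constant [k - c0] scales with
     [p0^3], and the mass is unchanged. *)
  set (K := (k - c0) * p0 ^ 3).
  set (r x := x * p x s / p0). set (dr x := q x s / p0).
  set (W x := p0 * (w x * zeta x s)).
  assert (Cp : forall x, continuity_pt (fun x => p x s) x) by now apply (cont2_slice1 p).
  assert (Cr : forall x, continuity_pt r x).
  { intros x. unfold r. cpt; lra. }
  assert (CW : forall x, continuity_pt W x).
  { intros x. unfold W. pose proof (cont2_slice1 zeta s zeta_cont). cpt. }
  assert (Hz0 : zeta 0 s = / p0).
  { apply zeta_static; [lra|ring]. }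
  assert (Dr : forall x, 0 < x < L -> is_derive r x (dr x)).
  { intros x Hx. unfold r, dr. pose proof (p_dx x s Hx Hs) as Dp. auto_derive.
    - splits; auto. now exists (px x s).
    - rewrite (Derive_eta_unique _ _ _ Dp), q_eq by lra. field. lra. }
  assert (DW : forall x, 0 < x < L ->
    is_derive W x (dr x * ((K * r x - mass x / r x ^ 2) / 4))).
  { intros x Hx.
    pose proof (w_pos x ltac:(lra)) as Hwx. pose proof (zeta_pos x s) as Hzx.
    (* The momentum equation gives only the derivative of the fourth power. Once [w zeta] is known
       to be differentiable, its own derivative follows on division by [4 (w zeta)^3], which is
       positive inside. *)
    assert (Du : ex_derive (fun x => w x * zeta x s) x).
    { apply (ex_derive_mult w (fun x => zeta x s)).
      - eexists; now apply w_derive.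
      - now apply zeta_ex_dx. }
    destruct Du as [l Du].
    assert (Du4 : is_derive (fun x => (w x * zeta x s) ^ 4) x (4 * (w x * zeta x s) ^ 3 * l)).
    { apply is_derive_eq with (INR 4 * l * (w x * zeta x s) ^ 3).
      - exact (is_derive_pow _ 4 x l Du).
      - simpl. ring. }
    assert (Du4' : is_derive (fun x => (w x * zeta x s) ^ 4) x
       (w x ^ 3 * ((k - c0) * x / p x s - mass x / (x ^ 2 * p x s ^ 4)))).
    { apply (is_derive_ext_loc (fun x => w x ^ 4 * zeta x s ^ 4 - a s * visc x s)).
      - assert (He : 0 < Rmin x (L - x)) by (apply Rmin_glb_lt; lra).
        exists (mkposreal _ He). intros y Hy.
        change (Rabs (y - x) < Rmin x (L - x)) in Hy.
        pose proof (Rmin_l x (L - x)). pose proof (Rmin_r x (L - x)).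
        apply Rabs_lt_between in Hy. unfold visc. rewrite Hvx by lra.
        match goal with |- ?l = ?r => change (@eq R l r) end.
        unfold Rdiv. ring.
      - eapply is_derive_eq; [now apply momentum|].
        rewrite Hvx by lra. rewrite <- (Hacc x ltac:(lra)). field. split; auto; lra. }
    pose proof (is_derive_unique _ _ _ Du4) as E1. pose proof (is_derive_unique _ _ _ Du4') as E2.
    rewrite E1 in E2.
    assert (Hl : l = ((k - c0) * x / p x s - mass x / (x ^ 2 * p x s ^ 4)) * (p x s ^ 2 * q x s) / 4).
    { pose proof (zeta_cube x s) as Hz3.
      apply Rmult_eq_reg_l with (4 * (w x * zeta x s) ^ 3).
      - rewrite E2.
        replace (4 * (w x * zeta x s) ^ 3 * (((k - c0) * x / p x s - mass x / (x ^ 2 * p x s ^ 4)) * (p x s ^ 2 * q x s) / 4))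
        with (w x ^ 3 * ((k - c0) * x / p x s - mass x / (x ^ 2 * p x s ^ 4)) * (zeta x s ^ 3 * p x s ^ 2 * q x s))
          by (field; split; auto; lra).
        rewrite Hz3. ring.
      - apply Rmult_integral_contrapositive_currified; [lra|]. apply pow_nonzero.
        apply Rmult_integral_contrapositive_currified; lra. }
    eapply is_derive_eq; [apply (is_derive_scal (fun x => w x * zeta x s) x p0); exact Du|].
    rewrite Hl. unfold dr, K, r. simpl. unfold mult; simpl. field. repeat split; auto; lra. }
  assert (Crigid : forall x, 0 <= x <= L -> r x = x).
  { apply (profile_rigidity L k K w mass (fun x => (k * x - mass x / x ^ 2) / 4) r dr W
      (fun x => (K * r x - mass x / r x ^ 2) / 4)); auto.
    - intros x. apply mass_cont.
    - intros x. destruct (Req_dec x 0) as [->|Hne].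
      + apply (slope_cont_zero (fun x => x) k 1 1); try lra.
        * cpt.
        * intros; lra.
      + pose proof mass_cont. cpt; try lra. now apply pow_nonzero.
    - intros x Hx. destruct (Req_dec x 0) as [->|Hne].
      (* Continuity of the slope at the center needs [r x] comparable with [x]; nearby [p > p0 / 2]
         gives the factor [1 / 2]. *)
      + destruct (pos_near (fun x => p x s - p0 / 2) 0) as [d [Hd Hd']].
        { cpt. } { fold p0. lra. }
        apply (slope_cont_zero r K (1 / 2) d); try lra; auto.
        intros x Hx'. specialize (Hd' x ltac:(now rewrite Rminus_0_r)).
        unfold r. unfold Rdiv at 2. rewrite !Rabs_mult, Rabs_inv.
        rewrite (Rabs_pos_eq p0), (Rabs_pos_eq (p x s)) by (try lra; left; apply p_pos).
        rewrite (Rmult_comm (1 / 2)), Rmult_assoc. apply Rmult_le_compat_l; [apply Rabs_pos|].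
        apply Rmult_le_reg_r with p0; [lra|].
        rewrite Rmult_assoc, Rinv_l, Rmult_1_r by lra. lra.
      + pose proof mass_cont. cpt; try lra. apply pow_nonzero. unfold r.
        apply Rmult_integral_contrapositive_currified; [|apply Rinv_neq_0_compat; lra].
        apply Rmult_integral_contrapositive_currified; auto.
    - apply mass_zero.
    - rewrite mass_zero. unfold Rdiv. rewrite Rmult_0_l. ring.
    - intros x _. apply mass_derive.
    - unfold r. unfold Rdiv. ring.
    - intros x Hx. unfold dr. now apply Rdiv_lt_0_compat.
    - unfold W. rewrite w_zero, Hz0. field. lra.
    - unfold W. rewrite w_L. ring.
    - intros x Hx. unfold W. apply Rmult_lt_0_compat; [lra|].
      apply Rmult_lt_0_compat; [now apply w_pos|apply zeta_pos].
    - rewrite mass_zero. unfold r. unfold Rdiv. rewrite !Rmult_0_l. ring.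
    - intros x Hx. unfold dr, r, W. pose proof (zeta_cube x s) as Hz3.
      transitivity (x ^ 2 * w x ^ 3 * (zeta x s ^ 3 * p x s ^ 2 * q x s)).
      + rewrite Hz3. ring.
      + field. lra. }
  intros x Hx. destruct (Req_dec x 0) as [->|Hne]; [reflexivity|].
  specialize (Crigid x Hx). unfold r in Crigid. fold p0.
  apply Rmult_eq_reg_l with (x / p0).
  - replace (x / p0 * p x s) with (x * p x s / p0) by (field; lra).
    rewrite Crigid. field. lra.
  - apply Rmult_integral_contrapositive_currified; [auto|apply Rinv_neq_0_compat; lra].
Qed.

(** A constant energy makes the total dissipation vanish, and its density is a positive multiple of
    [shear^2] away from the center. *)
Lemma zero_energy_static : (forall s, 0 < s -> energy s = 0) ->
  forall x s, 0 < x < L -> 0 < s -> shear x s = 0.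
Proof.
  intros HE x s Hx Hs.
  assert (HD : RInt (fun x => dissipation x s) 0 L = 0).
  { assert (H1 : is_derive energy s 0).
    { apply (is_derive_ext_loc (fun _ => 0)); [|apply (is_derive_const 0)].
      exists (mkposreal s Hs). intros t Ht. change (Rabs (t - s) < s) in Ht.
      apply Rabs_lt_between in Ht. symmetry. apply HE. lra. }
    pose proof (is_derive_unique _ _ _ H1). pose proof (is_derive_unique _ _ _ (energy_derive s Hs)).
    pose proof (exp_pos (- b * s)). nra. }
  destruct (Req_dec (shear x s) 0) as [H|H]; auto. exfalso.
  assert (0 < RInt (fun x => dissipation x s) 0 L); [|lra].
  apply RInt_pos_strict with x; try lra.
  - apply (cont2_slice1 dissipation), dissipation_cont.
  - intros y Hy. now apply dissipation_nonneg.
  - unfold dissipation. specialize (a_pos s).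
    apply Rmult_lt_0_compat; [apply Rmult_lt_0_compat; lra|].
    apply Rdiv_lt_0_compat; auto. apply Rmult_lt_0_compat.
    + apply Rmult_lt_0_compat; apply pow_lt; auto. lra.
    + now apply pow2_gt_0.
Qed.

Lemma nonpositive_energy_exit : energy 0 <= 0 ->
  ~ (forall x, 0 <= x <= L -> p x 0 = p 0 0 /\ ps x 0 = ps 0 0) ->
  exists S, forall s, S < s -> 0 <= s /\ exists x, 0 <= x <= L /\ p x s < 1 / 2.
Proof.
  intros HE Hinh.
  destruct (classic (exists s, 0 <= s /\ energy s < 0)) as [[s [Hs HEs]]|Hn].
  { now apply negative_energy_exit with s. }
  exfalso. apply Hinh. clear Hinh.
  assert (HE0 : forall s, 0 < s -> energy s = 0).
  { intros s Hs. pose proof (energy_nonincreasing 0 s ltac:(lra)).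
    destruct (Rlt_le_dec (energy s) 0); [|lra].
    exfalso. apply Hn. exists s. lra. }
  assert (Hp : forall x s, 0 <= x <= L -> 0 < s -> p x s = p 0 s).
  { intros x s Hx Hs. apply homogeneous_of_static; auto. now apply zero_energy_static. }
  (* Homogeneity has been obtained for [s > 0] only; it passes to the initial data by continuity in
     time. *)
  assert (Hlim : forall f, cont2 f -> (forall x s, 0 <= x <= L -> 0 < s -> f x s = f 0 s) ->
     forall x, 0 <= x <= L -> f x 0 = f 0 0).
  { intros f Cf Hf x Hx.
    assert (Cd : continuity_pt (fun s => f x s - f 0 s) 0).
    { pose proof (cont2_slice2 f x Cf). pose proof (cont2_slice2 f 0 Cf). cpt. }
    destruct (Req_dec (f x 0 - f 0 0) 0) as [H|H]; [lra|]. exfalso.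
    destruct (Cd (Rabs (f x 0 - f 0 0)) (Rabs_pos_lt _ H)) as [d [Hd Hd']].
    specialize (Hd' (d / 2)). cbv beta in Hd'. rewrite (Hf x (d / 2)) in Hd' by lra.
    rewrite Rminus_diag in Hd'.
    assert (HD : Rabs (0 - (f x 0 - f 0 0)) < Rabs (f x 0 - f 0 0)).
    { apply Hd'. split; [split; [exact I|lra]|]. simpl. unfold Rdist.
      rewrite Rminus_0_r, Rabs_pos_eq; lra. }
    rewrite Rminus_0_l, Rabs_Ropp in HD. lra. }
  assert (Hps : forall x s, 0 <= x <= L -> 0 < s -> ps x s = ps 0 s).
  { intros x s Hx Hs.
    rewrite <- (is_derive_unique _ _ _ (p_ds x s Hx Hs)).
    rewrite <- (is_derive_unique _ _ _ (p_ds 0 s ltac:(lra) Hs)).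
    apply Derive_ext_loc. exists (mkposreal s Hs). intros t Ht.
    change (Rabs (t - s) < s) in Ht. apply Rabs_lt_between in Ht. apply Hp; lra. }
  intros x Hx. split; now apply Hlim.
Qed.

(** With strain [t = x chi] the relation reads [1 - y^3 = y^3 t]. Thus [y - 1] is of first order in
    [t], and [3 y - 3 + t], which has the factor [(y - 1)^2], of second order. The second order
    matters at the center: [x^2 (x chi)^2] is already the density of [H], with no smallness needed
    from the velocity. *)
Lemma pressure_bounds (x y chi : R) : 0 < y -> y ^ 3 * (1 + x * chi) = 1 ->
  Rabs (3 * y - 3 + x * chi) <= y ^ 3 * (3 * y ^ 2 + 2 * y + 1) * (x * chi) ^ 2 /\
  Rabs (y ^ 4 - 1) <= y ^ 3 * ((y + 1) * (y ^ 2 + 1)) * Rabs (x * chi).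
Proof.
  intros Hy He. set (t := x * chi) in *.
  assert (Hy3 : 0 < y ^ 3) by now apply pow_lt.
  assert (Ht : t = (1 - y) * (1 + y + y ^ 2) / y ^ 3).
  { apply Rmult_eq_reg_l with (y ^ 3); [|lra].
    replace (y ^ 3 * ((1 - y) * (1 + y + y ^ 2) / y ^ 3)) with (1 - y ^ 3) by (field; lra). lra. }
  assert (Hs : 1 <= 1 + y + y ^ 2) by nra.
  assert (H1 : Rabs (y - 1) <= y ^ 3 * Rabs t).
  { rewrite Ht. unfold Rdiv. rewrite !Rabs_mult, Rabs_inv, (Rabs_pos_eq (y ^ 3)),
      (Rabs_pos_eq (1 + y + y ^ 2)), (Rabs_minus_sym 1 y) by lra.
    replace (y ^ 3 * (Rabs (y - 1) * (1 + y + y ^ 2) * / y ^ 3))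
      with (Rabs (y - 1) * (1 + y + y ^ 2)) by (field; lra).
    pose proof (Rabs_pos (y - 1)). nra. }
  split.
  - replace (3 * y - 3 + t) with ((y - 1) ^ 2 * (3 * y ^ 2 + 2 * y + 1) / y ^ 3)
      by (rewrite Ht; field; lra).
    rewrite Rabs_pos_eq.
    2: { apply Rmult_le_pos; [apply Rmult_le_pos; [apply pow2_ge_0|nra]|].
         left; now apply Rinv_0_lt_compat. }
    assert (H2 : (y - 1) ^ 2 <= (y ^ 3 * t) ^ 2).
    { rewrite <- (pow2_abs (y - 1)), <- (pow2_abs (y ^ 3 * t)).
      apply pow_incr. split; [apply Rabs_pos|]. rewrite Rabs_mult, (Rabs_pos_eq (y ^ 3)) by lra.
      exact H1. }
    apply Rmult_le_reg_r with (y ^ 3); [exact Hy3|].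
    replace ((y - 1) ^ 2 * (3 * y ^ 2 + 2 * y + 1) / y ^ 3 * y ^ 3)
      with ((y - 1) ^ 2 * (3 * y ^ 2 + 2 * y + 1)) by (field; lra).
    replace (y ^ 3 * (3 * y ^ 2 + 2 * y + 1) * t ^ 2 * y ^ 3)
      with ((y ^ 3 * t) ^ 2 * (3 * y ^ 2 + 2 * y + 1)) by ring.
    apply Rmult_le_compat_r; [nra|exact H2].
  - replace (y ^ 4 - 1) with ((y - 1) * ((y + 1) * (y ^ 2 + 1))) by ring.
    assert (H2 : 0 < (y + 1) * (y ^ 2 + 1)) by nra.
    rewrite Rabs_mult, (Rabs_pos_eq ((y + 1) * (y ^ 2 + 1))) by lra.
    replace (y ^ 3 * ((y + 1) * (y ^ 2 + 1)) * Rabs t)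
      with (y ^ 3 * Rabs t * ((y + 1) * (y ^ 2 + 1))) by ring.
    apply Rmult_le_compat_r; lra.
Qed.

(* The deviation of [p] from a spatially constant function, measured through the variances of
   the velocity [v] and of [ln p] with weights [x^4 rho p^2] and [x^4 rho], and through [(ln p)_x]. *)
Let chi (x s : R) : R := px x s / p x s.
Let ell (x s : R) : R := ln (p x s).
Let T0 : R := RInt (fun x => x ^ 4 * w x ^ 3) 0 L.
Let A (s : R) : R := RInt (fun x => x ^ 4 * w x ^ 3 * p x s ^ 2) 0 L.
Let N (s : R) : R := RInt (fun x => x ^ 4 * w x ^ 3 * (p x s * ps x s)) 0 L.
Let Q (s : R) : R := RInt (fun x => x ^ 4 * w x ^ 3 * ps x s ^ 2) 0 L.
Let T1 (s : R) : R := RInt (fun x => x ^ 4 * w x ^ 3 * ell x s) 0 L.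
Let T2 (s : R) : R := RInt (fun x => x ^ 4 * w x ^ 3 * ell x s ^ 2) 0 L.
Let H (s : R) : R := RInt (fun x => x ^ 4 * chi x s ^ 2) 0 L.
Let Y (s : R) : R := (Q s - N s ^ 2 / A s) + (T2 s - T1 s ^ 2 / T0) + H s.
Let V (s : R) : R := N s / A s.
Let lbar (s : R) : R := T1 s / T0.
Let Yd (x s : R) : R :=
  x ^ 4 * w x ^ 3 * (p x s ^ 2 * (v x s - V s) ^ 2 + (ell x s - lbar s) ^ 2)
  + x ^ 4 * chi x s ^ 2.
Let Gd (x s : R) : R :=
  x ^ 4 * w x ^ 3 * (- (2 * V s + b) * (p x s ^ 2 * (v x s - V s) ^ 2)
    - 2 * k * p x s ^ 2 * (v x s - V s) * (/ p x s ^ 3 - exp (- 3 * lbar s))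
    + 2 * (ell x s - lbar s) * (v x s - V s))
  + 2 * x ^ 4 * chi x s * shear x s
  + 2 * (w x ^ 4 / p x s * x ^ 2 *
      ((3 * (p x s * zeta x s) - 3 + x * chi x s) * (v x s - V s)
       + x * shear x s * ((p x s * zeta x s) ^ 4 - 1)))
  - 2 * dissipation x s.

(** * Evolution of the deviation from homogeneity *)

Lemma ell_cont : cont2 ell.
Proof. unfold ell. cont2_auto; auto. Qed.

Lemma chi_cont : cont2 chi.
Proof. unfold chi. cont2_auto; auto. Qed.

Lemma weight_pos x : 0 < x < L -> 0 < x ^ 4 * w x ^ 3.
Proof.
  intros Hx. specialize (w_pos x ltac:(lra)).
  apply Rmult_lt_0_compat; apply pow_lt; lra.
Qed.

Lemma weight_nonneg x : 0 <= x <= L -> 0 <= x ^ 4 * w x ^ 3.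
Proof.
  intros Hx. pose proof (w_nonneg x Hx). apply Rmult_le_pos; apply pow_le; lra.
Qed.

Lemma T0_pos : 0 < T0.
Proof.
  apply RInt_pos_strict with (L / 2); try lra.
  - intros; cpt.
  - apply weight_nonneg.
  - apply weight_pos; lra.
Qed.

Lemma A_pos s : 0 < A s.
Proof.
  pose proof (cont2_slice1 p s p_cont) as Cp.
  apply RInt_pos_strict with (L / 2); try lra.
  - intros; cpt.
  - intros x Hx. apply Rmult_le_pos; [now apply weight_nonneg|apply pow2_ge_0].
  - apply Rmult_lt_0_compat; [apply weight_pos; lra|]. apply pow_lt, p_pos.
Qed.

Lemma V_cont s : continuity_pt V s.
Proof.
  unfold V. apply (continuity_pt_div N A).
  - apply (RInt_param_continuity (fun x s => x ^ 4 * w x ^ 3 * (p x s * ps x s))); [lra|cont2_auto].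
  - apply (RInt_param_continuity (fun x s => x ^ 4 * w x ^ 3 * p x s ^ 2)); [lra|cont2_auto].
  - pose proof (A_pos s). lra.
Qed.

Lemma lbar_cont s : continuity_pt lbar s.
Proof.
  unfold lbar. apply (continuity_pt_div T1 (fun _ => T0)).
  - pose proof ell_cont.
    apply (RInt_param_continuity (fun x s => x ^ 4 * w x ^ 3 * ell x s)); [lra|cont2_auto].
  - apply continuity_pt_const; intros ? ?; reflexivity.
  - pose proof T0_pos. lra.
Qed.

Lemma Yd_cont : cont2 Yd.
Proof.
  pose proof v_cont. pose proof ell_cont. pose proof chi_cont. pose proof V_cont. pose proof lbar_cont.
  unfold Yd. cont2_auto.
Qed.

Lemma Gd_cont : cont2 Gd.
Proof.
  pose proof v_cont. pose proof ell_cont. pose proof chi_cont. pose proof V_cont. pose proof lbar_cont.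
  pose proof shear_cont. pose proof zeta_cont. pose proof dissipation_cont.
  assert (cont2 (fun x s => / p x s ^ 3)) by (intros x s; apply continuity_2d_pt_inv; auto;
    apply (cont2_pow p 3 p_cont)).
  unfold Gd. cont2_auto; auto.
Qed.

Lemma RInt_comb (f g : R -> R) (c u l : R) :
  (forall x, continuity_pt f x) -> (forall x, continuity_pt g x) ->
  RInt (fun x => f x + c * g x) u l = RInt f u l + c * RInt g u l.
Proof.
  intros Cf Cg. rewrite RInt_plus_cont, RInt_scal_cont; auto.
  intros; cpt.
Qed.

(** The moments defining [Y] are easy to differentiate in time, while squares centred at the
    weighted means are visibly nonnegative; expanding the squares links the two forms. *)
Lemma Y_eq s : Y s = RInt (fun x => Yd x s) 0 L.
Proof.
  pose proof (cont2_slice1 p s p_cont) as Cp. pose proof (cont2_slice1 ps s ps_cont) as Cps.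
  pose proof (cont2_slice1 ell s ell_cont) as Cl. pose proof (cont2_slice1 chi s chi_cont) as Cc.
  transitivity (RInt (fun x => x ^ 4 * w x ^ 3 * ps x s ^ 2
     + (- 2 * V s) * (x ^ 4 * w x ^ 3 * (p x s * ps x s))
     + V s ^ 2 * (x ^ 4 * w x ^ 3 * p x s ^ 2)
     + 1 * (x ^ 4 * w x ^ 3 * ell x s ^ 2)
     + (- 2 * lbar s) * (x ^ 4 * w x ^ 3 * ell x s)
     + lbar s ^ 2 * (x ^ 4 * w x ^ 3)
     + 1 * (x ^ 4 * chi x s ^ 2)) 0 L).
  - rewrite !RInt_comb by (intros; cpt).
    fold T0 (Q s) (N s) (A s) (T2 s) (T1 s) (H s). unfold Y, V, lbar.
    pose proof (A_pos s). pose proof T0_pos. field. lra.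
  - apply RInt_ext_le; [lra|]. intros x _. unfold Yd, v. field. auto.
Qed.

Lemma chi_ds x s : 0 <= x <= L -> 0 < s -> is_derive (fun s => chi x s) s (shear x s).
Proof.
  intros Hx Hs. eapply is_derive_eq.
  - apply (is_derive_div (fun s => px x s) (fun s => p x s)); auto.
  - unfold shear. field. auto.
Qed.

Lemma ell_ds x s : 0 <= x <= L -> 0 < s -> is_derive (fun s => ell x s) s (v x s).
Proof.
  intros Hx Hs. pose proof (p_ds x s Hx Hs) as Dp. unfold ell. auto_derive.
  - split; [now exists (ps x s)|auto].
  - rewrite (Derive_eta_unique _ _ _ Dp). unfold v. field. auto.
Qed.

Lemma Y_derive s : 0 < s -> is_derive Y s (RInt (fun x => Gd x s) 0 L).
Proof.
  intros Hs.
  assert (C1 := v_cont). assert (C3 := ell_cont). assert (C4 := chi_cont). assert (C5 := shear_cont).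
  assert (DA : is_derive A s (RInt (fun x => x ^ 4 * w x ^ 3 * (2 * p x s * ps x s)) 0 L)).
  { apply (RInt_param_derive (fun x s => x ^ 4 * w x ^ 3 * p x s ^ 2)
      (fun x s => x ^ 4 * w x ^ 3 * (2 * p x s * ps x s))); try lra; try cont2_auto.
    intros x t Hx Ht. pose proof (p_ds x t Hx Ht) as Dp. auto_derive; [now exists (ps x t)|].
    rewrite (Derive_eta_unique _ _ _ Dp). ring. }
  assert (DN : is_derive N s (RInt (fun x => x ^ 4 * w x ^ 3 * (ps x s ^ 2 + p x s * pss x s)) 0 L)).
  { apply (RInt_param_derive (fun x s => x ^ 4 * w x ^ 3 * (p x s * ps x s))
      (fun x s => x ^ 4 * w x ^ 3 * (ps x s ^ 2 + p x s * pss x s))); try lra; try cont2_auto.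
    intros x t Hx Ht. pose proof (p_ds x t Hx Ht) as Dp. pose proof (ps_ds x t Hx Ht) as Dps.
    auto_derive; [ex_der_at|].
    rewrite (Derive_eta_unique _ _ _ Dp), (Derive_eta_unique _ _ _ Dps). ring. }
  assert (DQ : is_derive Q s (RInt (fun x => x ^ 4 * w x ^ 3 * (2 * ps x s * pss x s)) 0 L)).
  { apply (RInt_param_derive (fun x s => x ^ 4 * w x ^ 3 * ps x s ^ 2)
      (fun x s => x ^ 4 * w x ^ 3 * (2 * ps x s * pss x s))); try lra; try cont2_auto.
    intros x t Hx Ht. pose proof (ps_ds x t Hx Ht) as Dp. auto_derive; [now exists (pss x t)|].
    rewrite (Derive_eta_unique _ _ _ Dp). ring. }
  assert (DT1 : is_derive T1 s (RInt (fun x => x ^ 4 * w x ^ 3 * v x s) 0 L)).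
  { apply (RInt_param_derive (fun x s => x ^ 4 * w x ^ 3 * ell x s)
      (fun x s => x ^ 4 * w x ^ 3 * v x s)); try lra; try cont2_auto.
    intros x t Hx Ht. apply (is_derive_scal (fun t => ell x t)). now apply ell_ds. }
  assert (DT2 : is_derive T2 s (RInt (fun x => x ^ 4 * w x ^ 3 * (2 * ell x s * v x s)) 0 L)).
  { apply (RInt_param_derive (fun x s => x ^ 4 * w x ^ 3 * ell x s ^ 2)
      (fun x s => x ^ 4 * w x ^ 3 * (2 * ell x s * v x s))); try lra; try cont2_auto.
    intros x t Hx Ht. pose proof (ell_ds x t Hx Ht) as Dp. auto_derive; [now exists (v x t)|].
    rewrite (Derive_eta_unique _ _ _ Dp). ring. }
  assert (DH : is_derive H s (RInt (fun x => x ^ 4 * (2 * chi x s * shear x s)) 0 L)).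
  { apply (RInt_param_derive (fun x s => x ^ 4 * chi x s ^ 2)
      (fun x s => x ^ 4 * (2 * chi x s * shear x s))); try lra; try cont2_auto.
    intros x t Hx Ht. pose proof (chi_ds x t Hx Ht) as Dp. auto_derive; [now exists (shear x t)|].
    rewrite (Derive_eta_unique _ _ _ Dp). ring. }
  pose proof (A_pos s) as HA. pose proof T0_pos as HT0.
  apply is_derive_eq with
   (RInt (fun x => x ^ 4 * w x ^ 3 * (2 * ps x s * pss x s)) 0 L
    + (- 2 * V s) * RInt (fun x => x ^ 4 * w x ^ 3 * (ps x s ^ 2 + p x s * pss x s)) 0 L
    + V s ^ 2 * RInt (fun x => x ^ 4 * w x ^ 3 * (2 * p x s * ps x s)) 0 L
    + 1 * RInt (fun x => x ^ 4 * w x ^ 3 * (2 * ell x s * v x s)) 0 L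
    + (- 2 * lbar s) * RInt (fun x => x ^ 4 * w x ^ 3 * v x s) 0 L
    + 1 * RInt (fun x => x ^ 4 * (2 * chi x s * shear x s)) 0 L).
  { unfold Y. auto_derive.
    - ex_der_at; lra.
    - rewrite (Derive_eta_unique _ _ _ DA), (Derive_eta_unique _ _ _ DN), (Derive_eta_unique _ _ _ DQ),
       (Derive_eta_unique _ _ _ DT1), (Derive_eta_unique _ _ _ DT2), (Derive_eta_unique _ _ _ DH).
      unfold V, lbar. field. lra. }
  pose proof (cont2_slice1 p s p_cont) as Cp. pose proof (cont2_slice1 ps s ps_cont) as Cps.
  pose proof (cont2_slice1 pss s pss_cont) as Cpss.
  pose proof (cont2_slice1 ell s ell_cont) as Cl. pose proof (cont2_slice1 chi s chi_cont) as Cc.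
  pose proof (cont2_slice1 v s v_cont) as Cv. pose proof (cont2_slice1 shear s shear_cont) as Cvx.
  pose proof (cont2_slice1 _ s (weak_density_cont (V s))) as Cwd.
  (* With weight [x^4 w^3], the integrals of [p^2 (v - V)] and of [ell - lbar] vanish, so multiples
     of them may be added freely. [kap] recentres [v] to [v - V] and [1 / p^3 - 1] to
     [1 / p^3 - exp (- 3 lbar)], which makes the rate quadratic in the deviations. Adding
     [weak_density] removes [pss]. *)
  set (kap := k * exp (- 3 * lbar s) - k + (2 * V s + b) * V s / 2).
  transitivity (RInt (fun x => x ^ 4 * w x ^ 3 * (2 * ps x s * pss x s)
    + (- 2 * V s) * (x ^ 4 * w x ^ 3 * (ps x s ^ 2 + p x s * pss x s))
    + V s ^ 2 * (x ^ 4 * w x ^ 3 * (2 * p x s * ps x s))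
    + 1 * (x ^ 4 * w x ^ 3 * (2 * ell x s * v x s))
    + (- 2 * lbar s) * (x ^ 4 * w x ^ 3 * v x s)
    + 1 * (x ^ 4 * (2 * chi x s * shear x s))
    + (- 2) * weak_density (V s) x s
    + (2 * kap) * (x ^ 4 * w x ^ 3 * (p x s * ps x s))
    + (- 2 * kap * V s) * (x ^ 4 * w x ^ 3 * p x s ^ 2)
    + (- 2 * V s) * (x ^ 4 * w x ^ 3 * ell x s)
    + (2 * V s * lbar s) * (x ^ 4 * w x ^ 3)) 0 L).
  { rewrite !RInt_comb by (intros; cpt). rewrite weak_identity by exact Hs.
    fold (A s) (N s) (T1 s) T0.
    replace (N s) with (V s * A s) by (unfold V; field; lra).
    replace (T1 s) with (lbar s * T0) by (unfold lbar; field; lra). ring. }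
  apply RInt_ext_le; [lra|]. intros x Hx.
  match goal with |- ?l = ?r => change (@eq R l r) end.
  unfold weak_density, Gd, kap.
  assert (Hz4 : zeta x s ^ 4 * (3 * x ^ 2 * p x s ^ 2 * q x s * (v x s - V s) + x ^ 3 * p x s ^ 3 * shear x s)
    = x ^ 2 / p x s * (3 * (p x s * zeta x s) * (v x s - V s) + x * shear x s * (p x s * zeta x s) ^ 4)).
  { transitivity (3 * x ^ 2 * (v x s - V s) * zeta x s * (zeta x s ^ 3 * p x s ^ 2 * q x s)
       + zeta x s ^ 4 * x ^ 3 * p x s ^ 3 * shear x s); [ring|].
    rewrite zeta_cube. field. auto. }
  rewrite Hz4. unfold chi.
  replace (ps x s) with (p x s * v x s) by (unfold v; field; auto).
  field. auto.
Qed.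

Lemma exp_lipschitz (u t c : R) : u <= c -> t <= c -> Rabs (exp u - exp t) <= exp c * Rabs (u - t).
Proof.
  intros Hu Ht. destruct (MVT_gen exp t u exp) as [d [Hd1 Hd2]].
  - intros y _. apply is_derive_exp.
  - intros y _. apply derivable_continuous_pt, derivable_pt_exp.
  - rewrite Hd2, Rabs_mult, (Rabs_pos_eq (exp d)) by (left; apply exp_pos).
    apply Rmult_le_compat_r; [apply Rabs_pos|].
    assert (d <= c).
    { apply Rle_trans with (1 := proj2 Hd1). now apply Rmax_lub. }
    destruct (Req_dec d c) as [->|Hne]; [lra|]. left. apply exp_increasing. lra.
Qed.

(** Every term is at least quadratic in the deviations, with coefficients bounded on [[0, S]]. The
    products [chi * shear] have coefficient [M6] from the pressure and [2] from the rate of [chi^2].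
    [M7] bounds the inverse of the coefficient of [x^4 shear^2] in [2 * dissipation], so completing
    the square costs [(M6 + 2)^2 * M7 / 4] times [x^4 chi^2]. *)
Lemma Gd_bound S : exists C, forall x s, 0 <= x <= L -> 0 <= s <= S -> Gd x s <= C * Yd x s.
Proof.
  pose proof v_cont. pose proof ell_cont. pose proof V_cont. pose proof lbar_cont. pose proof zeta_cont.
  assert (Cip : cont2 (fun x s => 1 / p x s)) by (cont2_auto; auto).
  destruct (cont2_bounded (fun x s => - (2 * V s + b)) 0 L 0 S) as [M1 [M1p M1b]]; [cont2_auto|].
  destruct (cont2_bounded (fun x s => -3 * ell x s) 0 L 0 S) as [M2 [M2p M2b]]; [cont2_auto|].
  destruct (cont2_bounded (fun x s => -3 * lbar s) 0 L 0 S) as [M2' [M2'p M2'b]]; [cont2_auto|].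
  destruct (cont2_bounded (fun x s => p x s ^ 2) 0 L 0 S) as [M3 [M3p M3b]]; [cont2_auto|].
  destruct (cont2_bounded (fun x s => 1 / p x s ^ 2) 0 L 0 S) as [M4 [M4p M4b]]; [cont2_auto; auto|].
  (* The factor [1 + (v - V)^2] dominates [|v - V|] and is continuous by plain algebra. *)
  destruct (cont2_bounded (fun x s => 2 * (w x ^ 4 / p x s) * ((p x s * zeta x s) ^ 3 *
     (3 * (p x s * zeta x s) ^ 2 + 2 * (p x s * zeta x s) + 1)) * (1 + (v x s - V s) ^ 2)) 0 L 0 S)
    as [M5 [M5p M5b]]; [cont2_auto; auto|].
  destruct (cont2_bounded (fun x s => 2 * (w x ^ 4 / p x s) * ((p x s * zeta x s) ^ 3 *
     ((p x s * zeta x s + 1) * ((p x s * zeta x s) ^ 2 + 1)))) 0 L 0 S)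
    as [M6 [M6p M6b]]; [cont2_auto; auto|].
  destruct (cont2_bounded (fun x s => q x s / (8 / 3 * mu * a s * p x s ^ 4)) 0 L 0 S)
    as [M7 [M7p M7b]].
  { assert (forall x s, 8 / 3 * mu * a s * p x s ^ 4 <> 0).
    { intros x s. apply Rmult_integral_contrapositive_currified; auto.
      specialize (a_pos s). assert (0 < 8 / 3 * mu) by lra.
      apply Rgt_not_eq. now apply Rmult_lt_0_compat. }
    cont2_auto; auto. }
  exists (M1 + k + k * M3 * (exp (M2 + M2') * 3) ^ 2 + 1 + M4 + M5 + (M6 + 2) ^ 2 * M7 / 4).
  intros x s Hx Hs.
  specialize (M1b x s Hx Hs). specialize (M2b x s Hx Hs). specialize (M2'b x s Hx Hs).
  specialize (M3b x s Hx Hs). specialize (M4b x s Hx Hs). specialize (M5b x s Hx Hs).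
  specialize (M6b x s Hx Hs). specialize (M7b x s Hx Hs).
  cbv beta in *.
  pose proof (p_pos x s) as Hp. pose proof (q_pos x s) as Hq. pose proof (zeta_pos x s) as Hz.
  pose proof (a_pos s) as Ha. pose proof (w_nonneg x Hx) as Hw.
  assert (Hwt := weight_nonneg x Hx).
  set (y := p x s * zeta x s) in *.
  assert (Hy : 0 < y) by (unfold y; now apply Rmult_lt_0_compat).
  assert (Hyc : y ^ 3 * (1 + x * chi x s) = 1).
  { transitivity (zeta x s ^ 3 * p x s ^ 2 * q x s); [|apply zeta_cube].
    rewrite q_eq by exact Hx. unfold y, chi. field. auto. }
  destruct (pressure_bounds x y (chi x s) Hy Hyc) as [B1 B2].
  set (W := v x s - V s) in *. set (d := ell x s - lbar s).
  set (E := / p x s ^ 3 - exp (-3 * lbar s)).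
  (* As [1 / p^3 = exp (- 3 ell)], the Lipschitz bound for [exp] controls [E] by [ell - lbar]; the
     factor [3] is that of the exponent. *)
  assert (HE : E ^ 2 <= (exp (M2 + M2') * 3) ^ 2 * d ^ 2).
  { assert (He : Rabs E <= exp (M2 + M2') * 3 * Rabs d).
    { unfold E. replace (/ p x s ^ 3) with (exp (-3 * ell x s)).
      - eapply Rle_trans; [apply (exp_lipschitz _ _ (M2 + M2'))|].
        + apply Rabs_le_between in M2b. lra.
        + apply Rabs_le_between in M2'b. lra.
        + replace (-3 * ell x s - -3 * lbar s) with (- (3 * d)) by (unfold d; ring).
          rewrite Rabs_Ropp, Rabs_mult, (Rabs_pos_eq 3) by lra. lra.
      - unfold ell. replace (-3 * ln (p x s)) with (- (ln (p x s) + ln (p x s) + ln (p x s))) by ring.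
        rewrite exp_Ropp, !exp_plus, exp_ln by auto. f_equal. ring. }
    rewrite <- (pow2_abs E), <- (pow2_abs d), <- Rpow_mult_distr.
    apply pow_incr. split; [apply Rabs_pos|exact He]. }
  assert (Hp2 : 0 < p x s ^ 2) by now apply pow_lt.
  assert (HW2 : 0 <= p x s ^ 2 * W ^ 2) by (apply Rmult_le_pos; [lra|apply pow2_ge_0]).
  assert (Hd2 := pow2_ge_0 d).
  assert (P1 : - (2 * V s + b) * (p x s ^ 2 * W ^ 2) <= M1 * (p x s ^ 2 * W ^ 2)).
  { apply Rmult_le_compat_r; [exact HW2|]. apply Rabs_le_between in M1b. lra. }
  assert (P2 : - 2 * k * p x s ^ 2 * W * E <=
     k * (p x s ^ 2 * W ^ 2) + k * M3 * (exp (M2 + M2') * 3) ^ 2 * d ^ 2).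
  { apply Rle_trans with (k * (p x s ^ 2 * W ^ 2) + k * p x s ^ 2 * E ^ 2).
    - assert (0 <= k * p x s ^ 2 * (W + E) ^ 2)
        by (apply Rmult_le_pos; [apply Rmult_le_pos; lra|apply pow2_ge_0]). lra.
    - apply Rplus_le_compat_l. rewrite !Rmult_assoc. apply Rmult_le_compat_l; [lra|].
      rewrite Rabs_pos_eq in M3b by lra.
      apply Rmult_le_compat; [lra|apply pow2_ge_0|exact M3b|exact HE]. }
  assert (P3 : 2 * d * W <= d ^ 2 + M4 * (p x s ^ 2 * W ^ 2)).
  { apply Rle_trans with (d ^ 2 + 1 / p x s ^ 2 * (p x s ^ 2 * W ^ 2)).
    - replace (1 / p x s ^ 2 * (p x s ^ 2 * W ^ 2)) with (W ^ 2) by (field; auto).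
      pose proof (pow2_ge_0 (d - W)). lra.
    - apply Rplus_le_compat_l, Rmult_le_compat_r; [exact HW2|].
      apply Rabs_le_between in M4b. lra. }
  assert (Hx4 : 0 <= x ^ 4) by (apply pow_le; lra).
  assert (Hwp : 0 <= 2 * (w x ^ 4 / p x s)).
  { apply Rmult_le_pos; [lra|]. apply Rmult_le_pos; [apply pow_le; lra|].
    left; now apply Rinv_0_lt_compat. }
  assert (Hy3 : 0 < y ^ 3) by now apply pow_lt.
  assert (P4 : 2 * (w x ^ 4 / p x s * x ^ 2 * ((3 * y - 3 + x * chi x s) * W))
     <= M5 * (x ^ 4 * chi x s ^ 2)).
  { set (f := y ^ 3 * (3 * y ^ 2 + 2 * y + 1)) in *.
    assert (Hf : 0 <= f) by (unfold f; apply Rmult_le_pos; nra).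
    apply Rle_trans with (2 * (w x ^ 4 / p x s) * f * (1 + W ^ 2) * (x ^ 4 * chi x s ^ 2)).
    - replace (2 * (w x ^ 4 / p x s * x ^ 2 * ((3 * y - 3 + x * chi x s) * W)))
       with (2 * (w x ^ 4 / p x s) * x ^ 2 * ((3 * y - 3 + x * chi x s) * W)) by ring.
      replace (2 * (w x ^ 4 / p x s) * f * (1 + W ^ 2) * (x ^ 4 * chi x s ^ 2))
       with (2 * (w x ^ 4 / p x s) * x ^ 2 * (f * (x * chi x s) ^ 2 * (1 + W ^ 2))) by ring.
      apply Rmult_le_compat_l; [apply Rmult_le_pos; [exact Hwp|apply pow2_ge_0]|].
      eapply Rle_trans; [apply Rle_abs|]. rewrite Rabs_mult.
      apply Rmult_le_compat; try apply Rabs_pos; auto.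
      rewrite <- (pow2_abs W). pose proof (pow2_ge_0 (Rabs W - 1)). nra.
    - apply Rmult_le_compat_r; [apply Rmult_le_pos; [exact Hx4|apply pow2_ge_0]|].
      apply Rabs_le_between in M5b. lra. }
  assert (P5 : 2 * (w x ^ 4 / p x s * x ^ 2 * (x * shear x s * (y ^ 4 - 1)))
     <= M6 * (x ^ 4 * (Rabs (chi x s) * Rabs (shear x s)))).
  { set (f := y ^ 3 * ((y + 1) * (y ^ 2 + 1))) in *.
    apply Rle_trans with (2 * (w x ^ 4 / p x s) * f * (x ^ 4 * (Rabs (chi x s) * Rabs (shear x s)))).
    - replace (2 * (w x ^ 4 / p x s * x ^ 2 * (x * shear x s * (y ^ 4 - 1))))
       with (2 * (w x ^ 4 / p x s) * x ^ 3 * (shear x s * (y ^ 4 - 1))) by ring.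
      replace (2 * (w x ^ 4 / p x s) * f * (x ^ 4 * (Rabs (chi x s) * Rabs (shear x s))))
       with (2 * (w x ^ 4 / p x s) * x ^ 3 * (Rabs (shear x s) * (f * (x * Rabs (chi x s))))) by ring.
      apply Rmult_le_compat_l; [apply Rmult_le_pos; [exact Hwp|apply pow_le; lra]|].
      eapply Rle_trans; [apply Rle_abs|]. rewrite Rabs_mult.
      apply Rmult_le_compat_l; [apply Rabs_pos|].
      rewrite Rabs_mult, (Rabs_pos_eq x) in B2 by lra. exact B2.
    - apply Rmult_le_compat_r.
      + apply Rmult_le_pos; [exact Hx4|]. apply Rmult_le_pos; apply Rabs_pos.
      + apply Rabs_le_between in M6b. lra. }
  assert (P6 : x ^ 4 * shear x s ^ 2 / M7 <= 2 * dissipation x s).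
  { unfold dissipation.
    set (D := 8 / 3 * mu * a s * p x s ^ 4) in *.
    assert (HD : 0 < D).
    { unfold D. apply Rmult_lt_0_compat; [|now apply pow_lt].
      apply Rmult_lt_0_compat; lra. }
    replace (2 * (4 / 3 * mu * a s * (x ^ 4 * p x s ^ 4 * shear x s ^ 2 / q x s)))
      with (x ^ 4 * shear x s ^ 2 * / (q x s / D)) by (unfold D; field; repeat split; auto; lra).
    apply Rmult_le_compat_l; [apply Rmult_le_pos; [exact Hx4|apply pow2_ge_0]|].
    apply Rinv_le_contravar; [now apply Rdiv_lt_0_compat|].
    apply Rabs_le_between in M7b. lra. }
  assert (P7 : (M6 + 2) * (Rabs (chi x s) * Rabs (shear x s)) - shear x s ^ 2 / M7
      <= (M6 + 2) ^ 2 * M7 / 4 * chi x s ^ 2).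
  { rewrite <- (pow2_abs (shear x s)), <- (pow2_abs (chi x s)).
    set (X := Rabs (chi x s)). set (T := Rabs (shear x s)).
    assert (HXT : 0 <= ((M6 + 2) * M7 * X / 2 - T) ^ 2 / M7).
    { apply Rmult_le_pos; [apply pow2_ge_0|left; now apply Rinv_0_lt_compat]. }
    replace (((M6 + 2) * M7 * X / 2 - T) ^ 2 / M7) with
      ((M6 + 2) ^ 2 * M7 / 4 * X ^ 2 - (M6 + 2) * (X * T) + T ^ 2 / M7) in HXT by (field; lra).
    lra. }
  assert (P8 : 2 * x ^ 4 * chi x s * shear x s <= 2 * (x ^ 4 * (Rabs (chi x s) * Rabs (shear x s)))).
  { rewrite <- Rabs_mult. pose proof (Rle_abs (chi x s * shear x s)). nra. }
  apply (Rmult_le_compat_l (x ^ 4)) in P7; [|exact Hx4].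
  set (C1 := k * M3 * (exp (M2 + M2') * 3) ^ 2) in *.
  assert (HC1 : 0 <= C1).
  { unfold C1. apply Rmult_le_pos; [apply Rmult_le_pos; lra|apply pow2_ge_0]. }
  set (C2' := (M6 + 2) ^ 2 * M7 / 4) in *.
  assert (HC2 : 0 <= C2').
  { unfold C2'. pose proof (pow2_ge_0 (M6 + 2)). apply Rmult_le_pos; [apply Rmult_le_pos; lra|lra]. }
  assert (Hc : 0 <= x ^ 4 * chi x s ^ 2) by (apply Rmult_le_pos; [exact Hx4|apply pow2_ge_0]).
  assert (Q1 : x ^ 4 * w x ^ 3 * (- (2 * V s + b) * (p x s ^ 2 * W ^ 2)
     - 2 * k * p x s ^ 2 * W * E + 2 * d * W) <=
     x ^ 4 * w x ^ 3 * ((M1 + k + C1 + 1 + M4) * (p x s ^ 2 * W ^ 2 + d ^ 2))).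
  { apply Rmult_le_compat_l; [exact Hwt|]. nra. }
  assert (Q2 : 0 <= x ^ 4 * w x ^ 3 * (p x s ^ 2 * W ^ 2 + d ^ 2))
    by (apply Rmult_le_pos; [exact Hwt|lra]).
  unfold Gd, Yd. fold y W d E.
  set (F := x ^ 4 * w x ^ 3) in *. set (J := p x s ^ 2 * W ^ 2 + d ^ 2) in *.
  assert (Q3 : (M1 + k + C1 + 1 + M4) * (F * J) <= (M1 + k + C1 + 1 + M4 + M5 + C2') * (F * J))
    by (apply Rmult_le_compat_r; lra).
  assert (Q4 : (M5 + C2') * (x ^ 4 * chi x s ^ 2) <= (M1 + k + C1 + 1 + M4 + M5 + C2') * (x ^ 4 * chi x s ^ 2))
    by (apply Rmult_le_compat_r; lra).
  assert (Q5 : x ^ 4 * ((M6 + 2) * (Rabs (chi x s) * Rabs (shear x s)) - shear x s ^ 2 / M7)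
     = M6 * (x ^ 4 * (Rabs (chi x s) * Rabs (shear x s))) + 2 * (x ^ 4 * (Rabs (chi x s) * Rabs (shear x s)))
       - x ^ 4 * shear x s ^ 2 / M7) by (field; lra).
  lra.
Qed.

(** At [s = 0] the weighted means are the common values of [v] and [ell], so [Y 0 = 0]. The Gronwall
    bound keeps [Y] from becoming positive, and its part [H] then forces [px = 0]. *)
Lemma homogeneous_persistence :
  (forall x, 0 <= x <= L -> p x 0 = p 0 0 /\ ps x 0 = ps 0 0) ->
  (forall x, 0 < x < L -> px x 0 = 0) ->
  forall x s, 0 <= x <= L -> 0 <= s -> p x s = p 0 s.
Proof.
  intros Hi Hpx.
  assert (CY : forall s, continuity_pt Y s).
  { intros s. apply (continuity_pt_ext (fun s => RInt (fun x => Yd x s) 0 L)).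
    - intros t. symmetry. apply Y_eq.
    - apply RInt_param_continuity; [lra|apply Yd_cont]. }
  assert (HV0 : V 0 = v 0 0).
  { unfold V. pose proof (A_pos 0). apply Rmult_eq_reg_r with (A 0); [|lra].
    replace (N 0 / A 0 * A 0) with (N 0) by (field; lra).
    pose proof (cont2_slice1 p 0 p_cont) as Cp.
    unfold A. rewrite <- RInt_scal_cont by (intros; cpt).
    apply RInt_ext_le; [lra|]. intros x Hx. destruct (Hi x ltac:(lra)) as [-> ->].
    unfold v. field. auto. }
  assert (Hl0 : lbar 0 = ell 0 0).
  { unfold lbar. pose proof T0_pos. apply Rmult_eq_reg_r with T0; [|lra].
    replace (T1 0 / T0 * T0) with (T1 0) by (field; lra).
    unfold T0. rewrite <- RInt_scal_cont by (intros; cpt).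
    apply RInt_ext_le; [lra|]. intros x Hx. unfold ell. destruct (Hi x ltac:(lra)) as [-> _].
    match goal with |- ?l = ?r => change (@eq R l r) end. ring. }
  assert (HY0 : Y 0 = 0).
  { rewrite Y_eq. transitivity (RInt (fun _ => 0) 0 L).
    - apply RInt_ext_le; [lra|]. intros x Hx.
      unfold Yd. rewrite HV0, Hl0. unfold v, ell, chi. destruct (Hi x ltac:(lra)) as [-> ->].
      rewrite Hpx by exact Hx.
      match goal with |- ?l = ?r => change (@eq R l r) end. unfold Rdiv. ring.
    - rewrite RInt_const. unfold scal; simpl; unfold mult; simpl. ring. }
  assert (HY : forall S, 0 < S -> Y S <= 0).
  { intros S HS. destruct (Gd_bound S) as [C HC].
    assert (He : exp (- C * S) * Y S <= exp (- C * 0) * Y 0).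
    { apply (nonincreasing_of_derive (fun s => exp (- C * s) * Y s)
        (fun s => exp (- C * s) * (RInt (fun x => Gd x s) 0 L - C * Y s))); try lra.
      - intros s Hs. pose proof (Y_derive s ltac:(lra)) as DY. auto_derive.
        + ex_der_at.
        + rewrite (Derive_eta_unique _ _ _ DY). ring.
      - intros s _. apply continuity_pt_mult; [|apply CY].
        apply derivable_continuous_pt. exists (- C * exp (- C * s)).
        apply is_derive_Reals. auto_derive; [exact I|ring].
      - intros s Hs.
        assert (RInt (fun x => Gd x s) 0 L <= C * Y s).
        { rewrite Y_eq. rewrite <- RInt_scal_cont by (apply (cont2_slice1 Yd), Yd_cont).
          apply RInt_le_cont; [lra| | |].
          - apply (cont2_slice1 Gd), Gd_cont.
          - pose proof Yd_cont. apply (cont2_slice1 (fun x s => C * Yd x s)). cont2_auto.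
          - intros x Hx. apply HC; lra. }
        pose proof (exp_pos (- C * s)). nra. }
    rewrite HY0, Rmult_0_r in He. pose proof (exp_pos (- C * S)). nra. }
  assert (Hpx0 : forall x s, 0 < x < L -> 0 < s -> px x s = 0).
  { intros x s Hx Hs. destruct (Req_dec (px x s) 0) as [|Hne]; auto. exfalso.
    specialize (HY s Hs). rewrite Y_eq in HY.
    assert (0 < RInt (fun x => Yd x s) 0 L); [|lra].
    assert (Hn : forall y, 0 <= y <= L ->
       0 <= y ^ 4 * w y ^ 3 * (p y s ^ 2 * (v y s - V s) ^ 2 + (ell y s - lbar s) ^ 2)).
    { intros y Hy. apply Rmult_le_pos; [now apply weight_nonneg|].
      apply Rplus_le_le_0_compat; [apply Rmult_le_pos|]; apply pow2_ge_0. }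
    apply RInt_pos_strict with x; try lra.
    - apply (cont2_slice1 Yd), Yd_cont.
    - intros y Hy. unfold Yd. specialize (Hn y Hy).
      assert (0 <= y ^ 4 * chi y s ^ 2) by (apply Rmult_le_pos; [apply pow_le; lra|apply pow2_ge_0]).
      lra.
    - unfold Yd. specialize (Hn x ltac:(lra)).
      assert (0 < x ^ 4 * chi x s ^ 2).
      { apply Rmult_lt_0_compat; [apply pow_lt; lra|]. apply pow2_gt_0. unfold chi.
        apply Rmult_integral_contrapositive_currified; [exact Hne|]. now apply Rinv_neq_0_compat. }
      lra. }
  intros x s Hx Hs. destruct (Req_dec s 0) as [->|Hne]; [now apply Hi|].
  apply (constant_of_derive (fun x => p x s)); [lra| |].
  - intros y Hy. rewrite <- (Hpx0 y s) by lra. apply p_dx; lra.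
  - intros y _. now apply (cont2_slice1 p).
Qed.

Lemma homogeneous_exit (y0 : R) :
  (forall x, 0 <= x <= L -> p x 0 = p 0 0 /\ ps x 0 = ps 0 0) ->
  (forall x, 0 < x < L -> px x 0 = 0) ->
  0 < y0 -> y0 ^ 2 * p 0 0 = 1 -> ps 0 0 <> - b * p 0 0 + b * y0 ->
  exists S, forall s, S < s -> 0 <= s /\ exists x, 0 <= x <= L /\ (p x s < 1 / 2 \/ 3 / 2 < p x s).
Proof.
  intros Hi Hpx Hy0 Hy0p Hoff.
  assert (Hp := homogeneous_persistence Hi Hpx).
  assert (Hnear_s : forall s, 0 < s -> locally s (fun t => 0 < t)).
  { intros s Hs. exists (mkposreal s Hs). intros t Ht. change (Rabs (t - s) < s) in Ht.
    apply Rabs_lt_between in Ht. lra. }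
  assert (Hnear_x : forall x, 0 < x < L -> locally x (fun y => 0 < y < L)).
  { intros x Hx. assert (He : 0 < Rmin x (L - x)) by (apply Rmin_glb_lt; lra).
    exists (mkposreal _ He). intros y Hy.
    change (Rabs (y - x) < Rmin x (L - x)) in Hy.
    pose proof (Rmin_l x (L - x)). pose proof (Rmin_r x (L - x)).
    apply Rabs_lt_between in Hy. lra. }
  assert (Hds : forall f df : R -> R -> R, (forall x s, 0 <= x <= L -> 0 < s -> f x s = f 0 s) ->
    (forall x s, 0 <= x <= L -> 0 < s -> is_derive (fun s => f x s) s (df x s)) ->
    forall x s, 0 <= x <= L -> 0 < s -> df x s = df 0 s).
  { intros f df Hf Df x s Hx Hs.
    rewrite <- (is_derive_unique _ _ _ (Df x s Hx Hs)).
    rewrite <- (is_derive_unique _ _ _ (Df 0 s ltac:(lra) Hs)).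
    apply Derive_ext_loc. eapply filter_imp; [|now apply Hnear_s].
    intros t Ht. now apply Hf. }
  assert (Hdx : forall f df : R -> R -> R, (forall x s, 0 <= x <= L -> 0 < s -> f x s = f 0 s) ->
    (forall x s, 0 < x < L -> 0 < s -> is_derive (fun x => f x s) x (df x s)) ->
    forall x s, 0 < x < L -> 0 < s -> df x s = 0).
  { intros f df Hf Df x s Hx Hs.
    rewrite <- (is_derive_unique _ _ _ (Df x s Hx Hs)).
    apply is_derive_unique. apply (is_derive_ext_loc (fun _ => f 0 s)); [|apply (is_derive_const (f 0 s))].
    eapply filter_imp; [|now apply Hnear_x]. intros y Hy. symmetry. apply Hf; lra. }
  assert (Hp' : forall x s, 0 <= x <= L -> 0 < s -> p x s = p 0 s) by (intros; apply Hp; lra).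
  assert (Hps := Hds p ps Hp' p_ds).
  assert (Hpss := Hds ps pss Hps ps_ds).
  assert (Hpx0 := Hdx p px Hp' p_dx).
  assert (Hpxs0 := Hdx ps pxs Hps ps_dx).
  assert (Hode : forall s, 0 < s -> pss 0 s + b / 2 * ps 0 s = k * (p 0 s - / p 0 s ^ 2)).
  (* With this shift the test factor [v - V] is [1]. In a homogeneous motion the pressure terms
     cancel and the dissipation vanishes, so the integrand is [c] times a positive weight and
     [c = 0] is the equation sought. *)
  { intros s Hs. pose proof (weak_identity (v 0 s - 1) s Hs) as HI.
    set (c := p 0 s * (pss 0 s + b / 2 * ps 0 s) + k * (1 / p 0 s - p 0 s ^ 2)).
    assert (HI' : RInt (fun x => c * (x ^ 4 * w x ^ 3)) 0 L = 0).
    { transitivity (RInt (fun x => weak_density (v 0 s - 1) x s) 0 L); [|exact HI].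
      apply RInt_ext_le; [lra|]. intros x Hx.
      match goal with |- ?l = ?r => change (@eq R l r) end.
      assert (Hz := zeta_static x s ltac:(lra) ltac:(rewrite (Hpx0 x s Hx Hs); ring)).
      unfold weak_density, dissipation, shear, v. rewrite Hz, q_eq by lra.
      rewrite (Hpx0 x s Hx Hs), (Hpxs0 x s Hx Hs).
      rewrite (Hps x s), (Hpss x s), (Hp' x s) by lra. unfold c.
      field. auto. }
    rewrite RInt_scal_cont in HI' by (intros; cpt). fold T0 in HI'. pose proof T0_pos.
    assert (Hc : c = 0).
    { apply Rmult_integral in HI'. destruct HI'; lra. }
    apply Rmult_eq_reg_l with (p 0 s); auto.
    replace (p 0 s * (k * (p 0 s - / p 0 s ^ 2))) with (- (k * (1 / p 0 s - p 0 s ^ 2))) by (field; auto).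
    unfold c in Hc. lra. }
  destruct (homogeneous_ode_exit k b y0 (fun s => p 0 s) (fun s => ps 0 s) (fun s => pss 0 s))
    as [S HS]; auto.
  - apply (cont2_slice2 p), p_cont.
  - apply (cont2_slice2 ps), ps_cont.
  - intros s Hs. apply p_ds; lra.
  - intros s Hs. apply ps_ds; lra.
  - exists S. intros s Hs. destruct (HS s Hs) as [H0 H1]. split; [exact H0|].
    exists 0. split; [lra|exact H1].
Qed.

End Flow.

(** * The profile, the self-similar time and the conclusion *)

Lemma pw_pos_eq r e : 0 < r -> pw r e = Rpower r e.
Proof. intros H. unfold pw. destruct (Rlt_dec 0 r); [reflexivity|lra]. Qed.

Lemma pw_zero e : pw 0 e = 0.
Proof. unfold pw. destruct (Rlt_dec 0 0); [lra|reflexivity]. Qed.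

Lemma pw_pos r e : 0 < r -> 0 < pw r e.
Proof. intros H. rewrite pw_pos_eq by exact H. apply exp_pos. Qed.

Lemma pw_third_cube r : 0 <= r -> pw r (1 / 3) ^ 3 = r.
Proof.
  intros H. destruct (Req_dec r 0) as [->|Hne]; [rewrite pw_zero; ring|].
  rewrite pw_pos_eq by lra. rewrite <- Rpower_pow by apply exp_pos.
  rewrite Rpower_mult. replace (1 / 3 * INR 3) with 1 by (simpl; field).
  apply Rpower_1; lra.
Qed.

Lemma cube_inj x y : 0 <= x -> 0 <= y -> x ^ 3 = y ^ 3 -> x = y.
Proof.
  intros Hx Hy H. destruct (Rtotal_order x y) as [Hl|[->|Hl]]; auto; exfalso;
    assert (0 < (x ^ 2 + x * y + y ^ 2)) by nra;
    assert ((x - y) * (x ^ 2 + x * y + y ^ 2) = 0) by lra; nra.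
Qed.

Lemma pw_nonneg r e : 0 <= pw r e.
Proof.
  unfold pw. destruct (Rlt_dec 0 r); [left; apply exp_pos|lra].
Qed.

Lemma pw_of_cube_third t : 0 <= t -> pw (t ^ 3) (1 / 3) = t.
Proof.
  intros H. apply cube_inj; auto using pw_nonneg. apply pw_third_cube. now apply pow_le.
Qed.

Lemma pw_of_cube_four_thirds t : 0 <= t -> pw (t ^ 3) (4 / 3) = t ^ 4.
Proof.
  intros H. destruct (Req_dec t 0) as [->|Hne].
  - rewrite pow_ne_zero, pw_zero by discriminate. ring.
  - assert (Ht : 0 < t) by lra. rewrite pw_pos_eq by now apply pow_lt.
    rewrite <- (Rpower_pow 3), Rpower_mult, <- (Rpower_pow 4) by exact Ht.
    f_equal. simpl. field.
Qed.

Lemma continuity_pt_clamped (h : R -> R) (l u : R) : l <= u ->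
  (forall c, l <= c <= u -> forall e, 0 < e -> exists d, 0 < d /\
     forall y, l <= y <= u -> Rabs (y - c) < d -> Rabs (h y - h c) < e) ->
  forall x, continuity_pt (fun x => h (clamp l u x)) x.
Proof.
  intros Hlu Hh x e He.
  destruct (Hh (clamp l u x) (clamp_in l u x Hlu) e He) as [d [Hd Hd']].
  exists d. split; [exact Hd|]. intros y [_ Hy]. apply Hd'; [now apply clamp_in|].
  eapply Rle_lt_trans; [apply clamp_lipschitz|exact Hy].
Qed.

Lemma filterlim_at_right_eps (f : R -> R) (a l e : R) :
  filterlim f (at_right a) (locally l) -> 0 < e ->
  exists d, 0 < d /\ forall y, a < y < a + d -> Rabs (f y - l) < e.
Proof.
  intros H He. destruct (proj1 (filterlim_locally f l) H (mkposreal e He)) as [d Hd].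
  exists d. split; [apply cond_pos|]. intros y Hy. apply Hd; [|lra].
  change (Rabs (y - a) < d). rewrite Rabs_pos_eq; lra.
Qed.

Lemma filterlim_at_left_eps (f : R -> R) (a l e : R) :
  filterlim f (at_left a) (locally l) -> 0 < e ->
  exists d, 0 < d /\ forall y, a - d < y < a -> Rabs (f y - l) < e.
Proof.
  intros H He. destruct (proj1 (filterlim_locally f l) H (mkposreal e He)) as [d Hd].
  exists d. split; [apply cond_pos|]. intros y Hy. apply Hd; [|lra].
  change (Rabs (y - a) < d). rewrite Rabs_left; lra.
Qed.

(** The equation integrates once: [x^2 u' + m / 4 + delta x^3 / 4] is constant in the open interval,
    and the constant vanishes because otherwise [u] would be unbounded like [1 / x] at the center.
    Clamping makes the cube root continuous on the whole line, the two end points being settled by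
    the limits in the hypotheses. *)
Lemma lane_emden_profile (delta R0 : R) (rho : R -> R) : 0 < R0 -> rho 0 = 1 ->
  filterlim (fun y => (rho y - rho 0) / y) (at_right 0) (locally 0) ->
  (forall y, 0 <= y < R0 -> 0 < rho y) ->
  rho R0 = 0 ->
  filterlim rho (at_left R0) (locally 0) ->
  (forall y, 0 < y < R0 ->
     ex_derive (fun z => pw (rho z) (1/3)) y /\
     ex_derive (Derive (fun z => pw (rho z) (1/3))) y /\
     Derive_n (fun z => pw (rho z) (1/3)) 2 y
       + 2 / y * Derive (fun z => pw (rho z) (1/3)) y
       + 1/4 * rho y + 3/4 * delta = 0) ->
  exists w : R -> R, (forall x, continuity_pt w x) /\ w 0 = 1 /\ w R0 = 0 /\
    (forall x, 0 <= x < R0 -> 0 < w x) /\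
    (forall x, 0 <= x <= R0 -> rho x = w x ^ 3) /\
    (forall x, 0 < x < R0 ->
      is_derive w x ((- delta * x - RInt (fun y => y ^ 2 * w y ^ 3) 0 x / x ^ 2) / 4)).
Proof.
  intros HR rho0 Hlim0 rpos rhoR HlimR Hode.
  set (u z := pw (rho z) (1 / 3)) in *.
  set (w x := u (clamp 0 R0 x)).
  assert (rnn : forall x, 0 <= x <= R0 -> 0 <= rho x).
  { intros x Hx. destruct (Req_dec x R0) as [->|Hne]; [lra|]. left; apply rpos; lra. }
  assert (u3 : forall x, 0 <= x <= R0 -> u x ^ 3 = rho x).
  { intros x Hx. apply pw_third_cube; auto. }
  assert (unn : forall x, 0 <= u x) by (intros; apply pw_nonneg).
  assert (u0 : u 0 = 1).
  { apply cube_inj; auto; [lra|]. rewrite u3 by lra. rewrite rho0. ring. }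
  assert (uR : u R0 = 0) by (unfold u; rewrite rhoR; apply pw_zero).
  assert (wu : forall x, 0 <= x <= R0 -> w x = u x).
  { intros x Hx. unfold w. now rewrite clamp_id. }
  assert (Cw : forall x, continuity_pt w x).
  { apply continuity_pt_clamped; [lra|]. intros c Hc e He.
    destruct (Req_dec c 0) as [->|Hc0]; [|destruct (Req_dec c R0) as [->|HcR]].
    (* Tolerance [1] in the difference quotient gives [|rho y - 1| < y], and [u^2 + u + 1 >= 1]
       passes this bound on to the cube root. *)
    - destruct (filterlim_at_right_eps _ _ _ 1 Hlim0 Rlt_0_1) as [d [Hd Hd']].
      exists (Rmin d e). split; [now apply Rmin_glb_lt|]. intros y Hy Hyd.
      pose proof (Rmin_l d e). pose proof (Rmin_r d e).
      rewrite Rminus_0_r, Rabs_pos_eq in Hyd by lra.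
      destruct (Req_dec y 0) as [->|Hy0]; [rewrite Rminus_diag, Rabs_R0; exact He|].
      specialize (Hd' y ltac:(lra)). rewrite Rminus_0_r in Hd'. unfold Rdiv in Hd'.
      rewrite Rabs_mult, Rabs_inv, (Rabs_pos_eq y), rho0 in Hd' by lra.
      assert (Hr : Rabs (rho y - 1) < y).
      { apply Rmult_lt_reg_r with (/ y); [apply Rinv_0_lt_compat; lra|].
        rewrite Rinv_r by lra. exact Hd'. }
      rewrite u0. rewrite <- (u3 y Hy) in Hr.
      replace (u y ^ 3 - 1) with ((u y - 1) * (u y ^ 2 + u y + 1)) in Hr by ring.
      specialize (unn y). rewrite Rabs_mult, (Rabs_pos_eq (u y ^ 2 + u y + 1)) in Hr by nra.
      pose proof (Rabs_pos (u y - 1)). nra.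
    - destruct (filterlim_at_left_eps _ _ _ (e ^ 3) HlimR (pow_lt e 3 He)) as [d [Hd Hd']].
      exists d. split; [exact Hd|]. intros y Hy Hyd.
      destruct (Req_dec y R0) as [->|Hy0]; [rewrite Rminus_diag, Rabs_R0; exact He|].
      rewrite Rabs_left1 in Hyd by lra. specialize (Hd' y ltac:(lra)).
      rewrite Rminus_0_r in Hd'. rewrite Rabs_pos_eq in Hd' by (apply rnn; lra).
      rewrite uR, Rminus_0_r, Rabs_pos_eq by apply unn.
      rewrite <- (u3 y Hy) in Hd'. specialize (unn y).
      apply Rnot_le_lt. intros Hle. assert (e ^ 3 <= u y ^ 3) by (apply pow_incr; lra). lra.
    - destruct (Hode c ltac:(lra)) as [[l Hl] _].
      destruct (is_derive_continuity_pt _ _ _ Hl e He) as [d [Hd Hd']].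
      exists d. split; [exact Hd|]. intros y Hy Hyd.
      destruct (Req_dec y c) as [->|Hne]; [rewrite Rminus_diag, Rabs_R0; exact He|].
      apply Hd'. split; [split; [exact I|auto]|exact Hyd]. }
  exists w. split; [exact Cw|]. splits.
  - rewrite wu by lra. exact u0.
  - rewrite wu by lra. exact uR.
  - intros x Hx. rewrite wu by lra. apply pw_pos. now apply rpos.
  - intros x Hx. rewrite wu by exact Hx. now rewrite u3.
  - set (m x := RInt (fun y => y ^ 2 * w y ^ 3) 0 x).
    assert (Dm : forall x, is_derive m x (x ^ 2 * w x ^ 3)).
    { intros x. apply (is_derive_primitive (fun y => y ^ 2 * w y ^ 3)). intros; cpt. }
    assert (Cm : forall x, continuity_pt m x).
    { intros x. eapply is_derive_continuity_pt, Dm. }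
    assert (m0 : m 0 = 0) by exact (RInt_point 0 (fun y => y ^ 2 * w y ^ 3)).
    assert (Du : forall x, 0 < x < R0 -> is_derive u x (Derive u x)).
    { intros x Hx. apply Derive_correct. apply Hode; lra. }
    assert (DDu : forall x, 0 < x < R0 -> is_derive (Derive u) x (Derive (Derive u) x)).
    { intros x Hx. apply Derive_correct. apply (Hode x Hx). }
    set (F x := x ^ 2 * Derive u x + m x / 4 + delta * x ^ 3 / 4).
    assert (DF : forall x, 0 < x < R0 -> is_derive F x 0).
    { intros x Hx. destruct (Hode x Hx) as [_ [_ HO]].
      change (Derive_n u 2 x) with (Derive (Derive u) x) in HO.
      pose proof (DDu x Hx) as D2. pose proof (Dm x) as D3. unfold F. auto_derive.
      - splits; try exact I; eexists; eassumption.
      - rewrite (Derive_eta_unique _ _ _ D3).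
        change (Derive (fun x0 : R => Derive u x0) x) with (Derive (Derive u) x).
        rewrite wu, u3 by lra.
        replace (Derive (Derive u) x) with
          (- (2 / x * Derive u x + 1 / 4 * rho x + 3 / 4 * delta)) by lra.
        field. lra. }
    set (c := F (R0 / 2)).
    assert (HF : forall x, 0 < x < R0 -> F x = c).
    { assert (HF : forall x y, 0 < x < R0 -> 0 < y < R0 -> x <= y -> F y = F x).
      { intros x y Hx Hy Hxy. apply constant_of_derive; auto.
        - intros; apply DF; lra.
        - intros t Ht. eapply is_derive_continuity_pt. apply DF; lra. }
      intros x Hx. unfold c. destruct (Rle_lt_dec x (R0 / 2)).
      - symmetry; apply HF; lra.
      - apply HF; lra. }
    (* [u' - c / x^2] is bounded, hence so is [u + c / x] near the center. As [u] itself is bounded,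
       this yields [|c| <= D x] for all small [x]. *)
    assert (Hc : c = 0).
    { destruct (cont2_bounded (fun x _ => w x) 0 R0 0 0 (cont2_fst w Cw)) as [M [HM Mb]].
      assert (Hm : forall x, 0 < x < R0 -> Rabs (m x) <= M ^ 3 * R0 * x ^ 2).
      { intros x Hx. destruct (mvt_open m (fun x => x ^ 2 * w x ^ 3) 0 x) as [t [Ht1 Ht2]];
          [lra|intros; apply Dm|auto|].
        rewrite m0, !Rminus_0_r in Ht2. rewrite Ht2, !Rabs_mult, <- !RPow_abs, (Rabs_pos_eq t),
          (Rabs_pos_eq x) by lra.
        specialize (Mb t 0 ltac:(lra) ltac:(lra)). pose proof (Rabs_pos (w t)).
        replace (M ^ 3 * R0 * x ^ 2) with (x ^ 2 * M ^ 3 * R0) by ring.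
        apply Rmult_le_compat; try lra.
        - apply Rmult_le_pos; apply pow_le; lra.
        - apply Rmult_le_compat; try (apply pow_le; lra); apply pow_incr; lra. }
      set (K := (M ^ 3 * R0 + Rabs delta * R0) / 4).
      assert (HK : 0 <= K).
      { unfold K. pose proof (pow_lt M 3 HM). pose proof (Rabs_pos delta).
        assert (0 <= M ^ 3 * R0) by nra. assert (0 <= Rabs delta * R0) by nra. lra. }
      assert (HDb : forall x, 0 < x < R0 -> Rabs (Derive u x - c / x ^ 2) <= K).
      { intros x Hx. specialize (HF x Hx). unfold F in HF.
        replace (Derive u x - c / x ^ 2) with (- (m x / x ^ 2 / 4 + delta * x / 4))
          by (rewrite <- HF; field; lra).
        rewrite Rabs_Ropp. eapply Rle_trans; [apply Rabs_triang|].
        unfold Rdiv. rewrite !Rabs_mult, !Rabs_inv, (Rabs_pos_eq 4), (Rabs_pos_eq x),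
          (Rabs_pos_eq (x ^ 2)) by (try apply pow2_ge_0; lra).
        assert (Rabs (m x) * / x ^ 2 <= M ^ 3 * R0).
        { apply Rmult_le_reg_r with (x ^ 2); [apply pow_lt; lra|].
          rewrite Rmult_assoc, Rinv_l, Rmult_1_r by (apply pow_nonzero; lra). now apply Hm. }
        pose proof (Rabs_pos delta).
        assert (Rabs delta * x <= Rabs delta * R0) by (apply Rmult_le_compat_l; lra).
        unfold K. lra. }
      set (x1 := R0 / 2). set (D := 2 * M + Rabs c / x1 + K * R0).
      assert (HD : forall x, 0 < x < x1 -> Rabs c <= D * x).
      { intros x Hx. unfold x1 in Hx.
        destruct (mvt_open (fun x => u x + c / x) (fun x => Derive u x - c / x ^ 2) x x1)
          as [t [Ht1 Ht2]].
        - unfold x1; lra.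
        - intros t Ht. unfold x1 in Ht. pose proof (Du t ltac:(lra)) as D1. auto_derive.
          + splits; [eexists; eassumption|lra|exact I].
          + rewrite (Derive_eta_unique _ _ _ D1). field. lra.
        - intros t Ht. unfold x1 in Ht. pose proof (is_derive_continuity_pt _ _ _ (Du t ltac:(lra))).
          cpt. lra.
        - unfold x1 in Ht1. specialize (HDb t ltac:(lra)).
          assert (Hb1 : Rabs ((Derive u t - c / t ^ 2) * (x1 - x)) <= K * R0).
          { rewrite Rabs_mult. unfold x1. rewrite (Rabs_pos_eq (R0 / 2 - x)) by lra.
            apply Rmult_le_compat; try lra. apply Rabs_pos. }
          rewrite <- Ht2 in Hb1.
          pose proof (Mb x 0 ltac:(lra) ltac:(lra)) as B1. cbv beta in B1.
          pose proof (Mb x1 0 ltac:(unfold x1; lra) ltac:(lra)) as B2. cbv beta in B2.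
          rewrite wu in B1, B2 by (unfold x1; lra).
          assert (Hcx : Rabs (c / x) <= D).
          { replace (c / x) with (u x1 + - u x + c / x1 + - (u x1 + c / x1 - (u x + c / x))) by ring.
            eapply Rle_trans; [apply Rabs_triang|]. rewrite Rabs_Ropp.
            eapply Rle_trans; [apply Rplus_le_compat_r, Rabs_triang|].
            eapply Rle_trans; [apply Rplus_le_compat_r, Rplus_le_compat_r, Rabs_triang|].
            rewrite Rabs_Ropp. unfold D.
            replace (Rabs (c / x1)) with (Rabs c / x1).
            2: { unfold Rdiv. rewrite Rabs_mult, Rabs_inv, (Rabs_pos_eq x1) by (unfold x1; lra).
                 reflexivity. }
            lra. }
          unfold Rdiv in Hcx. rewrite Rabs_mult, Rabs_inv, (Rabs_pos_eq x) in Hcx by lra.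
          apply Rmult_le_compat_r with (r := x) in Hcx; [|lra].
          rewrite Rmult_assoc, Rinv_l, Rmult_1_r in Hcx by lra. exact Hcx. }
      assert (HD0 : 0 < D).
      { unfold D. assert (0 <= Rabs c / x1).
        { apply Rmult_le_pos; [apply Rabs_pos|left; apply Rinv_0_lt_compat; unfold x1; lra]. }
        assert (0 <= K * R0) by (apply Rmult_le_pos; lra). lra. }
      destruct (Req_dec c 0) as [|Hne]; auto. exfalso.
      pose proof (Rabs_pos_lt c Hne) as Hcp.
      set (x := Rmin (x1 / 2) (Rabs c / (2 * D))).
      assert (Hx : 0 < x).
      { apply Rmin_glb_lt; [unfold x1; lra|]. apply Rdiv_lt_0_compat; lra. }
      pose proof (Rmin_l (x1 / 2) (Rabs c / (2 * D))) as L1. fold x in L1.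
      pose proof (Rmin_r (x1 / 2) (Rabs c / (2 * D))) as L2. fold x in L2.
      specialize (HD x ltac:(unfold x1 in *; lra)).
      apply Rmult_le_compat_l with (r := D) in L2; [|lra].
      replace (D * (Rabs c / (2 * D))) with (Rabs c / 2) in L2 by (field; lra). lra. }
    intros x Hx.
    apply (is_derive_ext_loc u).
    { assert (He : 0 < Rmin x (R0 - x)) by (apply Rmin_glb_lt; lra).
      exists (mkposreal _ He). intros y Hy. symmetry; apply wu.
      change (Rabs (y - x) < Rmin x (R0 - x)) in Hy.
      pose proof (Rmin_l x (R0 - x)). pose proof (Rmin_r x (R0 - x)).
      apply Rabs_lt_between in Hy. lra. }
    eapply is_derive_eq; [now apply Du|].
    fold (m x). specialize (HF x Hx). rewrite Hc in HF. unfold F in HF.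
    apply Rmult_eq_reg_l with (x ^ 2); [|apply pow_nonzero; lra].
    replace (x ^ 2 * Derive u x) with (- m x / 4 - delta * x ^ 3 / 4) by lra.
    field. lra.
Qed.

(** [alpha^(3/2)] is the affine function [A + B t], so the self-similar time is
    [(ln (A + B t) - ln A) / B], of logarithmic but unbounded growth. The witness makes [A + B t]
    exceed [A exp (B S)]. *)
Lemma stime_unbounded (a0 delta S : R) : 0 < a0 -> delta < 0 ->
  exists T, 0 < T /\ forall t, T < t -> S < stime a0 delta t.
Proof.
  intros Ha Hd.
  set (A := pw a0 (3 / 2)). set (B := 3 / 2 * pw a0 (1 / 2) * sqrt (2 * Rabs delta / a0)).
  assert (HA : 0 < A) by now apply pw_pos.
  assert (HB : 0 < B).
  { unfold B. pose proof (pw_pos a0 (1 / 2) Ha). apply Rmult_lt_0_compat; [lra|].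
    apply sqrt_lt_R0. apply Rdiv_lt_0_compat; auto. rewrite Rabs_left; lra. }
  assert (Hs : forall t, 0 < t -> stime a0 delta t = (ln (A + B * t) - ln A) / B).
  { intros t Ht. unfold stime.
    assert (Hpos : forall s, 0 <= s -> 0 < A + B * s) by (intros; nra).
    transitivity (RInt (fun s => / (A + B * s)) 0 t).
    - apply RInt_ext_le; [lra|]. intros s Hs. unfold alpha. fold A B.
      specialize (Hpos s ltac:(lra)).
      rewrite (pw_pos_eq (pw _ _)) by now apply pw_pos.
      rewrite pw_pos_eq by exact Hpos. rewrite Rpower_mult.
      replace (2 / 3 * (- 3 / 2)) with (Ropp 1) by field.
      rewrite Rpower_Ropp, Rpower_1 by exact Hpos. reflexivity.
    - apply is_RInt_unique.
      replace ((ln (A + B * t) - ln A) / B) with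
        (minus ((fun s => ln (A + B * s) / B) t) ((fun s => ln (A + B * s) / B) 0)).
      2: { unfold minus, plus, opp; simpl. rewrite Rmult_0_r, Rplus_0_r. field. lra. }
      apply (is_RInt_derive (fun s => ln (A + B * s) / B) (fun s => / (A + B * s))).
      + intros s Hs. rewrite Rmin_left, Rmax_right in Hs by lra. specialize (Hpos s ltac:(lra)).
        auto_derive; [exact Hpos|]. field. lra.
      + intros s Hs. rewrite Rmin_left, Rmax_right in Hs by lra. specialize (Hpos s ltac:(lra)).
        apply continuity_pt_continuous. apply (continuity_pt_inv (fun s => A + B * s)); [|lra].
        cpt. }
  exists (Rmax 1 (A * exp (B * S) / B)). split.
  { eapply Rlt_le_trans; [apply Rlt_0_1|apply Rmax_l]. }
  intros t Ht. pose proof (Rmax_l 1 (A * exp (B * S) / B)).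
  pose proof (Rmax_r 1 (A * exp (B * S) / B)).
  rewrite Hs by lra. apply Rmult_lt_reg_r with B; [exact HB|].
  replace ((ln (A + B * t) - ln A) / B * B) with (ln (A + B * t) - ln A) by (field; lra).
  assert (Hlt : A * exp (B * S) < A + B * t).
  { assert (A * exp (B * S) / B < t) by lra.
    apply Rmult_lt_compat_r with (r := B) in H1; [|exact HB].
    replace (A * exp (B * S) / B * B) with (A * exp (B * S)) in H1 by (field; lra). lra. }
  apply ln_increasing in Hlt; [|apply Rmult_lt_0_compat; [exact HA|apply exp_pos]].
  rewrite ln_mult, ln_exp in Hlt by (auto; apply exp_pos). lra.
Qed.

(** * From the clamped solution to the theorem *)

Lemma supnorm_gt (L e : R) (f : R -> R) (x : R) : 0 <= x <= L -> e < Rabs (f x) ->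
  Rbar_lt (Finite e) (supnorm L f).
Proof.
  intros Hx He. unfold supnorm.
  destruct (Lub_Rbar_correct (fun v => exists x, 0 <= x <= L /\ v = Rabs (f x))) as [Hub _].
  apply Rbar_lt_le_trans with (Finite (Rabs (f x))); [exact He|].
  apply Hub. now exists x.
Qed.

Lemma cont2_clamped (f : R -> R -> R) (L : R) : cont2 f ->
  cont2 (fun x s => f (clamp 0 L x) (Rmax 0 s)).
Proof.
  intros Hf x s e. destruct (Hf (clamp 0 L x) (Rmax 0 s) e) as [d Hd].
  exists d. intros u v Hu Hv. apply Hd.
  - eapply Rle_lt_trans; [apply clamp_lipschitz|exact Hu].
  - eapply Rle_lt_trans; [|exact Hv].
    destruct (Rmax_spec 0 v) as [[? ->]|[? ->]], (Rmax_spec 0 s) as [[? ->]|[? ->]];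
      unfold Rabs; repeat destruct Rcase_abs; lra.
Qed.

Lemma clamped_dx (f : R -> R -> R) (L x s l : R) : 0 < x < L ->
  is_derive (fun y => f y (Rmax 0 s)) x l ->
  is_derive (fun y => f (clamp 0 L y) (Rmax 0 s)) x l.
Proof.
  intros Hx Hd. apply (is_derive_ext_loc (fun y => f y (Rmax 0 s))); [|exact Hd].
  assert (He : 0 < Rmin x (L - x)) by (apply Rmin_glb_lt; lra).
  exists (mkposreal _ He). intros y Hy.
  change (Rabs (y - x) < Rmin x (L - x)) in Hy.
  pose proof (Rmin_l x (L - x)). pose proof (Rmin_r x (L - x)).
  apply Rabs_lt_between in Hy. rewrite clamp_id by lra. reflexivity.
Qed.

Lemma clamped_ds (f : R -> R) (s l : R) : 0 < s ->
  is_derive f s l -> is_derive (fun t => f (Rmax 0 t)) s l.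
Proof.
  intros Hs Hd. apply (is_derive_ext_loc f); [|exact Hd].
  exists (mkposreal s Hs). intros t Ht. change (Rabs (t - s) < s) in Ht.
  apply Rabs_lt_between in Ht. rewrite Rmax_right by lra. reflexivity.
Qed.

Lemma smooth2_schwarz (f : R -> R -> R) (x s : R) : smooth2 f ->
  pds (pdx f) x s = pdx (pds f) x s.
Proof.
  intros Hf. symmetry. apply (Schwarz f x s).
  - exists (mkposreal 1 Rlt_0_1). intros u v _ _.
    splits; [apply (Hf nil u v)|apply (Hf nil u v)|apply (Hf (Defs.Ds :: nil)%list u v)|
      apply (Hf (Defs.Dx :: nil)%list u v)].
  - apply (Hf (Defs.Dx :: Defs.Ds :: nil)%list x s).
  - apply (Hf (Defs.Ds :: Defs.Dx :: nil)%list x s).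
Qed.

Theorem theorem1p1
  (mu delta a0 R0 : R) (rho : R -> R) (phi : R -> R -> R) (phi0 phi1 : R -> R) :
  0 < mu -> delta < 0 -> 0 < a0 -> 0 < R0 ->
  (* the Lane-Emden-type profile rho, with first zero R0 *)
  rho 0 = 1 ->
  filterlim (fun y => (rho y - rho 0) / y) (at_right 0) (locally 0) ->
  (forall y, 0 <= y < R0 -> 0 < rho y) ->
  rho R0 = 0 ->
  filterlim rho (at_left R0) (locally 0) ->
  (forall y, 0 < y < R0 ->
     ex_derive (fun z => pw (rho z) (1/3)) y /\
     ex_derive (Derive (fun z => pw (rho z) (1/3))) y /\
     Derive_n (fun z => pw (rho z) (1/3)) 2 y
       + 2 / y * Derive (fun z => pw (rho z) (1/3)) y
       + 1/4 * rho y + 3/4 * delta = 0) ->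
  (* phi is a smooth solution with phi > -1 *)
  smooth2 phi ->
  (forall x s, 0 <= x <= R0 -> 0 <= s -> -1 < phi x s) ->
  (forall x s, 0 <= x <= R0 -> 0 <= s -> 0 < 1 + phi x s + x * pdx phi x s) ->
  (forall x s, 0 < x < R0 -> 0 < s -> pert_eq mu delta a0 R0 rho phi x s) ->
  (forall s, 0 <= s -> Bbar mu phi R0 s = 0) ->
  (forall x, 0 <= x <= R0 -> phi x 0 = phi0 x /\ pds phi x 0 = phi1 x) ->
  (forall x, 0 <= x <= R0 -> -1 < phi0 x) ->
  ( (* (1) homogeneous perturbation off the zero-energy curve *)
    (exists c0 c1, (forall x, 0 <= x <= R0 -> phi0 x = c0 /\ phi1 x = c1) /\
       c1 <> - bconst delta * (1 + c0) + bconst delta * pw (1 + c0) (-1/2))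
    \/
    (* (2) nonpositive energy, inhomogeneous perturbation *)
    (energy0 delta a0 R0 rho phi0 phi1 <= 0 /\
     ~ (exists c0 c1, forall x, 0 <= x <= R0 -> phi0 x = c0 /\ phi1 x = c1)) ) ->
  forall eps0, 0 < eps0 < 1/2 ->
  exists T, 0 < T /\ forall t, T < t ->
    (* max{ ||phi(s(t))||_inf , ||x phi_x(s(t))||_inf } > eps0 *)
    (Rbar_lt (Finite eps0) (supnorm R0 (fun x => phi x (stime a0 delta t)))
     \/ Rbar_lt (Finite eps0)
           (supnorm R0 (fun x => x * pdx phi x (stime a0 delta t)))).
Proof.
  intros Hmu Hdelta Ha0 HR rho0 Hlim0 rpos rhoR HlimR Hode Hsm Hphi Hq Hpert HB Hinit Hphi0 Hcase
    eps0 Heps.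
  destruct (lane_emden_profile delta R0 rho HR rho0 Hlim0 rpos rhoR HlimR Hode)
    as [w [Cw [w0 [wR [wpos [rw Dw]]]]]].
  set (k := - delta). set (b := bconst delta).
  assert (Hk : 0 < k) by (unfold k; lra).
  assert (Habs : Rabs delta = k) by (unfold k; rewrite Rabs_left; lra).
  assert (Hbd : b = sqrt (2 * Rabs delta)) by reflexivity.
  assert (Hb2 : b ^ 2 = 2 * k).
  { rewrite Hbd, Habs. simpl. rewrite Rmult_1_r. apply sqrt_sqrt. lra. }
  assert (Hb : 0 < b).
  { rewrite Hbd, Habs. apply sqrt_lt_R0. lra. }
  (* Clamping the arguments makes [p] and [q] positive on the whole plane. *)
  set (p x s := 1 + phi (clamp 0 R0 x) (Rmax 0 s)).
  set (px x s := pdx phi (clamp 0 R0 x) (Rmax 0 s)).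
  set (ps x s := pds phi (clamp 0 R0 x) (Rmax 0 s)).
  set (pxs x s := pdx (pds phi) (clamp 0 R0 x) (Rmax 0 s)).
  set (pss x s := pds (pds phi) (clamp 0 R0 x) (Rmax 0 s)).
  set (q x s := p x s + clamp 0 R0 x * px x s).
  set (a s := pw a0 (5/2) * exp (5/2 * b * s)).
  assert (Hin : forall x, 0 <= clamp 0 R0 x <= R0) by (intros; apply clamp_in; lra).
  assert (Hmax : forall s, 0 <= Rmax 0 s) by (intros; apply Rmax_l).
  assert (Hc2 : forall l, cont2 (fun x s => iterD l phi (clamp 0 R0 x) (Rmax 0 s))).
  { intros l. apply cont2_clamped. intros x s. apply (Hsm l x s). }
  assert (Cp : cont2 p).
  { pose proof (Hc2 nil) as H. simpl in H. unfold p. cont2_auto. }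
  assert (Cpx : cont2 px) by exact (Hc2 (Defs.Dx :: nil)%list).
  assert (Cps : cont2 ps) by exact (Hc2 (Defs.Ds :: nil)%list).
  assert (Cpxs : cont2 pxs) by exact (Hc2 (Defs.Dx :: Defs.Ds :: nil)%list).
  assert (Cpss : cont2 pss) by exact (Hc2 (Defs.Ds :: Defs.Ds :: nil)%list).
  assert (Cq : cont2 q).
  { pose proof (continuity_pt_clamp 0 R0). unfold q. cont2_auto. }
  assert (Ca : forall s, continuity_pt a s).
  { intros s. apply derivable_continuous_pt.
    exists (pw a0 (5/2) * (5/2 * b * exp (5/2 * b * s))). apply is_derive_Reals.
    unfold a. auto_derive; [exact I|ring]. }
  assert (Hapos : forall s, 0 < a s).
  { intros s. apply Rmult_lt_0_compat; [now apply pw_pos|apply exp_pos]. }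
  assert (Hppos : forall x s, 0 < p x s).
  { intros x s. specialize (Hphi _ _ (Hin x) (Hmax s)). unfold p. lra. }
  assert (Hqpos : forall x s, 0 < q x s).
  { intros x s. apply (Hq _ _ (Hin x) (Hmax s)). }
  assert (Hqeq : forall x s, 0 <= x <= R0 -> q x s = p x s + x * px x s).
  { intros x s Hx. unfold q. now rewrite clamp_id. }
  assert (Hval : forall (f : R -> R -> R) x s, 0 <= x <= R0 -> 0 <= s ->
     f (clamp 0 R0 x) (Rmax 0 s) = f x s).
  { intros f x s Hx Hs. now rewrite clamp_id, Rmax_right. }
  assert (Hderx : forall l x s, 0 < x < R0 ->
    is_derive (fun y => iterD l phi (clamp 0 R0 y) (Rmax 0 s)) x
      (pdx (iterD l phi) (clamp 0 R0 x) (Rmax 0 s))).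
  { intros l x s Hx. rewrite (clamp_id 0 R0 x) by lra. apply clamped_dx; [exact Hx|].
    apply Derive_correct. apply (Hsm l x (Rmax 0 s)). }
  assert (Hders : forall l x s, 0 < s ->
    is_derive (fun t => iterD l phi (clamp 0 R0 x) (Rmax 0 t)) s
      (pds (iterD l phi) (clamp 0 R0 x) (Rmax 0 s))).
  { intros l x s Hs. rewrite (Rmax_right 0 s) by lra.
    apply (clamped_ds (fun t => iterD l phi (clamp 0 R0 x) t)); [exact Hs|].
    apply Derive_correct. apply (Hsm l (clamp 0 R0 x) s). }
  assert (Dpx : forall x s, 0 < x < R0 -> is_derive (fun x => p x s) x (px x s)).
  { intros x s Hx. eapply is_derive_eq.
    - apply (is_derive_plus (fun _ => 1) (fun y => phi (clamp 0 R0 y) (Rmax 0 s))).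
      + apply (is_derive_const 1).
      + apply (Hderx nil x s Hx).
    - apply Rplus_0_l. }
  assert (Dps : forall x s, 0 < s -> is_derive (fun s => p x s) s (ps x s)).
  { intros x s Hs. eapply is_derive_eq.
    - apply (is_derive_plus (fun _ => 1) (fun t => phi (clamp 0 R0 x) (Rmax 0 t))).
      + apply (is_derive_const 1).
      + apply (Hders nil x s Hs).
    - apply Rplus_0_l. }
  assert (Dpsx : forall x s, 0 < x < R0 -> is_derive (fun x => ps x s) x (pxs x s)).
  { intros x s Hx. apply (Hderx (Defs.Ds :: nil)%list x s Hx). }
  assert (Dpss : forall x s, 0 < s -> is_derive (fun s => ps x s) s (pss x s)).
  { intros x s Hs. apply (Hders (Defs.Ds :: nil)%list x s Hs). }
  (* [pxs] is stored as the [x]-derivative of [ps]; equality of mixed derivatives makes it the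
     [s]-derivative of [px] as well. *)
  assert (Dpxs : forall x s, 0 < s -> is_derive (fun s => px x s) s (pxs x s)).
  { intros x s Hs. unfold pxs. rewrite <- smooth2_schwarz by exact Hsm.
    apply (Hders (Defs.Dx :: nil)%list x s Hs). }
  assert (Epx : forall x s, 0 < x < R0 -> ex_derive (fun x => px x s) x).
  { intros x s Hx. eexists. apply (Hderx (Defs.Dx :: nil)%list x s Hx). }
  assert (Epxs : forall x s, 0 < x < R0 -> ex_derive (fun x => pxs x s) x).
  { intros x s Hx. eexists. apply (Hderx (Defs.Dx :: Defs.Ds :: nil)%list x s Hx). }
  assert (Hloc : forall x, 0 < x < R0 -> locally x (fun y => 0 < y < R0)).
  { intros x Hx. assert (He : 0 < Rmin x (R0 - x)) by (apply Rmin_glb_lt; lra).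
    exists (mkposreal _ He). intros y Hy.
    change (Rabs (y - x) < Rmin x (R0 - x)) in Hy.
    pose proof (Rmin_l x (R0 - x)). pose proof (Rmin_r x (R0 - x)).
    apply Rabs_lt_between in Hy. lra. }
  assert (Hrho : forall y s, 0 <= y <= R0 -> 0 <= s ->
    pw (rho y / ((1 + phi y s) ^ 2 * (1 + phi y s + y * pdx phi y s))) (4 / 3)
    = w y ^ 4 * zeta p q y s ^ 4).
  { intros y s Hy Hs.
    replace (1 + phi y s) with (p y s) by (unfold p; now rewrite Hval).
    replace (pdx phi y s) with (px y s) by (unfold px; now rewrite Hval).
    rewrite <- Hqeq, rw by exact Hy.
    pose proof (zeta_cube p q Hppos Hqpos y s) as Hz.
    pose proof (zeta_pos p q y s). specialize (Hppos y s). specialize (Hqpos y s).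
    replace (w y ^ 3 / (p y s ^ 2 * q y s)) with ((w y * zeta p q y s) ^ 3).
    - rewrite pw_of_cube_four_thirds; [ring|]. apply Rmult_le_pos; [|lra].
      destruct (Req_dec y R0) as [->|Hne]; [lra|]. left; apply wpos; lra.
    - transitivity (w y ^ 3 * (zeta p q y s ^ 3 * p y s ^ 2 * q y s) / (p y s ^ 2 * q y s)).
      + field. split; lra.
      + rewrite Hz. now rewrite Rmult_1_r. }
  assert (Hrho' : forall y, 0 <= y <= R0 -> pw (rho y) (4 / 3) = w y ^ 4).
  { intros y Hy. rewrite rw by exact Hy. apply pw_of_cube_four_thirds.
    destruct (Req_dec y R0) as [->|Hne]; [lra|left; apply wpos; lra]. }
  assert (Hvisc : forall y s, 0 <= y <= R0 -> 0 <= s -> Bbar mu phi y s = visc mu p px ps pxs q y s).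
  { intros y s Hy Hs. unfold Bbar, visc, shear.
    replace (1 + phi y s) with (p y s) by (unfold p; now rewrite Hval).
    replace (pdx phi y s) with (px y s) by (unfold px; now rewrite Hval).
    replace (pds phi y s) with (ps y s) by (unfold ps; now rewrite Hval).
    replace (pdx (pds phi) y s) with (pxs y s) by (unfold pxs; now rewrite Hval).
    pose proof (Hqpos y s) as Hqy. pose proof (Hppos y s).
    rewrite Hqeq in Hqy |- * by exact Hy. field. split; lra. }
  assert (Hmom : forall x s, 0 < x < R0 -> 0 < s ->
    is_derive (fun x => w x ^ 4 * zeta p q x s ^ 4 - a s * visc mu p px ps pxs q x s) x
    (4 * mu * a s * shear p px ps pxs x s
     - x * w x ^ 3 * ((pss x s + b / 2 * ps x s) / p x s ^ 2 - k / p x s)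
     - w x ^ 3 * mass w x / (x ^ 2 * p x s ^ 4))).
  { intros x s Hx Hs. specialize (Hpert x s Hx Hs). unfold pert_eq in Hpert. fold b in Hpert.
    assert (Dwx : ex_derive w x) by (eexists; now apply Dw).
    assert (Dp : ex_derive (fun x => p x s) x) by (eexists; now apply Dpx).
    assert (Dq : ex_derive (fun x => q x s) x).
    { apply (ex_derive_ext_loc (fun x => p x s + x * px x s)).
      - eapply filter_imp; [|now apply Hloc]. intros y Hy. symmetry; apply Hqeq; lra.
      - apply (ex_derive_plus (fun x => p x s) (fun x => x * px x s)); [exact Dp|].
        apply (ex_derive_mult (fun x => x)); [apply ex_derive_id|now apply Epx]. }
    (* [Derive] is total, so [pert_eq] becomes a statement with [is_derive] only once the pressure
       and the viscous term are each known to be differentiable. *)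
    assert (D1 : ex_derive (fun x => w x ^ 4 * zeta p q x s ^ 4) x).
    { apply (ex_derive_mult (fun x => w x ^ 4) (fun x => zeta p q x s ^ 4)).
      - apply (ex_derive_pow w 4). exact Dwx.
      - apply (ex_derive_pow (fun x => zeta p q x s) 4).
        apply (zeta_ex_dx R0 p px q); auto. }
    assert (D2 : ex_derive (fun x => visc mu p px ps pxs q x s) x).
    { pose proof (Epx x s Hx) as Hpx. pose proof (Epxs x s Hx) as Hpxs.
      assert (Hps : ex_derive (fun x => ps x s) x) by (eexists; now apply Dpsx).
      pose proof (Hppos x s). pose proof (Hqpos x s).
      unfold visc, shear. auto_derive. splits; try assumption; try lra.
      apply (pow_nonzero (p x s) 2). lra. }
    assert (E1 : Derive (fun y => pw (rho y / ((1 + phi y s) ^ 2 * (1 + phi y s + y * pdx phi y s)))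
                        (4/3)) x = Derive (fun x => w x ^ 4 * zeta p q x s ^ 4) x).
    { apply Derive_ext_loc. eapply filter_imp; [|now apply Hloc]. intros y Hy. apply Hrho; lra. }
    (* [(w^4)_x = 4 w^3 w_x] with the integrated profile equation; this is how [mass] enters the
       momentum equation. *)
    assert (E2 : Derive (fun y => pw (rho y) (4/3)) x = w x ^ 3 * (k * x - mass w x / x ^ 2)).
    { transitivity (Derive (fun y => w y ^ 4) x).
      - apply Derive_ext_loc. eapply filter_imp; [|now apply Hloc]. intros y Hy. apply Hrho'; lra.
      - apply is_derive_unique. apply is_derive_eq with
          (INR 4 * ((- delta * x - RInt (fun y => y ^ 2 * w y ^ 3) 0 x / x ^ 2) / 4) * w x ^ 3).
        + exact (is_derive_pow w 4 x _ (Dw x Hx)).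
        + fold (mass w x). unfold k. simpl. field. lra. }
    assert (E3 : Derive (fun y => Bbar mu phi y s) x = Derive (fun x => visc mu p px ps pxs q x s) x).
    { apply Derive_ext_loc. eapply filter_imp; [|now apply Hloc]. intros y Hy. apply Hvisc; lra. }
    assert (E4 : Derive (fun y => pds phi y s / (1 + phi y s)) x = shear p px ps pxs x s).
    { transitivity (Derive (fun y => ps y s / p y s) x).
      - apply Derive_ext_loc. eapply filter_imp; [|now apply Hloc]. intros y Hy.
        unfold ps, p. rewrite !Hval by lra. reflexivity.
      - apply is_derive_unique. eapply is_derive_eq.
        + apply (is_derive_div (fun y => ps y s) (fun y => p y s)).
          * now apply Dpsx.
          * now apply Dpx.
          * specialize (Hppos x s). lra.
        + reflexivity. }
    rewrite E1, E2, E3, E4, Habs, rw in Hpert by lra.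
    replace (1 + phi x s) with (p x s) in Hpert by (unfold p; rewrite Hval by lra; reflexivity).
    replace (pds phi x s) with (ps x s) in Hpert by (unfold ps; rewrite Hval by lra; reflexivity).
    replace (pds (pds phi) x s) with (pss x s) in Hpert by (unfold pss; rewrite Hval by lra; reflexivity).
    fold (a s) in Hpert.
    apply is_derive_eq with (Derive (fun x => w x ^ 4 * zeta p q x s ^ 4) x
       - a s * Derive (fun x => visc mu p px ps pxs q x s) x).
    - apply (is_derive_minus (fun x => w x ^ 4 * zeta p q x s ^ 4)
        (fun x => a s * visc mu p px ps pxs q x s)).
      + now apply Derive_correct.
      + apply (is_derive_scal (fun x => visc mu p px ps pxs q x s)). now apply Derive_correct.
    - specialize (Hppos x s).
      match type of Hpert with ?l + ?m - ?r = ?u =>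
        match l with ?l1 + ?l2 =>
          replace (Derive (fun x => w x ^ 4 * zeta p q x s ^ 4) x) with (u + r - l) by lra
        end end.
      field. lra. }
  assert (Hbdry : forall s, 0 < s -> visc mu p px ps pxs q R0 s = 0).
  { intros s Hs. rewrite <- Hvisc by lra. apply HB. lra. }
  assert (Hexit : exists S, forall s, S < s -> 0 <= s /\
    exists x, 0 <= x <= R0 /\ (p x s < 1 / 2 \/ 3 / 2 < p x s)).
  { assert (Hp0 : forall x, 0 <= x <= R0 -> p x 0 = 1 + phi0 x).
    { intros x Hx. unfold p. rewrite Hval by lra. now rewrite (proj1 (Hinit x Hx)). }
    assert (Hps0 : forall x, 0 <= x <= R0 -> ps x 0 = phi1 x).
    { intros x Hx. unfold ps. rewrite Hval by lra. apply (Hinit x Hx). }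
    (* [phi0] is tied to [phi] on [[0, R0]] only, so the derivatives are identified at interior
       points. *)
    assert (Hpx0 : forall x, 0 < x < R0 -> px x 0 = Derive phi0 x).
    { intros x Hx. unfold px. rewrite Hval by lra. apply Derive_ext_loc.
      eapply filter_imp; [|now apply Hloc]. intros y Hy. apply Hinit. lra. }
    destruct Hcase as [[c0 [c1 [Hc Hoff]]]|[HE Hinh]].
    - assert (Hc0 : -1 < c0).
      { destruct (Hc 0 ltac:(lra)) as [<- _]. apply Hphi0. lra. }
      (* [y0 = (1 + c0)^(-1/2)] satisfies [y0^2 * p 0 0 = 1], and [- b p + b y0] is then the
         velocity on the zero-energy curve. *)
      apply (homogeneous_exit R0 k b mu w a p px ps pxs pss q) with (y0 := pw (1 + c0) (-1/2)); auto.
      + intros x Hx. rewrite !Hp0, !Hps0 by lra.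
        destruct (Hc x Hx) as [-> ->]. destruct (Hc 0 ltac:(lra)) as [-> ->]. auto.
      + intros x Hx. rewrite Hpx0 by exact Hx.
        apply is_derive_unique. apply (is_derive_ext_loc (fun _ => c0)).
        * eapply filter_imp; [|now apply Hloc]. intros y Hy. symmetry. apply Hc. lra.
        * apply (is_derive_const c0).
      + apply pw_pos. lra.
      + rewrite Hp0 by lra. destruct (Hc 0 ltac:(lra)) as [-> _].
        rewrite pw_pos_eq by lra. rewrite <- Rpower_pow by apply exp_pos.
        rewrite Rpower_mult. replace (-1 / 2 * INR 2) with (Ropp 1) by (simpl; field).
        rewrite Rpower_Ropp, Rpower_1 by lra. field. lra.
      + rewrite Hp0, Hps0 by lra. destruct (Hc 0 ltac:(lra)) as [-> ->]. exact Hoff.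
    - destruct (nonpositive_energy_exit R0 k b mu w a p px ps pxs pss q) as [S HS]; auto.
      (* The factor [a0 > 0] does not affect the sign, so the hypothesis on [energy0] becomes
         [energy 0 <= 0]. *)
      + assert (HE' : energy R0 k b w p px ps q 0 = a0 * energy0 delta a0 R0 rho phi0 phi1).
        { assert (Cz : cont2 (zeta p q)) by now apply zeta_cont.
          assert (Hpn : forall x s, p x s <> 0).
          { intros x s. specialize (Hppos x s). lra. }
          unfold energy, energy0. rewrite Rmult_0_r, exp_0, Rmult_1_l, Rmult_plus_distr_l.
          rewrite <- !Rmult_assoc, Rinv_r, !Rmult_1_l by lra.
          unfold energy_density. rewrite RInt_plus_cont.
          - f_equal; apply RInt_ext_le; try lra; intros x Hx.
            + rewrite Hp0, Hps0, rw by lra. rewrite <- Hbd.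
              replace delta with (- k) by (unfold k; ring).
              replace k with (b ^ 2 / 2) by lra.
              specialize (Hphi0 x ltac:(lra)).
              match goal with |- ?l = ?r => change (@eq R l r) end.
              field. lra.
            + rewrite <- Hpx0 by exact Hx. rewrite Hrho', <- Hp0, <- Hqeq by lra.
              pose proof (zeta_cube p q Hppos Hqpos x 0) as Hz.
              pose proof (zeta_pos p q x 0). specialize (Hppos x 0). specialize (Hqpos x 0).
              replace (p x 0 ^ 2 * q x 0) with ((/ zeta p q x 0) ^ 3).
              * rewrite pw_of_cube_third by (left; now apply Rinv_0_lt_compat).
                replace (3 / / zeta p q x 0) with (3 * zeta p q x 0) by (field; lra). reflexivity.
              * rewrite pow_inv. apply Rmult_eq_reg_l with (zeta p q x 0 ^ 3).
                -- rewrite Rinv_r, <- Rmult_assoc by (apply pow_nonzero; lra). now rewrite Hz.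
                -- apply pow_nonzero; lra.
          - apply (cont2_slice1 (fun x s => x ^ 4 * w x ^ 3 * ((ps x s + b * p x s) ^ 2 / 2 - k / p x s)) 0).
            cont2_auto; auto.
          - apply (cont2_slice1 (fun x s => x ^ 2 * w x ^ 4 *
              (3 * zeta p q x s - 3 / p x s + x * px x s / p x s ^ 2)) 0).
            cont2_auto; auto. intros x s. apply pow_nonzero, Hpn. }
        rewrite HE'. nra.
      + intros Hhom. apply Hinh. exists (phi0 0), (phi1 0). intros x Hx.
        destruct (Hhom x Hx) as [H1 H2]. rewrite !Hp0 in H1 by lra. rewrite !Hps0 in H2 by lra.
        split; lra.
      + exists S. intros s Hs. destruct (HS s Hs) as [H0 [x [Hx Hpx']]]. split; [exact H0|].
        exists x. auto. }
  destruct Hexit as [S HS].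
  destruct (stime_unbounded a0 delta S Ha0 Hdelta) as [T [HT HTS]].
  (* [p < 1/2] means [phi < - 1/2] and [p > 3/2] means [phi > 1/2]; either one beats every
     [eps0 < 1/2]. *)
  exists T. split; [exact HT|]. intros t Ht. left.
  destruct (HS _ (HTS t Ht)) as [Hs [x [Hx Hpx]]].
  apply supnorm_gt with x; [exact Hx|].
  unfold p in Hpx. rewrite Hval in Hpx by auto.
  unfold Rabs. destruct Rcase_abs; destruct Hpx; lra.
Qed.
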